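(* Let $(M^4,g,I)$ be a Hermitian $4$-manifold with K\''ahler form $\omega_I$ and Lee form $\theta$. Then $(M^4,g,I)$ admits, around each point, a closed $5$-frame (compatible with $(g,I)$) if and only if the curvature $\widetilde R$ of its canonical Hermitian connection is $$\widetilde R=-\frac14\,d(I\theta)\otimes\omega_I .$$
   Context: Hermitian: $g$ is a Riemannian metric and $I$ an integrable complex structure with $g(I\cdot,I\cdot)=g$. Set $\omega_I=g(I\cdot,\cdot)$, and orient $M$ so that $\omega_I$ is selfdual. $I$ acts on $p$-forms by $(I\alpha)(X_1,\dots,X_p)=\alpha(IX_1,\dots,IX_p)$, so $(I\theta)(X)=\theta(IX)$. The Lee form $\theta$ is defined by $d\omega_I=\theta\wedge\omega_I$. With $\nabla$ the Levi-Civita connection, the canonical Hermitian connection is $\widetilde\nabla_XY=\nabla_XY+\frac12(\nabla_XI)IY$, with curvature $\widetilde R(X,Y)=-[\widetilde\nabla_X,\widetilde\nabla_Y]+\widetilde\nabla_{[X,Y]}$. Skew endomorphisms $A$ are identified with $2$-forms $g(A\cdot,\cdot)$, so $\widetilde R$ is a $2$-form with values in $2$-forms and $(\beta\otimes\omega_I)(X,Y)=\beta(X,Y)\,\omega_I$. A $5$-frame is a set of five non-degenerate $2$-forms with $\omega_i\wedge\omega_j=\pm\delta_{ij}\,\omega_5\wedge\omega_5$ for $i,j=1,\dots,5$; it is closed if all $\omega_i$ are closed. Compatible with $(g,I)$ means: the $\omega_i$ are $g$-orthonormal (inner product normalised so that $\omega_I$ has unit length), $\omega_1,\omega_2,\omega_3$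 span the anti-selfdual forms $\Lambda^-$, and $\omega_4,\omega_5$ are selfdual and $I$-anti-invariant, i.e. $\omega_k(I\cdot,I\cdot)=-\omega_k$ for $k=4,5$ (equivalently, up to the sign of $\omega_5$, $\omega_5=\omega_4(I\cdot,\cdot)$). Flat metrics are allowed here. *)

(* Defs.v *)
From HB Require Import structures.
From mathcomp Require Import all_boot all_order all_algebra.
From mathcomp Require Import all_classical all_reals all_analysis.

Set Implicit Arguments.
Unset Strict Implicit.
Unset Printing Implicit Defensive.

Import Order.TTheory GRing.Theory Num.Theory.
Import numFieldNormedType.Exports.

Local Open Scope classical_set_scope.
Local Open Scope ring_scope.

(* Points of R^n and tangent vectors are row vectors, covectors are columns.
   In local coordinates, with d_i the coordinate fields:
   - an endomorphism field I has entries I(d_i) = \sum_j I_ij d_j, so that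
     the image of a vector u is u *m I;
   - a covariant 2-tensor b has entries b_ij = b(d_i, d_j). *)

Section Calculus.
Context {R : realType} {n : nat}.
Implicit Types (D : set 'rV[R]_n) (f : 'rV[R]_n -> R).

Definition pd (i : 'I_n) f : 'rV[R]_n -> R := 'D_(delta_mx 0 i) f.

Definition pds (s : seq 'I_n) f : 'rV[R]_n -> R := foldr pd f s.

(* Only meaningful for D open: the partial derivatives of all orders exist and
   are continuous at every point of D. *)
Definition smooth_on D f : Prop :=
  forall (s : seq 'I_n) x, D x ->
    {for x, continuous (pds s f)} /\
    (forall i, derivable (pds s f) x (delta_mx 0 i)).

Definition smooth_mx_on p q D (F : 'rV[R]_n -> 'M[R]_(p, q)) : Prop :=
  forall i j, smooth_on D (fun x => F x i j).

End Calculus.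

Record manifold (R : realType) (n : nat) (M : topologicalType) := Manifold {
  chart : Type;
  chart_dom : chart -> set M;
  chart_map : chart -> M -> 'rV[R]_n;
  chart_inv : chart -> 'rV[R]_n -> M;
  _ : hausdorff_space M;
  _ : @second_countable M;
  _ : forall p, exists c, chart_dom c p;
  _ : forall c, open (chart_dom c);
  _ : forall c, open (chart_map c @` chart_dom c);
  _ : forall c p, chart_dom c p -> chart_inv c (chart_map c p) = p;
  _ : forall c, {within chart_dom c, continuous (chart_map c)};
  _ : forall c, {within chart_map c @` chart_dom c, continuous (chart_inv c)};
  _ : forall c c', smooth_mx_on
        (chart_map c @` (chart_dom c `&` chart_dom c'))
        (fun x => chart_map c' (chart_inv c x))
}.

(* A tensor field on an open set U of M is a family, indexed by the charts, of
   component functions on the images of U in R^n, which are smooth and obey the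
   usual transformation law on overlaps. *)
Section Tensors.
Context {R : realType} {n : nat} {M : topologicalType}.
Variable A : manifold R n M.
Implicit Types (U : set M) (c : chart A).

Definition coord_dom U c : set 'rV[R]_n :=
  chart_map c @` (chart_dom c `&` U).

Definition transition c c' (x : 'rV[R]_n) : 'rV[R]_n :=
  chart_map c' (chart_inv c x).

(* d_i = \sum_j jacobian_ij d'_j *)
Definition jacobian c c' (x : 'rV[R]_n) : 'M[R]_n :=
  \matrix_(i, j) pd i (fun y => transition c c' y 0 j) x.

Definition covector_field U (a : chart A -> 'rV[R]_n -> 'cV[R]_n) : Prop :=
  (forall c, smooth_mx_on (coord_dom U c) (a c)) /\
  (forall c c' x, coord_dom (U `&` chart_dom c') c x ->
     a c x = jacobian c c' x *m a c' (transition c c' x)).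

Definition bilinear_field U (b : chart A -> 'rV[R]_n -> 'M[R]_n) : Prop :=
  (forall c, smooth_mx_on (coord_dom U c) (b c)) /\
  (forall c c' x, coord_dom (U `&` chart_dom c') c x ->
     b c x = jacobian c c' x *m b c' (transition c c' x)
               *m (jacobian c c' x)^T).

Definition endo_field U (J : chart A -> 'rV[R]_n -> 'M[R]_n) : Prop :=
  (forall c, smooth_mx_on (coord_dom U c) (J c)) /\
  (forall c c' x, coord_dom (U `&` chart_dom c') c x ->
     J c x *m jacobian c c' x = jacobian c c' x *m J c' (transition c c' x)).

Definition form2_field U (w : chart A -> 'rV[R]_n -> 'M[R]_n) : Prop :=
  bilinear_field U w /\
  (forall c x, coord_dom U c x -> (w c x)^T = - w c x).

End Tensors.

Section LocalGeometry.
Context {R : realType} {n : nat}.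
Implicit Types (X Y Z : 'rV[R]_n -> 'rV[R]_n) (g I w : 'rV[R]_n -> 'M[R]_n).
Implicit Types (a : 'rV[R]_n -> 'cV[R]_n).

Definition bil (b : 'M[R]_n) (u v : 'rV[R]_n) : R := (u *m b *m v^T) 0 0.

Definition lie_bracket X Y x : 'rV[R]_n := 'D_(X x) Y x - 'D_(Y x) X x.

Definition act_field I X x : 'rV[R]_n := X x *m I x.

Definition nijenhuis I X Y x : 'rV[R]_n :=
  lie_bracket (act_field I X) (act_field I Y) x - lie_bracket (act_field I X) Y x *m I x
  - lie_bracket X (act_field I Y) x *m I x - lie_bracket X Y x.

Definition christoffel g (i j k : 'I_n) x : R :=
  2^-1 * \sum_l invmx (g x) k l *
    (pd i (fun y => g y j l) x + pd j (fun y => g y i l) x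
     - pd l (fun y => g y i j) x).

Definition levi_civita g X Y x : 'rV[R]_n :=
  'D_(X x) Y x +
  \row_k \sum_i \sum_j X x 0 i * Y x 0 j * christoffel g i j k x.

(* (nabla_X I) Z *)
Definition nabla_endo g I X Z x : 'rV[R]_n :=
  levi_civita g X (act_field I Z) x - levi_civita g X Z x *m I x.

Definition canonical_conn g I X Y x : 'rV[R]_n :=
  levi_civita g X Y x + 2^-1 *: nabla_endo g I X (act_field I Y) x.

Definition canonical_curv g I X Y Z x : 'rV[R]_n :=
  - (canonical_conn g I X (canonical_conn g I Y Z) x
     - canonical_conn g I Y (canonical_conn g I X Z) x)
  + canonical_conn g I (lie_bracket X Y) Z x.

(* g(I ., .) *)
Definition kahler_form g I x : 'M[R]_n := I x *m g x.

(* (I a)(u) = a(u *m I) = u *m (I *m a) *)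
Definition act_covector I a x : 'cV[R]_n := I x *m a x.

Definition d1 a x : 'M[R]_n :=
  \matrix_(i, j) (pd i (fun y => a y j 0) x - pd j (fun y => a y i 0) x).

Definition d2 w (i j k : 'I_n) x : R :=
  pd i (fun y => w y j k) x + pd j (fun y => w y k i) x
  + pd k (fun y => w y i j) x.

Definition wedge12 a w (i j k : 'I_n) x : R :=
  a x i 0 * w x j k + a x j 0 * w x k i + a x k 0 * w x i j.

End LocalGeometry.

Section FourDimensional.
Context {R : realType}.
Implicit Types (a b w : 'M[R]_4) (g : 'M[R]_4).

(* Levi-Civita symbol *)
Definition eps (i j k l : 'I_4) : R :=
  \det (\matrix_(r < 4, s < 4) (tnth [tuple i; j; k; l] r == s)%:R).

(* the component of the 4-form a /\ b on (d_0, d_1, d_2, d_3) *)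
Definition wedge22 a b : R :=
  4^-1 * \sum_i \sum_j \sum_k \sum_l eps i j k l * a i j * b k l.

(* the components w^ij obtained by raising both indices *)
Definition raise g w : 'M[R]_4 := invmx g *m w *m (invmx g)^T.

(* The usual inner product \sum_(i < j) a_ij b^ij of 2-forms gives g(I ., .)
   squared norm 2 for orthogonal I; this is half of it. *)
Definition form_inner g a b : R :=
  4^-1 * \sum_i \sum_j a i j * raise g b i j.

(* Hodge star of g, for the orientation such that w /\ w > 0. *)
Definition hodge g w a : 'M[R]_4 :=
  \matrix_(k, l) (2^-1 * Num.sg (wedge22 w w) * Num.sqrt (\det g) *
    \sum_i \sum_j eps i j k l * raise g a i j).

End FourDimensional.

Section Hermitian.
Context {R : realType} {M : topologicalType}.
Variable A : manifold R 4 M.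
Implicit Types (g I : chart A -> 'rV[R]_4 -> 'M[R]_4).

Definition riemannian g : Prop :=
  bilinear_field setT g /\
  (forall c x, coord_dom setT c x ->
     (g c x)^T = g c x /\ forall u, u != 0 -> 0 < bil (g c x) u u).

Definition complex_structure I : Prop :=
  [/\ endo_field setT I,
      forall c x, coord_dom setT c x -> I c x *m I c x = - 1%:M &
      forall c (X Y : 'rV[R]_4 -> 'rV[R]_4),
        smooth_mx_on (coord_dom setT c) X ->
        smooth_mx_on (coord_dom setT c) Y ->
        forall x, coord_dom setT c x -> nijenhuis (I c) X Y x = 0].

Definition hermitian_manifold g I : Prop :=
  [/\ riemannian g, complex_structure I &
      forall c x, coord_dom setT c x ->
        forall u v, bil (g c x) (u *m I c x) (v *m I c x) = bil (g c x) u v].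

Definition lee_form g I (theta : chart A -> 'rV[R]_4 -> 'cV[R]_4) : Prop :=
  covector_field setT theta /\
  (forall c x, coord_dom setT c x -> forall i j k,
     d2 (kahler_form (g c) (I c)) i j k x =
     wedge12 (theta c) (kahler_form (g c) (I c)) i j k x).

(* The index i : 'I_5 stands for omega_(i+1); ord_max is omega_5. *)
Definition five_frame (U : set M) (w : 'I_5 -> chart A -> 'rV[R]_4 -> 'M[R]_4)
    : Prop :=
  [/\ forall i, form2_field U (w i),
      forall i c x, coord_dom U c x -> w i c x \in unitmx &
      exists e : 'I_5 -> bool, forall i j c x, coord_dom U c x ->
        wedge22 (w i c x) (w j c x) =
        (-1) ^+ e i * (i == j)%:R * wedge22 (w ord_max c x) (w ord_max c x)].

Definition closed_frame (U : set M)
    (w : 'I_5 -> chart A -> 'rV[R]_4 -> 'M[R]_4) : Prop :=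
  forall i c x, coord_dom U c x -> forall j k l, d2 (w i c) j k l x = 0.

Definition compatible_frame g I (U : set M)
    (w : 'I_5 -> chart A -> 'rV[R]_4 -> 'M[R]_4) : Prop :=
  forall c x, coord_dom U c x ->
  let star := hodge (g c x) (kahler_form (g c) (I c) x) in
  [/\ forall i j, form_inner (g c x) (w i c x) (w j c x) = (i == j)%:R,
      forall eta : 'M[R]_4,
        (eta^T = - eta /\ star eta = - eta) <->
        (exists t : 'I_5 -> R,
           eta = \sum_(i < 5 | (i < 3)%N) t i *: w i c x),
      forall i : 'I_5, (3 <= i)%N -> star (w i c x) = w i c x &
      forall i : 'I_5, (3 <= i)%N -> forall u v : 'rV[R]_4,
        bil (w i c x) (u *m I c x) (v *m I c x) = - bil (w i c x) u v].

(* Evaluated on vector fields, the 2-form identified with the skew endomorphism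
   R~(X, Y) is (Z, W) |-> g(R~(X, Y) Z, W). *)
Definition curvature_condition g I (theta : chart A -> 'rV[R]_4 -> 'cV[R]_4)
    : Prop :=
  forall c (X Y Z W : 'rV[R]_4 -> 'rV[R]_4),
    smooth_mx_on (coord_dom setT c) X -> smooth_mx_on (coord_dom setT c) Y ->
    smooth_mx_on (coord_dom setT c) Z -> smooth_mx_on (coord_dom setT c) W ->
    forall x, coord_dom setT c x ->
      bil (g c x) (canonical_curv (g c) (I c) X Y Z x) (W x) =
      - 4^-1 * bil (d1 (act_covector (I c) (theta c)) x) (X x) (Y x)
             * bil (kahler_form (g c) (I c) x) (Z x) (W x).

End Hermitian.

(* Main.v *)
(** In coordinates let B be the canonical Hermitian connection twisted by
    (1/4) I theta tensor I. It is unitary, and since I theta is a 1-form with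
    values in the center of u(2), its curvature is the canonical one plus
    (1/4) d(I theta) tensor omega_I; so the curvature condition says exactly that
    B is flat. The second fact is first-order: by integrability of I and
    d omega_I = theta /\ omega_I, the skew-symmetrization of the B-derivative of
    a 2-form w orthogonal to omega_I is dw, as if B were torsion-free on such forms.

    If B is flat, a parallel unitary frame turns five constant 2-forms orthogonal
    to omega_I into a closed compatible 5-frame. Conversely, for a closed compatible
    5-frame w_a the B-derivatives are L_ab w_b with L a 1-form valued in
    so(3) + so(2) whose skew-symmetrization is zero; linear algebra forces L = 0, so
    the curvature of B commutes with all the w_a and with I, and vanishes. *)
Require Import Defs.
From HB Require Import structures.
From mathcomp Require Import all_boot all_order all_algebra.
From mathcomp Require Import all_classical all_reals all_analysis.
From mathcomp Require Import ring lra.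

Set Implicit Arguments.
Unset Strict Implicit.
Unset Printing Implicit Defensive.

Import Order.TTheory GRing.Theory Num.Theory.
Import numFieldNormedType.Exports.

Local Open Scope classical_set_scope.
Local Open Scope ring_scope.

(** * Smooth functions *)

Section Lines.
Context {R : realType} {V W : normedModType R}.

Lemma is_derive_line (f : V -> W) (x v : V) (s : R) :
  derivable f (x + s *: v) v ->
  is_derive s 1 (fun t => f (x + t *: v)) ('D_v f (x + s *: v)).
Proof.
move=> df.
have E : (fun h => h^-1 *: (((fun t => f (x + t *: v)) \o shift s) (h *: (1 : R))
      - f (x + s *: v)))
   = (fun h : R => h^-1 *: ((f \o shift (x + s *: v)) (h *: v) - f (x + s *: v))).
  apply/funext => h /=; rewrite [h%:A]mulr1 scalerDl addrCA.
  by [].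
by split; rewrite /derivable /derive E.
Qed.

End Lines.

Section DiffBound.
Context {R : realType} {V W : normedModType R}.

Lemma differentiable_of_bound (f : V -> W) (df : {linear V -> W}) (x : V) :
  continuous df ->
  (forall e : R, 0 < e ->
     \forall h \near (0 : V), `|f (h + x) - f x - df h| <= e * `|h|) ->
  differentiable f x /\ 'd f x = df :> (V -> W).
Proof.
move=> cdf H.
have EL : f \o shift x = cst (f x) + df +o_ 0 id.
  apply/eqaddoP => e e0; apply: filterS (H e e0) => h.
  rewrite -![(_ + _ : _ -> _) _]/(_ + _) -![(- _ : _ -> _) _]/(- _) /= /cst.
  by rewrite opprD addrA.
have dE := diff_unique cdf EL.
by split => //; apply/diff_locallyP; rewrite dE; split.
Qed.

End DiffBound.

Section AxisMVT.
Context {R : realType} {V : normedModType R}.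

Lemma MVT_line (f : V -> R) (x v : V) (h : R) :
  (forall s : R, 0 <= s <= 1 -> derivable f (x + (s * h) *: v) v) ->
  exists2 s : R, 0 <= s <= 1 & f (x + h *: v) - f x = h * 'D_v f (x + (s * h) *: v).
Proof.
move=> df.
pose phi : R -> R := fun t => f (x + t *: v).
pose psi : R -> R := fun t => t * h.
have D (s : R) : 0 <= s <= 1 -> is_derive s 1 (phi \o psi) (h * 'D_v f (x + (s * h) *: v)).
  move=> s01; have d1 : is_derive (psi s) 1 phi ('D_v f (x + (s * h) *: v)).
    exact: (is_derive_line (df s s01)).
  have d2 : is_derive s 1 psi h.
    apply: is_derive_eq; rewrite /GRing.scale /=; ring.
  by rewrite mulrC; apply: is_derive1_comp.
have [||s s01] := @MVT_segment R (phi \o psi) (fun s : R => h * 'D_v f (x + (s * h) *: v)) 0 1 ler01.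
- move=> s; rewrite in_itv /= => /andP[/ltW s0 /ltW s1].
  by apply: D; rewrite s0 s1.
- apply: derivable_within_continuous => s; rewrite in_itv /= => s01.
  by have [] := D s s01.
rewrite /phi /psi /= subr0 mulr1 mul1r mul0r scale0r addr0 => E.
by exists s.
Qed.

End AxisMVT.

Section Rows.
Context {R : realType} {n : nat}.
Implicit Types (D : set 'rV[R]_n) (f : 'rV[R]_n -> R) (x h : 'rV[R]_n).

Local Notation e_ i := (delta_mx 0 i : 'rV[R]_n).

Lemma coord_le_norm h i : `|h 0 i| <= `|h|.
Proof.
rewrite {2}/Num.Def.normr /= mx_normrE.
exact: (le_bigmax _ (fun ij => `|h ij.1 ij.2|) (0, i)).
Qed.

Lemma rownorm_le (c : R) h : 0 <= c -> (forall i, `|h 0 i| <= c) -> `|h| <= c.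
Proof.
move=> c0 H; rewrite {1}/Num.Def.normr /= mx_normrE bigmax_le // => -[i j] _ /=.
by rewrite (ord1 i).
Qed.

Lemma near_ballP D x : (\forall y \near x, D y) <->
  exists2 r : R, 0 < r & forall y, `|y - x| < r -> D y.
Proof.
split.
  move=> /nbhs_ballP[r /= r0 H]; exists r => // y yx; apply: H.
  by rewrite -ball_normE /= distrC.
move=> [r r0 H]; apply/nbhs_ballP; exists r => //= y.
by rewrite -ball_normE /= distrC; exact: H.
Qed.

Lemma open_nearP D x : open D -> D x -> \forall y \near x, D y.
Proof. by rewrite openE => oD /oD. Qed.

Lemma normZe (s : R) i : `|s *: e_ i| <= `|s|.
Proof.
apply: rownorm_le => // j; rewrite !mxE normrM /=.
by case: (_ == _); rewrite ?normr1 ?normr0 ?mulr1 ?mulr0.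
Qed.

Definition trunc (k : nat) h : 'rV[R]_n := \row_j (if (j < k)%N then h 0 j else 0).

Lemma truncS k h (kn : (k < n)%N) :
  trunc k.+1 h = trunc k h + h 0 (Ordinal kn) *: e_ (Ordinal kn).
Proof.
apply/rowP => j; rewrite !mxE eqxx /= -(inj_eq val_inj) /= ltnS.
case: ltngtP => [||E]; rewrite ?mulr0 ?mulr1 ?addr0 ?add0r //.
by congr (h _ _); exact: val_inj.
Qed.

Lemma increment_expansion f x (r : R) h : `|h| < r ->
  (forall y, `|y - x| < r -> forall i, derivable f y (e_ i)) ->
  exists z : 'I_n -> 'rV[R]_n, (forall i, `|z i - x| <= `|h|) /\
    f (x + h) - f x = \sum_i h 0 i * pd i f (z i).
Proof.
move=> hr df.
have T (k : 'I_n) (s : R) : 0 <= s <= 1 ->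
    `|(x + trunc k h + (s * h 0 k) *: e_ k) - x| <= `|h|.
  move=> /andP[s0 s1]; apply: rownorm_le => // j; rewrite !mxE.
  have -> (a b c : R) : a + b + c - a = b + c by ring.
  case: (eqVneq j k) => [->|jk]; rewrite ?ltnn ?mulr1 ?add0r /= ?mulr0 ?addr0.
    rewrite normrM ger0_norm // (le_trans _ (coord_le_norm _ k)) //.
    by rewrite ler_piMl.
  by case: ifP => _; [exact: coord_le_norm|rewrite normr0].
have S (k : 'I_n) : exists z, `|z - x| <= `|h| /\
    f (x + trunc k.+1 h) - f (x + trunc k h) = h 0 k * pd k f z.
  have [s s01|s s01 E] := @MVT_line R _ f (x + trunc k h) (e_ k) (h 0 k).
    by apply: df; apply: le_lt_trans hr; exact: T.
  exists (x + trunc k h + (s * h 0 k) *: e_ k); split; first exact: T.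
  rewrite -E (truncS _ (ltn_ord k)) addrA.
  by congr (f (_ + _ *: delta_mx _ _) - _); [congr (h _ _)|]; exact: val_inj.
have [z Hz] := choice S.
exists z; split => [i|]; first by case: (Hz i).
rewrite (eq_bigr (fun k : 'I_n => f (x + trunc k.+1 h) - f (x + trunc k h)));
  last by move=> k _; case: (Hz k).
rewrite -(big_mkord xpredT (fun k => f (x + trunc k.+1 h) - f (x + trunc k h))).
rewrite (telescope_sumr (fun k => f (x + trunc k h))) //.
congr (f _ - f _).
  by congr (_ + _); apply/rowP => j; rewrite mxE ltn_ord.
by apply/rowP => j; rewrite !mxE /= addr0.
Qed.

Lemma continuousP_norm (f : 'rV[R]_n -> R) x : {for x, continuous f} <->
  forall e : R, 0 < e -> exists2 r : R, 0 < r & forall y, `|y - x| < r -> `|f y - f x| <= e.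
Proof.
split.
  move=> cf e e0.
  have [r r0 H] := (near_ballP (fun y => `|f x - f y| <= e) x).1
    ((@cvgrPdist_le _ _ _ (nbhs x) _ f (f x)).1 cf e e0).
  by exists r => // y /H; rewrite distrC.
move=> H; apply/(@cvgrPdist_le _ _ _ (nbhs x) _ f (f x)) => e /H[r r0 {}H].
apply/(near_ballP (fun y => `|f x - f y| <= e) x).
by exists r => // y /H; rewrite distrC.
Qed.

Lemma C1_differentiable_at f x :
  (\forall y \near x, forall i, derivable f y (e_ i)) ->
  (forall i, {for x, continuous (pd i f)}) ->
  differentiable f x /\ forall v, 'D_v f x = \sum_i v 0 i * pd i f x.
Proof.
move=> /near_ballP[r r0 df] cf.
pose L (h : 'rV[R]_n) : R := \sum_i h 0 i * pd i f x.
have L_lin : linear L.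
  move=> a u v; rewrite /L scaler_sumr -big_split /=; apply: eq_bigr => i _.
  by rewrite !mxE /GRing.scale /=; ring.
pose Ll : {linear 'rV[R]_n -> R^o} :=
  HB.pack L (GRing.isLinear.Build _ _ _ _ L L_lin).
have cL : continuous Ll.
  move=> y; apply/continuousP_norm => e e0.
  pose C := \sum_i `|pd i f x|.
  have C0 : 0 <= C by apply: sumr_ge0.
  have C1 : 0 < 1 + C by rewrite ltr_wpDr.
  exists (e / (1 + C)) => [|z Hz]; first by rewrite divr_gt0.
  rewrite /= /L -sumrB (le_trans (ler_norm_sum _ _ _)) //.
  apply: (@le_trans _ _ (\sum_i `|z - y| * `|pd i f x|)).
    apply: ler_sum => i _; rewrite -mulrBl normrM ler_wpM2r //.
    by have := coord_le_norm (z - y) i; rewrite !mxE.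
  rewrite -mulr_sumr -/C (@le_trans _ _ (e / (1 + C) * C)) //.
    by rewrite ler_wpM2r // ltW.
  by rewrite -mulrA ler_piMr ?ltW // mulrC ltr_pdivrMr // mul1r ltrDr.
have [dfx dE] : differentiable f x /\ 'd f x = Ll :> (_ -> _).
  apply: (@differentiable_of_bound R 'rV[R]_n R^o f Ll x cL) => e e0.
  pose e' := e / n.+1%:R.
  have e'0 : 0 < e' by rewrite divr_gt0.
  have : forall i, exists r : R, 0 < r /\ forall y, `|y - x| < r -> `|pd i f y - pd i f x| <= e'.
    by move=> i; have [ri ri0 H] := (continuousP_norm (pd i f) x).1 (cf i) e' e'0; exists ri.
  move=> /choice[ri Hri].
  pose rm := \big[Order.min/r]_i ri i.
  have rm0 : 0 < rm by apply: lt_bigmin => // i _; case: (Hri i).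
  apply/near_ballP; exists rm => // h; rewrite subr0 => hrm.
  have hr : `|h| < r by apply: lt_le_trans hrm _; exact: bigmin_le_id.
  have [z [Hz E]] := increment_expansion hr df.
  rewrite [h + x]addrC E /= /L -sumrB.
  rewrite (le_trans (ler_norm_sum _ _ _)) //.
  apply: (@le_trans _ _ (\sum_(i < n) `|h| * e')).
    apply: ler_sum => i _; rewrite -mulrBr normrM ler_pM // ?coord_le_norm //.
    have [_] := Hri i; apply; apply: le_lt_trans (Hz i) _.
    by apply: lt_le_trans hrm _; exact: bigmin_le.
  rewrite sumr_const card_ord -mulr_natr [e * _]mulrC -mulrA ler_wpM2l //.
  rewrite /e' -mulrA ler_piMr //; first exact: ltW.
  by rewrite mulrC ler_pdivrMr ?ltr0Sn // mul1r ler_nat.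
by split => // v; rewrite deriveE // dE.
Qed.

End Rows.

Section Smooth.
Context {R : realType} {n : nat}.
Implicit Types (D : set 'rV[R]_n) (f g : 'rV[R]_n -> R) (x : 'rV[R]_n).

Local Notation e_ i := (delta_mx 0 i : 'rV[R]_n).

Lemma smooth_cont D f x : smooth_on D f -> D x -> {for x, continuous f}.
Proof. by move=> /(_ [::] x) /[apply] -[]. Qed.

Lemma smooth_derivable D f x i : smooth_on D f -> D x -> derivable f x (e_ i).
Proof. by move=> /(_ [::] x) /[apply] -[]. Qed.

Lemma smooth_pd D f i : smooth_on D f -> smooth_on D (pd i f).
Proof. by move=> sf s x Dx; have := sf (rcons s i) x Dx; rewrite /pds foldr_rcons. Qed.

Lemma smooth_subset D D' f : D' `<=` D -> smooth_on D f -> smooth_on D' f.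
Proof. by move=> DD sf s x /DD; exact: sf. Qed.

Lemma pd_cst (c : R) i : pd i (fun=> c) = (fun=> 0) :> ('rV[R]_n -> R).
Proof. by apply/funext => x; exact: derive_cst. Qed.

Lemma smooth_cst D (c : R) : smooth_on D (fun=> c).
Proof.
have E s : exists c', pds s (fun=> c) = (fun=> c') :> ('rV[R]_n -> R).
  by elim: s => [|i s [c' /= ->]]; [exists c|exists 0; rewrite pd_cst].
move=> s x _; have [c' ->] := E s; split; first exact: cst_continuous.
by move=> i; exact: derivable_cst.
Qed.

Lemma pd_near f g i x : (\forall y \near x, f y = g y) -> pd i f x = pd i g x.
Proof. exact: near_eq_derive. Qed.

Lemma pd_open D f g i x : open D -> D x -> (forall y, D y -> f y = g y) ->
  pd i f x = pd i g x.
Proof.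
by move=> oD Dx E; apply: pd_near; apply: filterS (open_nearP oD Dx) => y /E.
Qed.

Lemma cont_near f g x : (\forall y \near x, f y = g y) ->
  {for x, continuous f} -> {for x, continuous g}.
Proof.
move=> E cf; rewrite /prop_for /continuous_at -(nbhs_singleton E).
by apply: cvg_trans cf; exact: (@near_eq_cvg _ _ (nbhs x) _ f g E).
Qed.

Lemma is_derive_translate f (a x v : 'rV[R]_n) : derivable f (x + a) v ->
  is_derive x v (fun y => f (y + a)) ('D_v f (x + a)).
Proof.
have E : (fun h => h^-1 *: (((fun y => f (y + a)) \o shift x) (h *: v) - f (x + a)))
   = (fun h : R => h^-1 *: ((f \o shift (x + a)) (h *: v) - f (x + a))).
  by apply/funext => h /=; rewrite addrA.
by move=> df; split; rewrite /derivable /derive E.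
Qed.

Section Gen.
Variables (D : set 'rV[R]_n) (Bs : ('rV[R]_n -> R) -> Prop).

Inductive gen : ('rV[R]_n -> R) -> Prop :=
| gen_base f : Bs f -> gen f
| gen_of_smooth f : smooth_on D f -> gen f
| gen_add f g : gen f -> gen g -> gen (fun x => f x + g x)
| gen_mul f g : gen f -> gen g -> gen (fun x => f x * g x).

Lemma gen_sum (J : Type) (r : seq J) (F : J -> 'rV[R]_n -> R) :
  (forall j, gen (F j)) -> gen (fun x => \sum_(j <- r) F j x).
Proof.
move=> gF; elim: r => [|j r IH].
  under eq_fun do rewrite big_nil.
  by apply: gen_of_smooth; exact: smooth_cst.
under eq_fun do rewrite big_cons.
exact: gen_add.
Qed.

Hypothesis oD : open D.
Hypothesis HBs : forall f, Bs f ->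
  (forall x, D x -> {for x, continuous f}) /\
  forall i, (forall x, D x -> derivable f x (e_ i)) /\
    exists2 h, gen h & forall x, D x -> pd i f x = h x.

Lemma gen_step f : gen f ->
  (forall x, D x -> {for x, continuous f}) /\
  forall i, (forall x, D x -> derivable f x (e_ i)) /\
    exists2 h, gen h & forall x, D x -> pd i f x = h x.
Proof.
elim => {f} [f /HBs //|f sf|f g _ [cf df] _ [cg dg]|f g gf [cf df] gg [cg dg]].
- split => [x|i]; first exact: smooth_cont.
  split => [x|]; first exact: smooth_derivable.
  by exists (pd i f) => //; apply: gen_of_smooth; exact: smooth_pd.
- split => [x Dx|i]; first by apply: continuousD; [exact: cf|exact: cg].
  have [df1 [hf ghf Ef]] := df i; have [dg1 [hg ghg Eg]] := dg i.
  split => [x Dx|]; first by apply: derivableD; [exact: df1|exact: dg1].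
  exists (fun x => hf x + hg x); first exact: gen_add.
  by move=> x Dx; rewrite /pd (deriveD (df1 x Dx) (dg1 x Dx)) -Ef // -Eg.
- split => [x Dx|i]; first by apply: continuousM; [exact: cf|exact: cg].
  have [df1 [hf ghf Ef]] := df i; have [dg1 [hg ghg Eg]] := dg i.
  split => [x Dx|]; first by apply: derivableM; [exact: df1|exact: dg1].
  exists (fun x => f x * hg x + g x * hf x).
    by apply: gen_add; exact: gen_mul.
  by move=> x Dx; rewrite -Ef // -Eg //; exact: (deriveM (df1 x Dx) (dg1 x Dx)).
Qed.

(* Coinduction: a class of continuous, derivable functions whose partial derivatives are
   polynomial in the class and in smooth functions consists of smooth functions. *)
Lemma gen_smooth f : gen f -> smooth_on D f.
Proof.
move=> gf; have E s : exists2 h, gen h & forall x, D x -> pds s f x = h x.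
  elim: s => [|i s [h gh Eh]]; first by exists f.
  have [_ /(_ i) [_ [h' gh' Eh']]] := gen_step gh.
  exists h' => // x Dx; rewrite -Eh' //=.
  exact: (pd_open _ oD).
move=> s x Dx; have [h gh Eh] := E s.
have [ch dh] := gen_step gh.
have nE : \forall y \near x, h y = pds s f y.
  by apply: filterS (open_nearP oD Dx) => y /Eh.
split=> [|i].
  by apply: cont_near nE _; exact: ch.
by apply: near_eq_derivable nE _; have [dh1 _] := dh i; exact: dh1.
Qed.

End Gen.

Definition no_base : ('rV[R]_n -> R) -> Prop := fun=> False.

Lemma smooth_poly D f : open D -> gen D no_base f -> smooth_on D f.
Proof. by move=> oD; apply: gen_smooth. Qed.

Lemma smoothD D f g : open D -> smooth_on D f -> smooth_on D g ->
  smooth_on D (fun x => f x + g x).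
Proof. by move=> oD sf sg; apply: smooth_poly => //; apply: gen_add; exact: gen_of_smooth. Qed.

Lemma smoothM D f g : open D -> smooth_on D f -> smooth_on D g ->
  smooth_on D (fun x => f x * g x).
Proof. by move=> oD sf sg; apply: smooth_poly => //; apply: gen_mul; exact: gen_of_smooth. Qed.

Lemma smooth_sum D (J : Type) (r : seq J) (F : J -> 'rV[R]_n -> R) : open D ->
  (forall j, smooth_on D (F j)) -> smooth_on D (fun x => \sum_(j <- r) F j x).
Proof.
move=> oD sF; apply: smooth_poly => //; apply: gen_sum => j; exact: gen_of_smooth.
Qed.

Lemma smooth_prod D (J : Type) (r : seq J) (F : J -> 'rV[R]_n -> R) : open D ->
  (forall j, smooth_on D (F j)) -> smooth_on D (fun x => \prod_(j <- r) F j x).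
Proof.
move=> oD sF; elim: r => [|j r IH].
  by under eq_fun do rewrite big_nil; exact: smooth_cst.
under eq_fun do rewrite big_cons.
exact: (smoothM oD (sF j) IH).
Qed.

Lemma smooth_ext D f g : open D -> (forall x, D x -> f x = g x) ->
  smooth_on D f -> smooth_on D g.
Proof.
move=> oD E sf; apply: (@gen_smooth D (fun h => h = g)) => //; last exact: gen_base.
move=> _ ->; split => [x Dx|i].
  apply: cont_near (smooth_cont sf Dx).
  by apply: filterS (open_nearP oD Dx) => y /E.
split => [x Dx|].
  have nE : \forall y \near x, f y = g y.
    by apply: filterS (open_nearP oD Dx) => y /E.
  by apply: near_eq_derivable nE _; exact: smooth_derivable Dx.
exists (pd i f); first by apply: gen_of_smooth; exact: smooth_pd.
by move=> x Dx; apply: (pd_open _ oD) => // y Dy; rewrite E.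
Qed.

Lemma smooth_inv D f : open D -> (forall x, D x -> f x != 0) ->
  smooth_on D f -> smooth_on D (fun x => (f x)^-1).
Proof.
move=> oD f0 sf; apply: (@gen_smooth D (fun h => h = (fun x => (f x)^-1))) => //; last exact: gen_base.
move=> _ ->; split => [x Dx|i].
  by apply: continuousV; [exact: f0|exact: smooth_cont Dx].
split => [x Dx|].
  by apply: derivableV; [exact: f0|exact: smooth_derivable Dx].
exists (fun x => (-1) * ((f x)^-1 * (f x)^-1 * pd i f x)).
  apply: gen_mul; first by apply: gen_of_smooth; exact: smooth_cst.
  apply: gen_mul; first by apply: gen_mul; exact: gen_base.
  by apply: gen_of_smooth; exact: smooth_pd.
move=> x Dx; rewrite /pd deriveV; [|exact: f0|exact: smooth_derivable Dx].
by rewrite /GRing.scale /= mulN1r mulNr expr2 invfM.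
Qed.

Lemma coord_derivable j i x : derivable (fun x : 'rV[R]_n => x 0 j) x (e_ i) /\
  pd i (fun x : 'rV[R]_n => x 0 j) x = (i == j)%:R.
Proof.
pose c (x : 'rV[R]_n) : R := x 0 j.
have c_lin : linear c by move=> a u v; rewrite /c !mxE.
pose cl : {linear 'rV[R]_n -> R^o} :=
  HB.pack c (GRing.isLinear.Build _ _ _ _ c c_lin).
have cc : continuous cl by exact: coord_continuous.
have [dx E] : differentiable c x /\ 'd c x = cl :> (_ -> _).
  apply: (@differentiable_of_bound R 'rV[R]_n R^o c cl x cc) => e e0.
  apply: filterE => h; rewrite /= /c mxE addrK subrr normr0.
  by rewrite mulr_ge0 // ltW.
split; first exact: diff_derivable.
by rewrite /pd deriveE // E /= /c mxE eqxx eq_sym.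
Qed.

Lemma pd_coord j i x : pd i (fun x : 'rV[R]_n => x 0 j) x = (i == j)%:R.
Proof. by have [] := coord_derivable j i x. Qed.

Lemma smooth_coord D j : open D -> smooth_on D (fun x => x 0 j).
Proof.
move=> oD; apply: (@gen_smooth D (fun h => h = (fun x => x 0 j))) => //; last exact: gen_base.
move=> _ ->; split => [x Dx|i].
  exact: coord_continuous.
split => [x Dx|]; first by have [] := coord_derivable j i x.
exists (fun=> (i == j)%:R); first by apply: gen_of_smooth; exact: smooth_cst.
by move=> x Dx; have [] := coord_derivable j i x.
Qed.

Lemma smooth_C1 D f x : open D -> smooth_on D f -> D x ->
  differentiable f x /\ forall v, 'D_v f x = \sum_i v 0 i * pd i f x.
Proof.
move=> oD sf Dx; apply: C1_differentiable_at.
  by apply: filterS (open_nearP oD Dx) => y Dy i; exact: smooth_derivable Dy.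
by move=> i; apply: smooth_cont Dx; exact: smooth_pd.
Qed.

Lemma pdD D f g i x : smooth_on D f -> smooth_on D g -> D x ->
  pd i (fun x => f x + g x) x = pd i f x + pd i g x.
Proof. by move=> sf sg Dx; rewrite /pd (deriveD (smooth_derivable sf Dx) (smooth_derivable sg Dx)). Qed.

Lemma pdM D f g i x : smooth_on D f -> smooth_on D g -> D x ->
  pd i (fun x => f x * g x) x = f x * pd i g x + pd i f x * g x.
Proof.
move=> sf sg Dx; rewrite /pd (deriveM (smooth_derivable sf Dx) (smooth_derivable sg Dx)).
by rewrite /GRing.scale /= [_ * g x]mulrC.
Qed.

Lemma pd_sum D (J : Type) (r : seq J) (F : J -> 'rV[R]_n -> R) i x : open D ->
  (forall j, smooth_on D (F j)) -> D x ->
  pd i (fun x => \sum_(j <- r) F j x) x = \sum_(j <- r) pd i (F j) x.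
Proof.
move=> oD sF Dx; elim: r => [|j r IH].
  by under eq_fun do rewrite big_nil; rewrite pd_cst big_nil.
under eq_fun do rewrite big_cons.
by rewrite (@pdD D) // ?IH ?big_cons //; exact: smooth_sum.
Qed.

Lemma pdZ D f (c : R) i x : smooth_on D f -> D x ->
  pd i (fun x => c * f x) x = c * pd i f x.
Proof.
by move=> sf Dx; rewrite (pdM i (@smooth_cst D c) sf Dx) pd_cst mul0r addr0.
Qed.

Lemma pdN D f i x : smooth_on D f -> D x -> pd i (fun x => - f x) x = - pd i f x.
Proof. by move=> sf Dx; rewrite /pd (deriveN (smooth_derivable sf Dx)). Qed.

Lemma smoothN D f : open D -> smooth_on D f -> smooth_on D (fun x => - f x).
Proof.
move=> oD sf; under eq_fun do rewrite -mulN1r.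
exact: (smoothM oD (@smooth_cst D (-1)) sf).
Qed.

Lemma smoothB D f g : open D -> smooth_on D f -> smooth_on D g ->
  smooth_on D (fun x => f x - g x).
Proof. by move=> oD sf sg; exact: (smoothD oD sf (smoothN oD sg)). Qed.

Lemma pdC D f i j x : open D -> smooth_on D f -> D x ->
  pd i (pd j f) x = pd j (pd i f) x.
Proof.
move=> oD sf Dx.
have [->//|ij] := eqVneq i j.
have [r r0 Dr] := (near_ballP D x).1 (open_nearP oD Dx).
have key (k l : 'I_n) (h : R) : 0 < h -> h < r -> k != l -> exists z, `|z - x| <= h /\
    f (x + h *: e_ l + h *: e_ k) - f (x + h *: e_ k) - (f (x + h *: e_ l) - f x) =
    h * (h * pd l (pd k f) z).
  move=> h0 hr kl.
  pose G y := f (y + h *: e_ l) - f y.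
  have near_in (s t : R) : 0 <= s <= 1 -> 0 <= t <= 1 ->
      `|x + (s * h) *: e_ k + (t * h) *: e_ l - x| <= h.
    move=> /andP[s0 s1] /andP[t0 t1]; apply: rownorm_le => [|m]; first exact: ltW.
    rewrite !mxE /=.
    have -> (a b c : R) : a + b + c - a = b + c by ring.
    have P (u : R) : 0 <= u -> u <= 1 -> `|u * h| <= h.
      by move=> u0 u1; rewrite ger0_norm ?mulr_ge0 ?(ltW h0) // ler_piMl // ltW.
    case: (eqVneq m k) => [mk|mk].
      by rewrite mk (negbTE kl) mulr1 mulr0 addr0; exact: P.
    case: (eqVneq m l) => [ml|ml]; rewrite ?mulr0 ?mulr1 ?add0r ?addr0; first exact: P.
    by rewrite normr0 ltW.
  have in_D (s t : R) : 0 <= s <= 1 -> 0 <= t <= 1 ->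
      D (x + (s * h) *: e_ k + (t * h) *: e_ l).
    by move=> s01 t01; apply: Dr; apply: le_lt_trans hr; exact: near_in.
  have dG (s : R) : 0 <= s <= 1 -> is_derive (x + (s * h) *: e_ k) (e_ k) G
       (pd k f (x + (s * h) *: e_ k + h *: e_ l) - pd k f (x + (s * h) *: e_ k)).
    move=> s01.
    have in1 : D (x + (s * h) *: e_ k + h *: e_ l).
      by have := in_D s 1 s01; rewrite mul1r lexx ler01; exact.
    have in0 : D (x + (s * h) *: e_ k).
      by have := in_D s 0 s01; rewrite mul0r scale0r addr0 lexx ler01; exact.
    have d1 := is_derive_translate (smooth_derivable sf in1).
    have d0 := derivableP (smooth_derivable sf in0).
    exact: is_deriveB.
  have [s s01|s s01 Es] := @MVT_line R _ G x (e_ k) h; first by have [] := dG s s01.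
  have [t t01|t t01 Et] := @MVT_line R _ (pd k f) (x + (s * h) *: e_ k) (e_ l) h.
    exact: smooth_derivable (smooth_pd k sf) (in_D s t s01 t01).
  exists (x + (s * h) *: e_ k + (t * h) *: e_ l); split; first exact: near_in.
  have [_ Ds] := dG s s01.
  rewrite Ds Et in Es; rewrite -Es /G.
  rewrite [x + h *: e_ l + _]addrAC.
  move: (f _) (f (x + h *: e_ l)) (f (x + h *: e_ k)) (f x) => a b c d.
  ring.
have pos (e : R) : 0 < e -> `|pd i (pd j f) x - pd j (pd i f) x| <= e + e.
  move=> e0.
  have [r1 r10 H1] := (continuousP_norm _ x).1 (smooth_cont (smooth_pd i (smooth_pd j sf)) Dx) e e0.
  have [r2 r20 H2] := (continuousP_norm _ x).1 (smooth_cont (smooth_pd j (smooth_pd i sf)) Dx) e e0.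
  pose h := Num.min r (Num.min r1 r2) / 2.
  have m0 : 0 < Num.min r (Num.min r1 r2) by rewrite !lt_min r0 r10.
  have hm : h < Num.min r (Num.min r1 r2) by rewrite /h; lra.
  have h0 : 0 < h by rewrite /h; lra.
  move: hm; rewrite !lt_min => /and3P[hr h1 h2].
  have ji : j != i by rewrite eq_sym.
  have [z1 [z1x E1]] := key j i h h0 hr ji.
  have [z2 [z2x E2]] := key i j h h0 hr ij.
  have E : pd i (pd j f) z1 = pd j (pd i f) z2.
    have hN : h != 0 by rewrite gt_eqF.
    suff EE : h * (h * pd i (pd j f) z1) = h * (h * pd j (pd i f) z2).
      exact: (mulfI hN (mulfI hN EE)).
    apply: etrans (esym E1) (etrans _ E2); rewrite [x + h *: e_ j + h *: e_ i]addrAC.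
    move: (f _) (f (x + h *: e_ i)) (f (x + h *: e_ j)) (f x) => a b c d.
    ring.
  have := H1 z1 (le_lt_trans z1x h1); have := H2 z2 (le_lt_trans z2x h2).
  rewrite E; move: (pd j _ z2) (pd j _ x) (pd i _ x) => a b c A1 A2.
  have -> : c - b = (a - b) - (a - c) by ring.
  exact: le_trans (ler_normB _ _) (lerD A1 A2).
apply/eqP; rewrite -subr_eq0 -normr_eq0; apply/eqP/le_anti; rewrite normr_ge0 andbT.
apply/ler_addgt0Pl => e e0; rewrite addr0 (splitr e); apply: pos.
by rewrite divr_gt0.
Qed.

End Smooth.

HB.lock Definition pdm (R : realType) (n p q : nat) (i : 'I_n)
    (F : 'rV[R]_n -> 'M[R]_(p, q)) (x : 'rV[R]_n) : 'M[R]_(p, q) :=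
  \matrix_(a, b) pd i (fun y => F y a b) x.

Section SmoothMatrix.
Context {R : realType} {n : nat}.
Implicit Types (D : set 'rV[R]_n) (x : 'rV[R]_n).

Lemma pdmE p q i (F : 'rV[R]_n -> 'M[R]_(p, q)) x a b :
  pdm i F x a b = pd i (fun y => F y a b) x.
Proof. by rewrite pdm.unlock mxE. Qed.

Lemma smooth_mx_pdm p q D (F : 'rV[R]_n -> 'M[R]_(p, q)) i :
  smooth_mx_on D F -> smooth_mx_on D (pdm i F).
Proof.
move=> sF a b; under eq_fun do rewrite pdmE.
exact: smooth_pd.
Qed.

Lemma smooth_mx_subset p q D D' (F : 'rV[R]_n -> 'M[R]_(p, q)) :
  D' `<=` D -> smooth_mx_on D F -> smooth_mx_on D' F.
Proof. by move=> DD sF a b; apply: smooth_subset (sF a b). Qed.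

Lemma smooth_mx_ext p q D (F G : 'rV[R]_n -> 'M[R]_(p, q)) : open D ->
  (forall x, D x -> F x = G x) -> smooth_mx_on D F -> smooth_mx_on D G.
Proof.
move=> oD E sF a b; apply: (smooth_ext oD _ (sF a b)) => x Dx.
by rewrite E.
Qed.

Lemma pdm_open p q D (F G : 'rV[R]_n -> 'M[R]_(p, q)) i x : open D -> D x ->
  (forall y, D y -> F y = G y) -> pdm i F x = pdm i G x.
Proof.
move=> oD Dx E; apply/matrixP => a b; rewrite !(mxE, pdmE).
by apply: (pd_open _ oD) => // y Dy; rewrite E.
Qed.

Lemma smooth_mx_cst p q D (C : 'M[R]_(p, q)) : smooth_mx_on D (fun=> C).
Proof. by move=> a b; exact: smooth_cst. Qed.

Lemma pdm_cst p q (C : 'M[R]_(p, q)) i x : pdm i (fun=> C) x = 0.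
Proof. by apply/matrixP => a b; rewrite pdmE pd_cst mxE. Qed.

Lemma smooth_mxD p q D (F G : 'rV[R]_n -> 'M[R]_(p, q)) : open D ->
  smooth_mx_on D F -> smooth_mx_on D G -> smooth_mx_on D (fun x => F x + G x).
Proof. by move=> oD sF sG a b; under eq_fun do rewrite mxE; exact: (smoothD oD (sF a b) (sG a b)). Qed.

Lemma pdmD p q D (F G : 'rV[R]_n -> 'M[R]_(p, q)) i x :
  smooth_mx_on D F -> smooth_mx_on D G -> D x ->
  pdm i (fun x => F x + G x) x = pdm i F x + pdm i G x.
Proof.
move=> sF sG Dx; apply/matrixP => a b; rewrite !(mxE, pdmE).
under eq_fun do rewrite mxE.
exact: pdD (sF a b) (sG a b) Dx.
Qed.

Lemma smooth_mxM p q r D (F : 'rV[R]_n -> 'M[R]_(p, q)) (G : 'rV[R]_n -> 'M[R]_(q, r)) :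
  open D -> smooth_mx_on D F -> smooth_mx_on D G ->
  smooth_mx_on D (fun x => F x *m G x).
Proof.
move=> oD sF sG a b; under eq_fun do rewrite mxE.
by apply: smooth_sum => // j; exact: (smoothM oD (sF a j) (sG j b)).
Qed.

Lemma pdmM p q r D (F : 'rV[R]_n -> 'M[R]_(p, q)) (G : 'rV[R]_n -> 'M[R]_(q, r)) i x :
  open D -> smooth_mx_on D F -> smooth_mx_on D G -> D x ->
  pdm i (fun x => F x *m G x) x = F x *m pdm i G x + pdm i F x *m G x.
Proof.
move=> oD sF sG Dx; apply/matrixP => a b; rewrite !(mxE, pdmE).
under eq_fun do rewrite mxE.
rewrite (pd_sum _ i oD _ Dx); last by move=> j; exact: (smoothM oD (sF a j) (sG j b)).
rewrite -big_split; apply: eq_bigr => j _ /=; rewrite !(mxE, pdmE).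
exact: pdM (sF a j) (sG j b) Dx.
Qed.

Lemma smooth_mxZ p q D (f : 'rV[R]_n -> R) (F : 'rV[R]_n -> 'M[R]_(p, q)) :
  open D -> smooth_on D f -> smooth_mx_on D F -> smooth_mx_on D (fun x => f x *: F x).
Proof. by move=> oD sf sF a b; under eq_fun do rewrite mxE; exact: (smoothM oD sf (sF a b)). Qed.

Lemma pdmZ p q D (f : 'rV[R]_n -> R) (F : 'rV[R]_n -> 'M[R]_(p, q)) i x :
  smooth_on D f -> smooth_mx_on D F -> D x ->
  pdm i (fun x => f x *: F x) x = f x *: pdm i F x + pd i f x *: F x.
Proof.
move=> sf sF Dx; apply/matrixP => a b; rewrite !(mxE, pdmE).
under eq_fun do rewrite mxE.
exact: pdM sf (sF a b) Dx.
Qed.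

Lemma smooth_mxN p q D (F : 'rV[R]_n -> 'M[R]_(p, q)) : open D ->
  smooth_mx_on D F -> smooth_mx_on D (fun x => - F x).
Proof. by move=> oD sF a b; under eq_fun do rewrite mxE; exact: (smoothN oD (sF a b)). Qed.

Lemma pdmN p q D (F : 'rV[R]_n -> 'M[R]_(p, q)) i x :
  smooth_mx_on D F -> D x -> pdm i (fun x => - F x) x = - pdm i F x.
Proof.
move=> sF Dx; apply/matrixP => a b; rewrite !(mxE, pdmE); under eq_fun do rewrite mxE.
exact: pdN (sF a b) Dx.
Qed.

Lemma smooth_mxB p q D (F G : 'rV[R]_n -> 'M[R]_(p, q)) : open D ->
  smooth_mx_on D F -> smooth_mx_on D G -> smooth_mx_on D (fun x => F x - G x).
Proof. by move=> oD sF sG; exact: (smooth_mxD oD sF (smooth_mxN oD sG)). Qed.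

Lemma pdmB p q D (F G : 'rV[R]_n -> 'M[R]_(p, q)) i x : open D ->
  smooth_mx_on D F -> smooth_mx_on D G -> D x ->
  pdm i (fun x => F x - G x) x = pdm i F x - pdm i G x.
Proof.
move=> oD sF sG Dx; rewrite (pdmD i sF (smooth_mxN oD sG) Dx).
by rewrite (pdmN i sG Dx).
Qed.

Lemma smooth_mx_sum p q D (J : Type) (r : seq J) (F : J -> 'rV[R]_n -> 'M[R]_(p, q)) :
  open D -> (forall j, smooth_mx_on D (F j)) ->
  smooth_mx_on D (fun x => \sum_(j <- r) F j x).
Proof.
move=> oD sF a b; under eq_fun do rewrite summxE.
by apply: smooth_sum => // j; exact: sF.
Qed.

Lemma pdm_sum p q D (J : Type) (r : seq J) (F : J -> 'rV[R]_n -> 'M[R]_(p, q)) i x :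
  open D -> (forall j, smooth_mx_on D (F j)) -> D x ->
  pdm i (fun x => \sum_(j <- r) F j x) x = \sum_(j <- r) pdm i (F j) x.
Proof.
move=> oD sF Dx; apply/matrixP => a b; rewrite summxE !(mxE, pdmE).
under eq_fun do rewrite summxE.
rewrite (pd_sum _ i oD (fun j => sF j a b) Dx).
by apply: eq_bigr => j _; rewrite pdmE.
Qed.

Lemma smooth_mxT p q D (F : 'rV[R]_n -> 'M[R]_(p, q)) :
  smooth_mx_on D F -> smooth_mx_on D (fun x => (F x)^T).
Proof. by move=> sF a b; under eq_fun do rewrite mxE; exact: sF. Qed.

Lemma pdmT p q (F : 'rV[R]_n -> 'M[R]_(p, q)) i x :
  pdm i (fun x => (F x)^T) x = (pdm i F x)^T.
Proof. by apply/matrixP => a b; rewrite !(mxE, pdmE); under eq_fun do rewrite mxE. Qed.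

Lemma pdmC p q D (F : 'rV[R]_n -> 'M[R]_(p, q)) i j x :
  open D -> smooth_mx_on D F -> D x -> pdm i (pdm j F) x = pdm j (pdm i F) x.
Proof.
move=> oD sF Dx.
apply/matrixP => a b.
rewrite (pdmE i (pdm j F)).
rewrite (pdmE j (pdm i F)).
have E k : (fun y => pdm k F y a b) = pd k (fun y => F y a b).
  by apply/funext => y; rewrite pdmE.
rewrite (E i) (E j).
exact: pdC oD (sF a b) Dx.
Qed.

Lemma smooth_det p D (F : 'rV[R]_n -> 'M[R]_p) : open D ->
  smooth_mx_on D F -> smooth_on D (fun x => \det (F x)).
Proof.
move=> oD sF; rewrite /determinant.
apply: smooth_sum => // s.
refine (@smoothM _ _ D (fun=> _) (fun x => \prod_i F x i _) oD _ _).
  exact: smooth_cst.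
by apply: smooth_prod => // i; exact: sF.
Qed.

Lemma smooth_invmx p D (F : 'rV[R]_n -> 'M[R]_p) : open D ->
  (forall x, D x -> F x \in unitmx) ->
  smooth_mx_on D F -> smooth_mx_on D (fun x => invmx (F x)).
Proof.
move=> oD uF sF.
pose G x := (\det (F x))^-1 *: \adj (F x).
refine (@smooth_mx_ext _ _ D G _ oD _ _).
  by move=> x Dx; rewrite /G /invmx uF.
refine (@smooth_mxZ _ _ D (fun x => (\det (F x))^-1) (fun x => \adj (F x)) oD _ _).
  apply: smooth_inv => //; last exact: smooth_det.
  by move=> x /uF; rewrite unitmxE unitfE.
move=> i j; under eq_fun do rewrite mxE.
apply: (@smoothM _ _ D (fun=> (-1) ^+ (j + i)) (fun x => \det (row' j (col' i (F x)))) oD).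
  exact: smooth_cst.
apply: smooth_det => // a b; under eq_fun do rewrite !(mxE, pdmE).
exact: sF.
Qed.

Definition dirm p q (u : 'rV[R]_n) (F : 'I_n -> 'M[R]_(p, q)) : 'M[R]_(p, q) :=
  \sum_i u 0 i *: F i.

Lemma dirm_delta p q (F : 'I_n -> 'M[R]_(p, q)) i : dirm (delta_mx 0 i) F = F i.
Proof.
rewrite /dirm (bigD1 i) //= big1 => [|k ki]; last by rewrite mxE (negbTE ki) andbF scale0r.
by rewrite mxE !eqxx scale1r addr0.
Qed.

Lemma derive_row m D (Y : 'rV[R]_n -> 'rV[R]_m) x v : open D ->
  smooth_mx_on D Y -> D x ->
  derivable Y x v /\ 'D_v Y x = dirm v (fun i => pdm i Y x).
Proof.
move=> oD sY Dx.
have dY : derivable Y x v.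
  apply/derivable_mxP => i j; apply: diff_derivable.
  by have [] := smooth_C1 oD (sY i j) Dx.
split=> //; rewrite derive_mx //; apply/matrixP => i j; rewrite summxE mxE.
have [_ ->] := smooth_C1 oD (sY i j) Dx.
by apply: eq_bigr => k _; rewrite !(mxE, pdmE).
Qed.

End SmoothMatrix.

Section Composition.
Context {R : realType} {n m : nat}.
Variables (D : set 'rV[R]_n) (E : set 'rV[R]_m) (phi : 'rV[R]_n -> 'rV[R]_m).
Hypotheses (oD : open D) (oE : open E) (sphi : smooth_mx_on D phi).
Hypothesis phiDE : forall x, D x -> E (phi x).

Lemma differentiable_row x : D x -> differentiable phi x.
Proof.
move=> Dx.
have -> : phi = \sum_j (fun x => phi x 0 j *: (delta_mx 0 j : 'rV[R]_m)).
  apply/funext => y; rewrite fct_sumE [LHS]row_sum_delta.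
  by apply: eq_bigr.
apply: differentiable_sum => j; apply: differentiableZl.
by have [] := smooth_C1 oD (sphi 0 j) Dx.
Qed.

Lemma pd_comp f i x : smooth_on E f -> D x ->
  derivable (f \o phi) x (delta_mx 0 i) /\
  pd i (f \o phi) x = \sum_j pd i (fun y => phi y 0 j) x * pd j f (phi x).
Proof.
move=> sf Dx.
have [df Df] := smooth_C1 oE sf (phiDE Dx).
have dp := differentiable_row Dx.
have dc : differentiable (f \o phi) x by exact: differentiable_comp.
split; first exact: diff_derivable.
rewrite [pd _ _ _]/pd deriveE // diff_comp //= -(deriveE _ df) -(deriveE _ dp) Df.
have [_ ->] := derive_row (delta_mx 0 i) oD sphi Dx.
by apply: eq_bigr => j _; rewrite dirm_delta pdmE.
Qed.

Lemma smooth_comp f : smooth_on E f -> smooth_on D (f \o phi).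
Proof.
move=> sf; apply: (@gen_smooth _ _ D (fun h => exists2 f, smooth_on E f & h = f \o phi)) => //;
  last by apply: gen_base; exists f.
move=> _ [h sh ->]; split=> [x Dx|i].
  apply: continuous_comp; first exact: differentiable_continuous (differentiable_row Dx).
  exact: smooth_cont (phiDE Dx).
split=> [x Dx|]; first by have [] := pd_comp i sh Dx.
exists (fun x => \sum_j pd i (fun y => phi y 0 j) x * pd j h (phi x)).
  apply: gen_sum => j; apply: gen_mul.
    by apply: gen_of_smooth; apply: smooth_pd; exact: sphi.
  by apply: gen_base; exists (pd j h); [exact: smooth_pd|reflexivity].
by move=> x Dx; have [] := pd_comp i sh Dx.
Qed.

Lemma smooth_mx_comp p q (F : 'rV[R]_m -> 'M[R]_(p, q)) :
  smooth_mx_on E F -> smooth_mx_on D (fun x => F (phi x)).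
Proof. by move=> sF a b; exact: (smooth_comp (sF a b)). Qed.

Lemma pdm_comp p q (F : 'rV[R]_m -> 'M[R]_(p, q)) i x : smooth_mx_on E F -> D x ->
  pdm i (fun x => F (phi x)) x =
  \sum_j pd i (fun y => phi y 0 j) x *: pdm j F (phi x).
Proof.
move=> sF Dx; apply/matrixP => a b; rewrite summxE pdmE.
have [_ ->] := pd_comp i (sF a b) Dx.
by apply: eq_bigr => j _; rewrite !(mxE, pdmE).
Qed.

End Composition.

(** * Parallel frames of flat connections *)

Section UnitInterval.
Context {R : realType}.
Implicit Types (f g F : R -> R).

Definition int01 f : R := (\int[@lebesgue_measure R]_(t in `[0%R, 1%R]) f t)%R.

Definition cont01 f : Prop := forall t : R, 0 <= t <= 1 -> {for t, continuous f}.

Lemma cont01_within f : cont01 f -> {within `[0, 1], continuous f}.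
Proof.
move=> cf; apply: continuous_in_subspaceT => t.
by rewrite inE /= in_itv /=; exact: cf.
Qed.

Lemma cont01_integrable f : cont01 f ->
  (@lebesgue_measure R).-integrable `[0%R, 1%R] (EFin \o f).
Proof.
move=> cf; apply: continuous_compact_integrable; first exact: segment_compact.
exact: cont01_within.
Qed.

Lemma int01D f g : cont01 f -> cont01 g ->
  int01 (fun t => f t + g t) = int01 f + int01 g.
Proof. by move=> cf cg; rewrite /int01 RintegralD //; exact: cont01_integrable. Qed.

Lemma int01Z (c : R) f : cont01 f -> int01 (fun t => c * f t) = c * int01 f.
Proof. by move=> cf; rewrite /int01 RintegralZl //; exact: cont01_integrable. Qed.

Lemma eq_int01 f g : (forall t : R, 0 <= t <= 1 -> f t = g t) -> int01 f = int01 g.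
Proof.
move=> E; apply: eq_Rintegral => t; rewrite inE /= in_itv /=; exact: E.
Qed.

Lemma int01_le f (C : R) : cont01 f -> (forall t : R, 0 <= t <= 1 -> `|f t| <= C) ->
  `|int01 f| <= C.
Proof.
move=> cf bf.
have I1 := cont01_integrable cf.
have L : `|int01 f| <= int01 (fun t => `|f t|).
  by refine (le_normr_Rintegral _ I1); exact: measurable_itv.
apply: (le_trans L).
have cC : cont01 (fun=> C) by move=> t _; exact: cst_continuous.
have -> : C = (\int[@lebesgue_measure R]_(t in `[0%R, 1%R]) C)%R.
  rewrite Rintegral_cst //= lebesgue_measure_itv /= lte01 oppr0 addr0 /=.
  by rewrite mulr1.
apply: le_Rintegral.
- exact: measurable_itv.
- apply: cont01_integrable => t t01.
  by apply: (@continuous_comp _ _ _ f Num.norm); [exact: cf|exact: norm_continuous].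
- exact: cont01_integrable cC.
- by move=> t /=; rewrite in_itv /=; exact: bf.
Qed.

Lemma int01_FTC F f : cont01 f ->
  (forall t : R, 0 <= t <= 1 -> is_derive t 1 F (f t)) -> int01 f = F 1 - F 0.
Proof.
move=> cf dF.
have cF (t : R) : 0 <= t <= 1 -> {for t, continuous F}.
  by move=> /dF[d _]; apply: differentiable_continuous; apply/derivable1_diffP.
rewrite /int01 /Rintegral (@continuous_FTC2 R f F 0 1) //.
- exact: cont01_within.
- split.
  + move=> t; rewrite in_itv /= => /andP[/ltW t0 /ltW t1].
    by have [] := dF t (introT andP (conj t0 t1)).
  + by apply: cvg_at_right_filter; apply: cF; rewrite lexx ler01.
  + by apply: cvg_at_left_filter; apply: cF; rewrite lexx ler01.
- move=> t; rewrite in_itv /= => /andP[/ltW t0 /ltW t1].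
  by rewrite derive1E; have [] := dF t (introT andP (conj t0 t1)).
Qed.

End UnitInterval.

Lemma is_derive_of_bound (R : realType) (V : normedModType R) (f : V -> R) (x v : V) (d : R) :
  (forall e : R, 0 < e -> exists2 r : R, 0 < r &
     forall h : R, `|h| < r -> `|f (x + h *: v) - f x - h * d| <= e * `|h|) ->
  is_derive x v f d.
Proof.
move=> H.
suff L : (fun h : R => h^-1 *: ((f \o shift x) (h *: v) - f x)) @ 0^' --> d.
  by split; [apply/cvg_ex; exists d|exact: cvg_lim L].
apply/cvgrPdist_le => e e0; have [r r0 Hr] := H e e0.
near=> h.
have h0 : h != 0 by near: h; exact: nbhs_dnbhs_neq.
have hr : `|h| < r by near: h; exact: dnbhs0_lt.
have := Hr h hr; rewrite /= [h *: v + x]addrC => Hh.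
rewrite /GRing.scale /= -(ler_pM2r (x := `|h|)) ?normr_gt0 // -normrM.
have -> : (d - h^-1 * (f (x + h *: v) - f x)) * h = - (f (x + h *: v) - f x - h * d).
  by field.
by rewrite normrN.
Unshelve. all: by end_near. Qed.

Section Radial.
Context {R : realType} {n : nat}.
Variables (p : 'rV[R]_n) (r : R).
Implicit Types (f g : 'rV[R]_n -> R) (x y : 'rV[R]_n).

Local Notation e_ i := (delta_mx 0 i : 'rV[R]_n).

Definition cball : set 'rV[R]_n := [set y | `|y - p| < r].

Lemma open_cball : open cball.
Proof.
rewrite openE => x Bx; apply/near_ballP; exists (r - `|x - p|); first by rewrite subr_gt0.
move=> y yx; rewrite /cball /= -(subrKA x) (le_lt_trans (ler_normD _ _)) //.
by rewrite -ltrBrDr.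
Qed.

Definition ray (t : R) x : 'rV[R]_n := p + t *: (x - p).

Lemma ray_cball (t : R) x : 0 <= t <= 1 -> cball x -> cball (ray t x).
Proof.
move=> /andP[t0 t1] Bx; rewrite /cball /ray /= addrC addKr normrZ ger0_norm //.
by apply: le_lt_trans Bx; rewrite ler_piMl.
Qed.

Lemma ray_dist (s t : R) x y : `|ray s y - ray t x| <= `|s| * `|y - x| + `|s - t| * `|x - p|.
Proof.
rewrite /ray.
have -> : p + s *: (y - p) - (p + t *: (x - p)) = s *: (y - x) + (s - t) *: (x - p).
  rewrite scalerBl !scalerBr; apply/rowP => j; rewrite !mxE; ring.
by rewrite (le_trans (ler_normD _ _)) // !normrZ.
Qed.

Lemma ray_continuous f x (t : R) : {for ray t x, continuous f} ->
  {for t, continuous (fun s => f (ray s x))}.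
Proof.
move=> /continuousP_norm cf; apply/cvgrPdist_le => e /cf[d d0 H].
have c0 : 0 < 1 + `|x - p| by rewrite ltr_wpDr.
near=> s; rewrite distrC; apply: H.
apply: le_lt_trans (ray_dist s t x x) _; rewrite subrr normr0 mulr0 add0r.
have : `|s - t| < d / (1 + `|x - p|).
  rewrite distrC; near: s; apply: (@cvgr_dist_lt _ _ _ (nbhs t) _ id t); [exact: cvg_id|exact: divr_gt0].
rewrite ltr_pdivlMr // => L; apply: le_lt_trans L.
by rewrite ler_wpM2l // lerDr.
Unshelve. all: by end_near. Qed.

(* Tube lemma along the segment from p to x. *)
Lemma ray_uniform f x (e : R) : (forall y, cball y -> {for y, continuous f}) ->
  cball x -> 0 < e -> exists2 d : R, 0 < d & forall y, `|y - x| < d ->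
  cball y /\ forall t : R, 0 <= t <= 1 -> `|f (ray t y) - f (ray t x)| <= e.
Proof.
move=> cf Bx e0.
have cpt : compact (`[0, 1]%classic : set R) by exact: segment_compact.
have [] := compact_near_coveringP (`[0, 1]%classic : set R) => /(_ cpt) cov _.
have nx := nbhs_filter x.
have := cov _ (nbhs x) (fun y t => `|f (ray t y) - f (ray t x)| <= e) nx.
case.
  move=> t; rewrite /= in_itv /= => t01.
  have Bt := ray_cball t01 Bx.
  have e20 : 0 < e / 2 by rewrite divr_gt0.
  have [d d0 H] := (continuousP_norm _ _).1 (cf _ Bt) _ e20.
  have c0 : 0 < 2 * (1 + `|x - p|) by rewrite mulr_gt0 // ltr_wpDr.
  pose d1 := Num.min 1 (d / (2 * (1 + `|x - p|))).
  have d10 : 0 < d1 by rewrite lt_min ltr01 divr_gt0.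
  exists ([set s | `|s - t| < d1], [set y | `|y - x| < d / 4]) => /=.
    split; last by apply/near_ballP; exists (d / 4) => //; rewrite divr_gt0.
    by apply/nbhs_ballP; exists d1 => //= s; rewrite /ball /= distrC.
  move=> [s y] /= [st yx].
  have [s1 s2] : `|s| <= 2 /\ `|s - t| * `|x - p| < d / 2.
    move: st; rewrite lt_min => /andP[st1]; rewrite ltr_pdivlMr // => st2; split.
      move: t01 => /andP[t0 t1]; rewrite -(subrK t s).
      rewrite (le_trans (ler_normD _ _)) // (ger0_norm t0); lra.
    have := normr_ge0 (s - t); have := normr_ge0 (x - p); nra.
  have A1 : `|f (ray s y) - f (ray t x)| <= e / 2.
    apply: H; apply: le_lt_trans (ray_dist s t x y) _.
    have := normr_ge0 s; have := normr_ge0 (y - x); nra.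
  have A2 : `|f (ray s x) - f (ray t x)| <= e / 2.
    apply: H; apply: le_lt_trans (ray_dist s t x x) _.
    rewrite subrr normr0 mulr0 add0r; lra.
  have -> : f (ray s y) - f (ray s x) = (f (ray s y) - f (ray t x)) - (f (ray s x) - f (ray t x)) by ring.
  rewrite (le_trans (ler_normB _ _)) //; lra.
move=> d /= d0 H.
have : \forall y \near x, cball y /\ forall t : R, 0 <= t <= 1 -> `|f (ray t y) - f (ray t x)| <= e.
  apply: filterS2 (open_nearP open_cball Bx) (_ : nbhs x _) => [y By|]; last first.
    exists d; [exact: d0|exact: H].
  by move=> K; split=> // t t01; apply: K; rewrite /= in_itv.
by move=> /near_ballP.
Qed.

Definition radial (k : nat) f x : R := int01 (fun t => t ^+ k * f (ray t x)).

Lemma radial_ext k f g x : cball x -> (forall y, cball y -> f y = g y) ->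
  radial k f x = radial k g x.
Proof. by move=> Bx E; apply: eq_int01 => t t01; rewrite E //; exact: ray_cball. Qed.

Lemma radial_cont01 k f x : (forall y, cball y -> {for y, continuous f}) -> cball x ->
  cont01 (fun t => t ^+ k * f (ray t x)).
Proof.
move=> cf Bx t t01.
apply: continuousM; first exact: exprn_continuous.
by apply: ray_continuous; apply: cf; exact: ray_cball.
Qed.

Lemma radial_le k f x (C : R) : (forall y, cball y -> {for y, continuous f}) -> cball x ->
  (forall y, cball y -> `|f y| <= C) -> `|radial k f x| <= C.
Proof.
move=> cf Bx bf; apply: int01_le; first exact: radial_cont01.
move=> t t01; rewrite normrM normrX.
have := bf _ (ray_cball t01 Bx).
move: t01 => /andP[t0 t1]; apply: le_trans.
by rewrite ler_piMl // exprn_ile1 // ger0_norm.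
Qed.

Lemma radialD k f g x : (forall y, cball y -> {for y, continuous f}) ->
  (forall y, cball y -> {for y, continuous g}) -> cball x ->
  radial k (fun y => f y + g y) x = radial k f x + radial k g x.
Proof.
move=> cf cg Bx; rewrite /radial -int01D; try exact: radial_cont01.
by apply: eq_int01 => t _; rewrite mulrDr.
Qed.

Lemma radialZ k f x (c : R) : (forall y, cball y -> {for y, continuous f}) -> cball x ->
  radial k (fun y => c * f y) x = c * radial k f x.
Proof.
move=> cf Bx; rewrite /radial -int01Z; last exact: radial_cont01.
by apply: eq_int01 => t _; rewrite mulrCA.
Qed.

Lemma radial_continuous k f x : (forall y, cball y -> {for y, continuous f}) ->
  cball x -> {for x, continuous (radial k f)}.
Proof.
move=> cf Bx; apply/continuousP_norm => e e0.
have [d d0 H] := ray_uniform cf Bx e0; exists d => // y /H[By Hy].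
rewrite /radial -mulN1r -int01Z; last exact: radial_cont01.
have c1 : cont01 (fun t => -1 * (t ^+ k * f (ray t x))).
  move=> t t01; apply: continuousM; first exact: cst_continuous.
  exact: radial_cont01.
rewrite -int01D //; last exact: radial_cont01.
apply: int01_le.
  by move=> t t01; apply: continuousD; [exact: radial_cont01|exact: c1].
move=> t t01; rewrite mulN1r -mulrBr normrM normrX.
apply: le_trans (Hy t t01).
move: t01 => /andP[t0 t1].
by rewrite ler_piMl // exprn_ile1 // ger0_norm.
Qed.

Lemma radial_is_derive k f x i : smooth_on cball f -> cball x ->
  is_derive x (e_ i) (radial k f) (radial k.+1 (pd i f) x).
Proof.
move=> sf Bx; apply: is_derive_of_bound => e e0.
have cf y : cball y -> {for y, continuous f} by exact: smooth_cont.
have cdf y : cball y -> {for y, continuous (pd i f)}.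
  exact: smooth_cont (smooth_pd i sf).
have [d d0 H] := ray_uniform cdf Bx e0.
exists d => // h hd.
have line (s : R) : 0 <= s <= 1 -> `|x + (s * h) *: e_ i - x| < d.
  move=> /andP[s0 s1]; rewrite addrC addKr (le_lt_trans (normZe _ _)) //.
  by rewrite (le_lt_trans _ hd) // normrM ger0_norm // ler_piMl.
have Bh : cball (x + h *: e_ i).
  by have /H[] := line 1 (introT andP (conj ler01 (lexx 1))); rewrite mul1r.
rewrite /radial -mulN1r -[_ - h * _]addrC -mulNr -!int01Z; try exact: radial_cont01.
have c1 : cont01 (fun t => -1 * (t ^+ k * f (ray t x))).
  move=> t t01; apply: continuousM; first exact: cst_continuous.
  exact: radial_cont01.
have c2 : cont01 (fun t => - h * (t ^+ k.+1 * pd i f (ray t x))).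
  move=> t t01; apply: continuousM; first exact: cst_continuous.
  exact: radial_cont01.
have c3 : cont01 (fun t => t ^+ k * f (ray t (x + h *: e_ i))) by exact: radial_cont01.
have c4 : cont01 (fun t => t ^+ k * f (ray t (x + h *: e_ i)) + -1 * (t ^+ k * f (ray t x))).
  by move=> t t01; apply: continuousD; [exact: c3|exact: c1].
rewrite -int01D // -int01D //; apply: int01_le.
  by move=> t t01; apply: continuousD; [exact: c2|exact: c4].
move=> t t01.
have rayE (a : R) : ray t (x + a *: e_ i) = ray t x + (t * a) *: e_ i.
  by rewrite /ray addrAC scalerDr scalerA addrA.
have [s s01|s s01 E] := @MVT_line R _ f (ray t x) (e_ i) (t * h).
  rewrite mulrCA -rayE; apply: (smooth_derivable sf).
  by apply: ray_cball => //; have /H[] := line s s01.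
rewrite mulN1r [_ + - _](_ : _ = t ^+ k * (f (ray t (x + h *: e_ i)) - f (ray t x))); last by ring.
rewrite rayE E [s * (t * h)]mulrCA -rayE.
have /H[_ /(_ t t01)] := line s s01.
rewrite /pd; set a := 'D__ f (ray t (x + _)); set b := 'D__ f (ray t x) => ab.
move: a b ab => a b ab.
have -> : - h * (t ^+ k.+1 * b) + t ^+ k * (t * h * a) = h * (t ^+ k.+1 * (a - b)).
  by rewrite exprS; ring.
rewrite normrM mulrC ler_wpM2r // normrM normrX.
apply: le_trans ab.
move: t01 => /andP[t0 t1].
by rewrite ler_piMl // exprn_ile1 // ger0_norm.
Qed.

Lemma radial_smooth k f : smooth_on cball f -> smooth_on cball (radial k f).
Proof.
move=> sf.
apply: (@gen_smooth _ _ cball (fun h => exists k' f', smooth_on cball f' /\ h = radial k' f')).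
- exact: open_cball.
- move=> _ [k' [f' [sf' ->]]]; split=> [x Bx|i].
    apply: radial_continuous => // y; exact: smooth_cont.
  split=> [x Bx|]; first by have [] := radial_is_derive k' i sf' Bx.
  exists (radial k'.+1 (pd i f')).
    apply: gen_base; exists k'.+1, (pd i f'); split; [exact: smooth_pd|reflexivity].
  by move=> x Bx; have [] := radial_is_derive k' i sf' Bx.
- by apply: gen_base; exists k, f.
Qed.

Lemma pd_radial k f i x : smooth_on cball f -> cball x ->
  pd i (radial k f) x = radial k.+1 (pd i f) x.
Proof. by move=> sf Bx; have [] := radial_is_derive k i sf Bx. Qed.

Lemma radial_euler f x : smooth_on cball f -> cball x ->
  radial 0 f x + \sum_j (x - p) 0 j * radial 1 (pd j f) x = f x.
Proof.
move=> sf Bx.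
have cf y : cball y -> {for y, continuous f} by exact: smooth_cont.
have cdf j y : cball y -> {for y, continuous (pd j f)}.
  exact: smooth_cont (smooth_pd j sf).
pose phi (t : R) := f (ray t x) + \sum_j (x - p) 0 j * (t ^+ 1 * pd j f (ray t x)).
have cs (s : seq 'I_n) : cont01 (fun t => \sum_(j <- s) (x - p) 0 j * (t ^+ 1 * pd j f (ray t x))) /\
   int01 (fun t => \sum_(j <- s) (x - p) 0 j * (t ^+ 1 * pd j f (ray t x))) =
   \sum_(j <- s) (x - p) 0 j * radial 1 (pd j f) x.
  elim: s => [|j s [c I]].
    have E0 : (fun t => \sum_(j <- [::]) (x - p) 0 j * (t ^+ 1 * pd j f (ray t x))) = (fun=> 0).
      by apply/funext => t; rewrite big_nil.
    rewrite E0; split; first by move=> t t01; exact: cst_continuous.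
    rewrite big_nil -[RHS](mul0r (int01 (fun=> 0))) -int01Z.
      by apply: eq_int01 => t _; rewrite mul0r.
    by move=> t _; exact: cst_continuous.
  have cj1 := radial_cont01 (k := 1) (cdf j) Bx.
  have cj : cont01 (fun t => (x - p) 0 j * (t ^+ 1 * pd j f (ray t x))).
    by move=> t t01; apply: continuousM; [exact: cst_continuous|exact: cj1].
  have E : (fun t => \sum_(j <- j :: s) (x - p) 0 j * (t ^+ 1 * pd j f (ray t x))) =
     (fun t => (x - p) 0 j * (t ^+ 1 * pd j f (ray t x)) +
       \sum_(j <- s) (x - p) 0 j * (t ^+ 1 * pd j f (ray t x))).
    by apply/funext => t; rewrite big_cons.
  rewrite E; split.
    by move=> t t01; apply: continuousD; [exact: cj|exact: c].
  by rewrite int01D // I int01Z // big_cons.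
have [c I] := cs (index_enum 'I_n).
have c0 : cont01 (fun t => t ^+ 0 * f (ray t x)) by exact: radial_cont01.
rewrite /radial -[X in _ + X]I -int01D //.
pose F (t : R) : R := t * f (ray t x).
have dF (t : R) : 0 <= t <= 1 -> is_derive t 1 F
    (t ^+ 0 * f (ray t x) + \sum_j (x - p) 0 j * (t ^+ 1 * pd j f (ray t x))).
  move=> t01.
  have [df Df] := smooth_C1 open_cball sf (ray_cball t01 Bx).
  have d1 : is_derive t 1 (fun s => f (ray s x)) ('D_(x - p) f (ray t x)).
    have dd : derivable f (ray t x) (x - p) by exact: diff_derivable.
    exact: (is_derive_line dd).
  have [h1 h2] := is_deriveM (is_derive_id t 1) d1.
  split; first exact: h1.
  apply: etrans h2 _; rewrite Df /GRing.scale /= expr0 mul1r addrC; congr (_ + _).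
    by rewrite mulr1.
  by rewrite mulr_sumr; apply: eq_bigr => j _; rewrite expr1 mulrCA.
have cF : cont01 (fun t => t ^+ 0 * f (ray t x) + \sum_j (x - p) 0 j * (t ^+ 1 * pd j f (ray t x))).
  by move=> t t01; apply: continuousD; [exact: c0|exact: c].
rewrite (int01_FTC cF dF).
by rewrite /F mul1r mul0r subr0 /ray scale1r addrC subrK.
Qed.

(* A primitive of the 1-form beta if beta is closed; [pd_poincare] is the homotopy formula. *)
Definition poincare (beta : 'I_n -> 'rV[R]_n -> R) x : R :=
  \sum_j (x - p) 0 j * radial 0 (beta j) x.

Lemma poincare_smooth beta : (forall j, smooth_on cball (beta j)) ->
  smooth_on cball (poincare beta).
Proof.
move=> sb; apply: smooth_sum => [|j]; first exact: open_cball.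
refine (smoothM open_cball _ (radial_smooth 0 (sb j))).
under eq_fun do rewrite !mxE.
exact: (smoothD open_cball (smooth_coord j open_cball) (@smooth_cst _ _ cball _)).
Qed.

Lemma pd_poincare beta i x : (forall j, smooth_on cball (beta j)) -> cball x ->
  pd i (poincare beta) x = beta i x +
  \sum_j (x - p) 0 j * radial 1 (fun y => pd i (beta j) y - pd j (beta i) y) x.
Proof.
move=> sb Bx.
have sc j : smooth_on cball (fun y => (y - p) 0 j).
  under eq_fun do rewrite !mxE.
  exact: (smoothD open_cball (smooth_coord j open_cball) (@smooth_cst _ _ cball _)).
have cb j y : cball y -> {for y, continuous (beta j)} by exact: smooth_cont.
have cdb k j y : cball y -> {for y, continuous (pd k (beta j))}.
  exact: smooth_cont (smooth_pd k (sb j)).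
have sr j := radial_smooth 0 (sb j).
rewrite /poincare (pd_sum _ i open_cball (fun j => smoothM open_cball (sc j) (sr j)) Bx).
have E j : pd i (fun y => (y - p) 0 j * radial 0 (beta j) y) x =
   (x - p) 0 j * radial 1 (pd i (beta j)) x + (i == j)%:R * radial 0 (beta j) x.
  rewrite (pdM i (sc j) (sr j) Bx) (pd_radial 0 i (sb j) Bx); congr (_ + _ * _).
  have Ec : (fun y : 'rV[R]_n => (y - p) 0 j) = (fun y => y 0 j - p 0 j).
    by apply/funext => y; rewrite !mxE.
  rewrite Ec (pdD i (smooth_coord j open_cball) (@smooth_cst _ _ cball _) Bx) pd_cst addr0.
  have [_ E1] := smooth_C1 open_cball (smooth_coord j open_cball) Bx.
  exact: pd_coord.
rewrite (eq_bigr _ (fun j _ => E j)) big_split /= addrC.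
rewrite (bigD1 i) //= eqxx mul1r big1 ?addr0; last first.
  by move=> j ji; rewrite eq_sym (negbTE ji) mul0r.
have -> : \sum_j (x - p) 0 j * radial 1 (fun y => pd i (beta j) y - pd j (beta i) y) x =
  \sum_j (x - p) 0 j * radial 1 (pd i (beta j)) x - \sum_j (x - p) 0 j * radial 1 (pd j (beta i)) x.
  rewrite -sumrB; apply: eq_bigr => j _; rewrite -mulrBr; congr (_ * _).
  rewrite -mulN1r -radialZ //; last exact: cdb.
  rewrite -radialD //; [|exact: cdb|].
    by congr (radial 1 _ x); apply/funext => y; rewrite mulN1r.
  by move=> y By; apply: continuousM; [exact: cst_continuous|exact: cdb].
have K (a b c d : R) : a + b = c -> a + d = c + (d - b) by lra.
exact: K (radial_euler (sb i) Bx).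
Qed.

End Radial.

Section GeometricSequences.
Context {R : realType}.

Lemma half_pow_small (c e : R) : 0 < e -> exists k : nat, c * 2^-1 ^+ k <= e.
Proof.
move=> e0; have [c0|c0] := lerP c 0.
  by exists 0%N; rewrite expr0 mulr1 (le_trans c0) // ltW.
have ce : 0 <= c / e by rewrite divr_ge0 ?ltW.
have := archi_boundP ce; set k := Num.bound _ => ck; exists k.
rewrite exprVn ler_pdivrMr ?exprn_gt0 // mulrC -ler_pdivrMr //.
apply: le_trans (ltW ck) _; rewrite -natrX ler_nat.
exact: ltnW (ltn_expl _ _).
Qed.

Lemma le_of_half_pow (a b c : R) : (forall k, a <= b + c * 2^-1 ^+ k) -> a <= b.
Proof.
move=> H; apply/ler_addgt0Pr => e e0; have [k ck] := half_pow_small c e0.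
by apply: le_trans (H k) _; rewrite lerD2l.
Qed.

Lemma geometric_limit (u : nat -> R) (d : R) :
  (forall k, `|u k.+1 - u k| <= d * 2^-1 ^+ k) ->
  exists l, forall k, `|l - u k| <= 2 * d * 2^-1 ^+ k.
Proof.
move=> H.
have d0 : 0 <= d by have := H 0%N; rewrite expr0 mulr1; exact: le_trans.
pose a k := u k - 2 * d * 2^-1 ^+ k; pose b k := u k + 2 * d * 2^-1 ^+ k.
have P k : 0 <= (2^-1 : R) ^+ k by rewrite exprn_ge0.
have na : nondecreasing_seq a.
  apply/nondecreasing_seqP => k; rewrite /a exprS.
  have := H k; rewrite ler_norml => /andP[H1 H2]; have := P k; nra.
have nb : nonincreasing_seq b.
  apply/nonincreasing_seqP => k; rewrite /b exprS.
  have := H k; rewrite ler_norml => /andP[H1 H2]; have := P k; nra.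
have ab j k : a j <= b k.
  apply: (@le_trans _ _ (a (maxn j k))); first by apply: na; exact: leq_maxl.
  apply: (@le_trans _ _ (b (maxn j k))); last by apply: nb; exact: leq_maxr.
  by rewrite /a /b; have := mulr_ge0 d0 (P (maxn j k)); lra.
pose S : set R := range a.
have S0 : S (a 0%N) by exists 0%N.
have Sub k : ubound S (b k) by move=> _ [j _ <-].
exists (sup S) => k; rewrite ler_norml; apply/andP; split.
  have : a k <= sup S by apply: ub_le_sup; [exists (b 0%N); exact: Sub|exists k].
  rewrite /a; lra.
have : sup S <= b k by apply: ge_sup; [exists (a 0%N)|exact: Sub].
rewrite /b; lra.
Qed.

Lemma ler_term (T : finType) (F : T -> R) i : (forall j, 0 <= F j) -> F i <= \sum_j F j.
Proof. by move=> F0; rewrite (bigD1 i) //= lerDl sumr_ge0. Qed.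

Lemma ler_sum_cst (k : nat) (F : 'I_k -> R) (c : R) : (forall i, F i <= c) ->
  \sum_i F i <= k%:R * c.
Proof.
move=> H; apply: le_trans (ler_sum _ (fun i _ => H i)) _.
by rewrite sumr_const card_ord mulr_natl.
Qed.

End GeometricSequences.

Section Picard.
Context {R : realType} {n m q : nat}.
Variables (p : 'rV[R]_n) (r K : R) (G : 'I_n -> 'rV[R]_n -> 'M[R]_m).
Variable F0 : 'M[R]_(q, m).
Hypothesis K0 : 0 < K.
Local Notation B := (cball p r).
Local Notation oB := (@open_cball R n p r).
Local Notation e_ i := (delta_mx 0 i : 'rV[R]_n).
Hypothesis sG : forall i, smooth_mx_on B (G i).
Hypothesis flatG : forall i j x, B x ->
  pdm i (G j) x - pdm j (G i) x + G i x *m G j x - G j x *m G i x = 0.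
Hypothesis GK : forall i a b x, B x -> `|G i x a b| <= K.
Hypothesis small : n%:R * r * (m%:R * K) <= 8^-1.

Fixpoint picard (k : nat) : 'rV[R]_n -> 'M[R]_(q, m) :=
  if k is k'.+1 then
    fun x => \matrix_(a, b) (F0 a b + poincare p (fun j y => (picard k' y *m G j y) a b) x)
  else fun=> F0.

Lemma picard_smooth k : smooth_mx_on B (picard k).
Proof.
elim: k => [|k IH] a b; first exact: smooth_cst.
rewrite /=; under eq_fun do rewrite mxE.
refine (smoothD oB (@smooth_cst _ _ B (F0 a b)) (poincare_smooth _)) => j.
exact: (smooth_mxM oB IH (sG j) a b).
Qed.

Lemma mulmx_entry_le s (A : 'M[R]_(s, m)) i x a b (c : R) : 0 <= c ->
  (forall a b, `|A a b| <= c) -> B x -> `|(A *m G i x) a b| <= m%:R * K * c.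
Proof.
move=> c0 H Bx; rewrite mxE (le_trans (ler_norm_sum _ _ _)) // -mulrA.
by apply: ler_sum_cst => j; rewrite normrM mulrC ler_pM //; exact: GK.
Qed.

Lemma poincare_le (beta : 'I_n -> 'rV[R]_n -> R) x (c : R) k :
  0 <= c -> (forall j y, B y -> {for y, continuous (beta j)}) -> B x ->
  (forall j y, B y -> `|beta j y| <= c) ->
  `|\sum_j (x - p) 0 j * radial p k (beta j) x| <= n%:R * r * c.
Proof.
move=> c0 cb Bx bc; rewrite (le_trans (ler_norm_sum _ _ _)) // -mulrA.
apply: ler_sum_cst => j; rewrite normrM ler_pM //.
  exact: le_trans (coord_le_norm _ _) (ltW Bx).
by apply: (@radial_le _ _ p r) => //; [exact: cb|exact: bc].
Qed.

Definition F0bound : R := \sum_a \sum_b `|F0 a b|.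

Lemma F0bound_ge a b : `|F0 a b| <= F0bound.
Proof.
apply: le_trans (ler_term (F := fun b => `|F0 a b|) b _) _ => //.
by apply: (ler_term (F := fun a => \sum_b `|F0 a b|)) => j; exact: sumr_ge0.
Qed.

Lemma F0bound_ge0 : 0 <= F0bound.
Proof. by apply: sumr_ge0 => a _; exact: sumr_ge0. Qed.

Lemma picard_cont k a b j y : B y ->
  {for y, continuous (fun y => (picard k y *m G j y) a b)}.
Proof. exact: smooth_cont (smooth_mxM oB (picard_smooth k) (sG j) a b). Qed.

Lemma picard_step k x a b : B x ->
  `|picard k.+1 x a b - picard k x a b| <= F0bound * 2^-1 ^+ k.
Proof.
have mK : 0 <= m%:R * K by rewrite mulr_ge0 // ltW.
elim: k x a b => [|k IH] x a b Bx.
  rewrite expr0 mulr1 /= mxE addrC addKr.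
  have : `|poincare p (fun j y => (F0 *m G j y) a b) x| <= n%:R * r * (m%:R * K * F0bound).
    apply: poincare_le => //.
    - by rewrite mulr_ge0 // F0bound_ge0.
    - by move=> j y; exact: (@picard_cont 0 a b j y).
    - move=> j y By; apply: mulmx_entry_le => //; first exact: F0bound_ge0.
      exact: F0bound_ge.
  move/le_trans; apply; rewrite mulrA.
  have := F0bound_ge0; move: small; nra.
have -> : picard k.+2 x a b - picard k.+1 x a b =
  \sum_j (x - p) 0 j * radial p 0 (fun y => ((picard k.+1 y - picard k y) *m G j y) a b) x.
  rewrite /= !mxE opprD addrACA subrr add0r /poincare -sumrB.
  apply: eq_bigr => j _; rewrite -mulrBr; congr (_ * _).
  rewrite -mulN1r -(@radialZ _ _ p r) //; last by move=> y; exact: (@picard_cont _ a b j y).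
  rewrite -(@radialD _ _ p r) //; [|by move=> y; exact: (@picard_cont k.+1 a b j y)|].
    by congr (radial p 0 _ x); apply/funext => y; rewrite mulmxBl !mxE mulN1r.
  by move=> y By; apply: continuousM; [exact: cst_continuous|exact: (@picard_cont _ a b j y)].
have P k' : 0 <= F0bound * (2^-1 : R) ^+ k' by rewrite mulr_ge0 ?F0bound_ge0 ?exprn_ge0.
apply: (@le_trans _ _ (n%:R * r * (m%:R * K * (F0bound * 2^-1 ^+ k)))).
  apply: poincare_le => //.
  - by rewrite mulr_ge0.
  - move=> j y; apply: smooth_cont.
    exact: (smooth_mxM oB (smooth_mxB oB (picard_smooth k.+1) (picard_smooth k)) (sG j) a b).
  - move=> j y By; apply: mulmx_entry_le => // a' b'.
    by have := IH y a' b' By; rewrite !mxE.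
rewrite exprS; have := P k; move: small; nra.
Qed.

(* The iterates are parallel only in the limit. By the homotopy formula and flatness the
   defect from being parallel reproduces itself, so it decays geometrically on a small ball. *)
Definition defect k i x : 'M[R]_(q, m) := pdm i (picard k) x - picard k x *m G i x.

Lemma defect_smooth k i : smooth_mx_on B (defect k i).
Proof.
exact: (smooth_mxB oB (smooth_mx_pdm i (picard_smooth k)) (smooth_mxM oB (picard_smooth k) (sG i))).
Qed.

Lemma defectS k i x a b : B x ->
  defect k.+1 i x a b = ((picard k x - picard k.+1 x) *m G i x) a b +
   \sum_j (x - p) 0 j *
      radial p 1 (fun y => (defect k i y *m G j y - defect k j y *m G i y) a b) x.
Proof.
move=> Bx; have sFG j := smooth_mxM oB (picard_smooth k) (sG j).
rewrite /defect mxE pdmE mulmxBl [in RHS]mxE.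
have -> : (fun y => picard k.+1 y a b) =
    (fun y => F0 a b + poincare p (fun j y => (picard k y *m G j y) a b) y).
  by apply/funext => y; rewrite /= mxE.
have sb j := sFG j a b.
rewrite (pdD i (@smooth_cst _ _ B _) (poincare_smooth sb) Bx) pd_cst add0r.
rewrite (pd_poincare i sb Bx).
set S := \sum_j _; set S' := \sum_j _.
have -> : S = S'.
  apply: eq_bigr => j _; congr (_ * _).
  apply: (@radial_ext _ _ p r _ _ _ x Bx) => y By.
  have E k1 k2 : pd k1 (fun y => (picard k y *m G k2 y) a b) y =
      (pdm k1 (fun y => picard k y *m G k2 y) y) a b by rewrite pdmE.
  rewrite !E !(pdmM _ oB (picard_smooth k) (sG _) By).
  have -> (A C : 'M[R]_(q, m)) : A a b - C a b = (A - C) a b by rewrite !mxE.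
  congr (fun_of_matrix _ a b); apply/eqP; rewrite -subr_eq0; apply/eqP.
  transitivity (picard k y *m (pdm i (G j) y - pdm j (G i) y + G i y *m G j y - G j y *m G i y)).
    rewrite /defect !mulmxBl !mulmxBr !mulmxDr !mulmxN !mulmxA.
    move: (_ *m pdm i _ y) (_ *m pdm j _ y) (_ *m G i y *m _) (_ *m G j y *m _) (pdm i _ y *m _) (pdm j _ y *m _) => a1 a2 a3 a4 a5 a6.
    by apply/matrixP => u v; rewrite !mxE; ring.
  by rewrite flatG // mulmx0.
by rewrite [LHS]addrAC.
Qed.

Lemma defect_le k i x a b : B x ->
  `|defect k i x a b| <= 4 * (m%:R * K * F0bound) * 2^-1 ^+ k.
Proof.
have mK : 0 <= m%:R * K by rewrite mulr_ge0 // ltW.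
have MF : 0 <= m%:R * K * F0bound by rewrite mulr_ge0 // F0bound_ge0.
have P k' : 0 <= (m%:R * K * F0bound) * (2^-1 : R) ^+ k' by rewrite mulr_ge0 ?exprn_ge0.
elim: k i x a b => [|k IH] i x a b Bx.
  rewrite /defect /= pdm_cst sub0r mxE normrN expr0 mulr1.
  have : `|(F0 *m G i x) a b| <= m%:R * K * F0bound.
    by apply: mulmx_entry_le => //; [exact: F0bound_ge0|exact: F0bound_ge].
  by move/le_trans; apply; lra.
rewrite defectS // (le_trans (ler_normD _ _)) //.
set c := 4 * (m%:R * K * F0bound) * 2^-1 ^+ k in IH *.
have c0 : 0 <= c by rewrite /c -mulrA mulr_ge0.
have A1 : `|((picard k x - picard k.+1 x) *m G i x) a b| <= m%:R * K * (F0bound * 2^-1 ^+ k).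
  apply: mulmx_entry_le => //; first by rewrite mulr_ge0 ?F0bound_ge0 ?exprn_ge0.
  by move=> a' b'; rewrite mxE [X in _ + X]mxE distrC; exact: picard_step.
have A2 : `|\sum_j (x - p) 0 j *
    radial p 1 (fun y => (defect k i y *m G j y - defect k j y *m G i y) a b) x| <=
    n%:R * r * (2 * (m%:R * K * c)).
  apply: poincare_le => //.
  - by rewrite mulr_ge0 // mulr_ge0.
  - move=> j y; apply: smooth_cont.
    exact: (smooth_mxB oB (smooth_mxM oB (defect_smooth k i) (sG j))
      (smooth_mxM oB (defect_smooth k j) (sG i)) a b).
  - move=> j y By; rewrite mxE [X in _ + X]mxE (le_trans (ler_normB _ _)) //.
    have h1 : `|(defect k i y *m G j y) a b| <= m%:R * K * c.
      by apply: mulmx_entry_le => // a' b'; exact: IH.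
    have h2 : `|(defect k j y *m G i y) a b| <= m%:R * K * c.
      by apply: mulmx_entry_le => // a' b'; exact: IH.
    by rewrite mulr_natl mulr2n lerD.
apply: le_trans (lerD A1 A2) _.
have A3 : n%:R * r * (2 * (m%:R * K * c)) <= 4^-1 * c.
  by move: small c0; nra.
apply: le_trans (lerD (lexx _) A3) _.
rewrite /c exprS; have := P k; move: (m%:R * K) F0bound (2^-1 ^+ k) => u v w; nra.
Qed.

Lemma picard_center k : picard k p = F0.
Proof.
case: k => // k; apply/matrixP => a b; rewrite mxE /poincare big1 ?addr0 //.
by move=> j _; rewrite subrr mxE mul0r.
Qed.

Lemma picard_limit : 0 < r -> exists F : 'rV[R]_n -> 'M[R]_(q, m),
  [/\ smooth_mx_on B F, F p = F0 & forall i x, B x -> pdm i F x = F x *m G i x].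
Proof.
have mK : 0 <= m%:R * K by rewrite mulr_ge0 // ltW.
move=> r0; have F00 := F0bound_ge0.
have Bp : B p by rewrite /cball /= subrr normr0.
have ex (z : 'rV[R]_n * 'I_q * 'I_m) : exists l : R, B z.1.1 ->
    forall k, `|l - picard k z.1.1 z.1.2 z.2| <= 2 * F0bound * 2^-1 ^+ k.
  case: (pselect (B z.1.1)) => [Bz|nB]; last by exists 0.
  have [l Hl] := @geometric_limit R (fun k => picard k z.1.1 z.1.2 z.2) F0bound
    (fun k => picard_step k z.1.2 z.2 Bz).
  by exists l.
have [lim Hlim] := choice ex.
pose F x : 'M[R]_(q, m) := \matrix_(a, b) lim (x, a, b).
have HF x a b k : B x -> `|F x a b - picard k x a b| <= 2 * F0bound * 2^-1 ^+ k.
  by move=> Bx; rewrite mxE; exact: (Hlim (x, a, b) Bx).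
have P k : 0 <= (2^-1 : R) ^+ k by rewrite exprn_ge0.
have cF a b x : B x -> {for x, continuous (fun y => F y a b)}.
  move=> Bx; apply/continuousP_norm => e e0.
  have e4 : 0 < e / 4 by rewrite divr_gt0.
  have [k Hk] := half_pow_small (2 * F0bound) e4.
  have [d1 d10 H1] := (near_ballP B x).1 (open_nearP oB Bx).
  have [d d0 H] := (continuousP_norm _ x).1 (smooth_cont (picard_smooth k a b) Bx) _ e4.
  exists (Num.min d1 d); first by rewrite lt_min d10.
  move=> y; rewrite lt_min => /andP[/H1 By /H Hy].
  have := HF x a b k Bx; have := HF y a b k By; move: Hy Hk.
  move: (F y a b) (F x a b) (picard k y a b) (picard k x a b) (_ * _ ^+ _) => a1 a2 a3 a4 c.
  rewrite !ler_norml => /andP[? ?] ? /andP[? ?] /andP[? ?]; apply/andP; split; lra.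
have sGc i j k x : B x -> {for x, continuous (fun y => G i y j k)}.
  exact: smooth_cont (sG i j k).
have cFG i a b x : B x -> {for x, continuous (fun y => (F y *m G i y) a b)}.
  move=> Bx.
  have E (s : seq 'I_m) : {for x, continuous (fun y => \sum_(j <- s) F y a j * G i y j b)}.
    elim: s => [|j s IH].
      have -> : (fun y => \sum_(j <- [::]) F y a j * G i y j b) = (fun=> 0).
        by apply/funext => y; rewrite big_nil.
      exact: cst_continuous.
    have -> : (fun y => \sum_(j <- j :: s) F y a j * G i y j b) =
        (fun y => F y a j * G i y j b + \sum_(j <- s) F y a j * G i y j b).
      by apply/funext => y; rewrite big_cons.
    apply: continuousD; last exact: IH.
    by apply: continuousM; [exact: cF|exact: sGc].
  have -> : (fun y => (F y *m G i y) a b) = (fun y => \sum_j F y a j * G i y j b).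
    by apply/funext => y; rewrite mxE.
  exact: E.
have dF i a b x : B x -> is_derive x (e_ i) (fun y => F y a b) ((F x *m G i x) a b).
  move=> Bx; apply: is_derive_of_bound => e e0.
  have [d1 d10 H1] := (near_ballP B x).1 (open_nearP oB Bx).
  have [d d0 H] := (continuousP_norm _ x).1 (cFG i a b x Bx) _ e0.
  exists (Num.min d1 d); first by rewrite lt_min d10.
  move=> h; rewrite lt_min => /andP[hd1 hd].
  have line (s : R) : 0 <= s <= 1 -> `|x + (s * h) *: e_ i - x| <= `|h|.
    move=> /andP[s0 s1]; rewrite addrC addKr (le_trans (normZe _ _)) //.
    by rewrite normrM ger0_norm // ler_piMl.
  have lineB (s : R) (s01 : 0 <= s <= 1) : B (x + (s * h) *: e_ i).
    by apply: H1; apply: le_lt_trans hd1; exact: line.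
  have Bh : B (x + h *: e_ i).
    by have := lineB 1 (introT andP (conj ler01 (lexx 1))); rewrite mul1r.
  pose M := 4 * F0bound + `|h| * (m%:R * K * (2 * F0bound) + 4 * (m%:R * K * F0bound)).
  rewrite [e * _]mulrC; apply: (@le_of_half_pow _ _ _ M) => k.
  have [s s01|s s01 E] := @MVT_line R _ (fun y => picard k y a b) x (e_ i) h.
    exact: smooth_derivable (picard_smooth k a b) (lineB s s01).
  have Bs := lineB s s01; move: (line s s01) E; set z := x + (s * h) *: e_ i in Bs * => Hz E.
  have E2 : 'D_(e_ i) (fun y => picard k y a b) z = (picard k z *m G i z) a b + defect k i z a b.
    by rewrite /defect [X in _ + X]mxE pdmE [X in _ + (_ + X)]mxE addrC subrK.
  rewrite E2 in E.
  have T1 := HF x a b k Bx; have T2 := HF _ a b k Bh.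
  have T3 := defect_le k i a b Bs.
  have T4 : `|(F z *m G i z) a b - (F x *m G i x) a b| <= e.
    by apply: H; apply: le_lt_trans hd.
  have T5 : `|(picard k z *m G i z) a b - (F z *m G i z) a b| <= m%:R * K * (2 * F0bound * 2^-1 ^+ k).
    have -> : (picard k z *m G i z) a b - (F z *m G i z) a b = ((picard k z - F z) *m G i z) a b.
      by rewrite mulmxBl !mxE.
    apply: mulmx_entry_le => //; first by rewrite !mulr_ge0.
    by move=> a' b'; rewrite mxE [X in _ + X]mxE distrC; exact: HF.
  have -> : F (x + h *: e_ i) a b - F x a b - h * (F x *m G i x) a b =
    (F (x + h *: e_ i) a b - picard k (x + h *: e_ i) a b) - (F x a b - picard k x a b) +
    h * (((F z *m G i z) a b - (F x *m G i x) a b) +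
         ((picard k z *m G i z) a b - (F z *m G i z) a b) + defect k i z a b).
    move: E; move: (F _ a b) (picard k _ a b) (picard k x a b) (F x a b) => a1 a2 a3 a4.
    move: (fun_of_matrix _ a b) (fun_of_matrix (F x *m _) a b) (fun_of_matrix (F z *m _) a b) => a5 a6 a7.
    move: (defect _ _ _ a b) => a8 E.
    have -> : a2 = h * (a5 + a8) + a3 by rewrite -E; ring.
    ring.
  rewrite (le_trans (ler_normD _ _)) //.
  have U1 := le_trans (ler_normB _ _) (lerD T2 T1).
  have U2 := le_trans (ler_normD _ _) (lerD (le_trans (ler_normD _ _) (lerD T4 T5)) T3).
  have U3 := ler_wpM2l (normr_ge0 h) U2; rewrite -normrM in U3.
  apply: le_trans (lerD U1 U3) _.
  by rewrite /M le_eqVlt; apply/orP; left; apply/eqP; ring.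
have EF i a b x : B x -> pd i (fun y => F y a b) x = (F x *m G i x) a b.
  by move=> Bx; have [] := dF i a b x Bx.
exists F; split.
- move=> a b.
  apply: (@gen_smooth _ _ B (fun h => exists a b, h = (fun y => F y a b))).
  + exact: oB.
  + move=> _ [a' [b' ->]]; split=> [x Bx|i]; first exact: cF.
    split=> [x Bx|]; first by have [] := dF i a' b' x Bx.
    exists (fun x => \sum_j F x a' j * G i x j b').
      apply: gen_sum => j; apply: gen_mul; first by apply: gen_base; exists a', j.
      by apply: gen_of_smooth; exact: sG.
    by move=> x Bx; rewrite EF // mxE.
  + by apply: gen_base; exists a, b.
- apply/matrixP => a b; apply/eqP; rewrite -subr_eq0 -normr_eq0.
  apply/eqP/le_anti; rewrite normr_ge0 andbT.
  apply: (@le_of_half_pow _ _ _ (2 * F0bound)) => k; rewrite add0r.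
  by rewrite -{1}(picard_center k); exact: HF.
- by move=> i x Bx; apply/matrixP => a b; rewrite pdmE EF.
Qed.

End Picard.

(* Frobenius: a flat connection has a parallel frame with prescribed initial value. *)
Lemma flat_connection_frame (R : realType) (n m q : nat) (D : set 'rV[R]_n) (p : 'rV[R]_n)
    (G : 'I_n -> 'rV[R]_n -> 'M[R]_m) (F0 : 'M[R]_(q, m)) :
  open D -> D p -> (forall i, smooth_mx_on D (G i)) ->
  (forall i j x, D x ->
     pdm i (G j) x - pdm j (G i) x + G i x *m G j x - G j x *m G i x = 0) ->
  exists (r : R) (F : 'rV[R]_n -> 'M[R]_(q, m)),
    [/\ 0 < r, cball p r `<=` D, smooth_mx_on (cball p r) F, F p = F0 &
      forall i x, cball p r x -> pdm i F x = F x *m G i x].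
Proof.
move=> oD Dp sG flat.
have [r1 r10 Dr1] := (near_ballP D p).1 (open_nearP oD Dp).
pose S := \sum_i \sum_a \sum_b `|G i p a b|.
have GS i a b : `|G i p a b| <= S.
  apply: le_trans (ler_term (F := fun b => `|G i p a b|) b _) _ => //.
  apply: le_trans (ler_term (F := fun a => \sum_b `|G i p a b|) a _) _ => [j|].
    exact: sumr_ge0.
  apply: (ler_term (F := fun i => \sum_a \sum_b `|G i p a b|)) => j.
  by apply: sumr_ge0 => ? _; exact: sumr_ge0.
have S0 : 0 <= S.
  by do 3 (apply: sumr_ge0 => ? _).
have : forall z : 'I_n * 'I_m * 'I_m, exists d : R, 0 < d /\
    forall y, `|y - p| < d -> `|G z.1.1 y z.1.2 z.2 - G z.1.1 p z.1.2 z.2| <= 1.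
  move=> z; have [d d0 H] := (continuousP_norm _ p).1
    (smooth_cont (sG z.1.1 z.1.2 z.2) Dp) 1 ltr01.
  by exists d.
move=> /choice[d Hd].
pose K := 1 + S.
have K0 : 0 < K by rewrite ltr_wpDr.
pose r2 := \big[Order.min/r1]_z d z.
have r20 : 0 < r2 by apply: lt_bigmin => // z _; case: (Hd z).
pose c := 1 + n%:R * (m%:R * K).
have nm0 : 0 <= n%:R * (m%:R * K) by rewrite !mulr_ge0 // ltW.
have c0 : 0 < c by rewrite ltr_wpDr.
pose r := Num.min r2 (8^-1 / c).
have r0 : 0 < r by rewrite lt_min r20 divr_gt0.
have r2r : r <= r2 by rewrite ge_min lexx.
have BD : cball p r `<=` D.
  move=> y By; apply: Dr1; apply: lt_le_trans By _; apply: le_trans r2r _.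
  exact: bigmin_le_id.
have GK i a b x : cball p r x -> `|G i x a b| <= K.
  move=> Bx; have [_ H] := Hd (i, a, b).
  have : `|G i x a b - G i p a b| <= 1.
    apply: H; apply: lt_le_trans Bx _; apply: le_trans r2r _; exact: bigmin_le.
  have := GS i a b; rewrite !ler_norml /K => /andP[? ?] /andP[? ?].
  by apply/andP; split; lra.
have small : n%:R * r * (m%:R * K) <= 8^-1.
  have rc : r * c <= 8^-1 by rewrite -ler_pdivlMr // ge_min lexx orbT.
  rewrite mulrAC; apply: le_trans rc; rewrite mulrC ler_pM2l // /c; lra.
have [F [sF Fp dF]] := @picard_limit R n m q p r K G F0 K0
  (fun i => smooth_mx_subset BD (sG i)) (fun i j x Bx => flat i j x (BD x Bx)) GK small r0.
by exists r, F.
Qed.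

(** * Linear algebra of 2-forms in dimension four *)

Notation o0 := (@Ordinal 4 0 isT).
Notation o1 := (@Ordinal 4 1 isT).
Notation o2 := (@Ordinal 4 2 isT).
Notation o3 := (@Ordinal 4 3 isT).

Lemma I4P (P : 'I_4 -> Prop) : P o0 -> P o1 -> P o2 -> P o3 -> forall i, P i.
Proof.
move=> P0 P1 P2 P3 [[|[|[|[|//]]]] Hi].
- by rewrite (_ : Ordinal Hi = o0) //; exact: val_inj.
- by rewrite (_ : Ordinal Hi = o1) //; exact: val_inj.
- by rewrite (_ : Ordinal Hi = o2) //; exact: val_inj.
- by rewrite (_ : Ordinal Hi = o3) //; exact: val_inj.
Qed.

Section Standard.
Context {R : realType}.
Implicit Types (A B P Q : 'M[R]_4).

Lemma sum4 (V : nmodType) (f : 'I_4 -> V) : \sum_i f i = f o0 + f o1 + f o2 + f o3.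
Proof.
rewrite !big_ord_recl big_ord0 addr0 !addrA.
by congr (f _ + f _ + f _ + f _); exact: val_inj.
Qed.

Lemma mx4P A B : (forall i j : 'I_4, A i j = B i j) -> A = B.
Proof. by move=> E; apply/matrixP. Qed.

Definition mx4 (s : seq (seq R)) : 'M[R]_4 :=
  \matrix_(i, j) nth 0 (nth [::] s i) j.

Definition skew4 (a b c d e f : R) : 'M[R]_4 :=
  mx4 [:: [:: 0; a; b; c]; [:: - a; 0; d; e]; [:: - b; - d; 0; f]; [:: - c; - e; - f; 0]].

Definition J0 : 'M[R]_4 := skew4 1 0 0 0 0 1.

(* An orthonormal basis of the forms orthogonal to J0 = e01 + e23: the antiselfdual
   e01 - e23, e02 + e13, e03 - e12, then the selfdual e02 - e13, e03 + e12. *)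
Definition E5 (m : 'I_5) : 'M[R]_4 :=
  let d (k : nat) : R := (val m == k)%:R in
  skew4 (d 0%N) (d 1%N + d 3%N) (d 2%N + d 4%N) (d 4%N - d 2%N) (d 1%N - d 3%N) (- d 0%N).

Definition det4 (f : nat -> nat -> R) : R :=
  f 0 0 * f 1 1 * f 2 2 * f 3 3 - f 0 0 * f 1 1 * f 2 3 * f 3 2
  - f 0 0 * f 1 2 * f 2 1 * f 3 3 + f 0 0 * f 1 2 * f 2 3 * f 3 1
  + f 0 0 * f 1 3 * f 2 1 * f 3 2 - f 0 0 * f 1 3 * f 2 2 * f 3 1
  - f 0 1 * f 1 0 * f 2 2 * f 3 3 + f 0 1 * f 1 0 * f 2 3 * f 3 2
  + f 0 1 * f 1 2 * f 2 0 * f 3 3 - f 0 1 * f 1 2 * f 2 3 * f 3 0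
  - f 0 1 * f 1 3 * f 2 0 * f 3 2 + f 0 1 * f 1 3 * f 2 2 * f 3 0
  + f 0 2 * f 1 0 * f 2 1 * f 3 3 - f 0 2 * f 1 0 * f 2 3 * f 3 1
  - f 0 2 * f 1 1 * f 2 0 * f 3 3 + f 0 2 * f 1 1 * f 2 3 * f 3 0
  + f 0 2 * f 1 3 * f 2 0 * f 3 1 - f 0 2 * f 1 3 * f 2 1 * f 3 0
  - f 0 3 * f 1 0 * f 2 1 * f 3 2 + f 0 3 * f 1 0 * f 2 2 * f 3 1
  + f 0 3 * f 1 1 * f 2 0 * f 3 2 - f 0 3 * f 1 1 * f 2 2 * f 3 0
  - f 0 3 * f 1 2 * f 2 0 * f 3 1 + f 0 3 * f 1 2 * f 2 1 * f 3 0.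

Let minor0 (f : nat -> nat -> R) (j a b : nat) : R := f a.+1 (bump j b).

Lemma det_fun_row0 n (f : nat -> nat -> R) :
  \det (\matrix_(i < n.+1, j < n.+1) f i j) =
  \sum_(j < n.+1) f 0%N j * ((-1) ^+ j * \det (\matrix_(i < n, k < n) minor0 f j i k)).
Proof.
rewrite (expand_det_row _ ord0); apply: eq_bigr => j _.
rewrite /cofactor mxE add0n; congr (_ * (_ * \det _)).
by apply/matrixP => a b; rewrite !mxE.
Qed.

Lemma det4E (f : nat -> nat -> R) : \det (\matrix_(i < 4, j < 4) f i j) = det4 f.
Proof.
have d1 (g : nat -> nat -> R) : \det (\matrix_(i < 1, j < 1) g i j) = g 0%N 0%N.
  by rewrite det_mx11 mxE.
have d2 (g : nat -> nat -> R) : \det (\matrix_(i < 2, j < 2) g i j) =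
    g 0%N 0%N * g 1%N 1%N - g 0%N 1%N * g 1%N 0%N.
  rewrite det_fun_row0 !big_ord_recl big_ord0 !d1 /minor0 /= /bump /= !addn0 expr0 expr1.
  ring.
have d3 (g : nat -> nat -> R) : \det (\matrix_(i < 3, j < 3) g i j) =
    g 0%N 0%N * (g 1%N 1%N * g 2%N 2%N - g 1%N 2%N * g 2%N 1%N)
    - g 0%N 1%N * (g 1%N 0%N * g 2%N 2%N - g 1%N 2%N * g 2%N 0%N)
    + g 0%N 2%N * (g 1%N 0%N * g 2%N 1%N - g 1%N 1%N * g 2%N 0%N).
  rewrite det_fun_row0 !big_ord_recl big_ord0 !d2 /minor0 /= /bump /= !addn0 expr0 expr1.
  ring.
rewrite det_fun_row0 !big_ord_recl big_ord0 !d3 /minor0 /= /bump /= !addn0 /det4 expr0 expr1.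
ring.
Qed.

Lemma eps_sum (h : 'I_4 -> 'I_4 -> 'I_4 -> 'I_4 -> R) :
  \sum_i \sum_j \sum_k \sum_l eps i j k l * h i j k l =
  h o0 o1 o2 o3 - h o0 o1 o3 o2 - h o0 o2 o1 o3 + h o0 o2 o3 o1 + h o0 o3 o1 o2 - h o0 o3 o2 o1
  - h o1 o0 o2 o3 + h o1 o0 o3 o2 + h o1 o2 o0 o3 - h o1 o2 o3 o0 - h o1 o3 o0 o2 + h o1 o3 o2 o0
  + h o2 o0 o1 o3 - h o2 o0 o3 o1 - h o2 o1 o0 o3 + h o2 o1 o3 o0 + h o2 o3 o0 o1 - h o2 o3 o1 o0
  - h o3 o0 o1 o2 + h o3 o0 o2 o1 + h o3 o1 o0 o2 - h o3 o1 o2 o0 - h o3 o2 o0 o1 + h o3 o2 o1 o0.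
Proof.
pose f (i j k l : nat) (r s : nat) : R := (nth 0%N [:: i; j; k; l] r == s)%:R.
have epsE (i j k l : 'I_4) : eps i j k l = det4 (f i j k l).
  rewrite -det4E /eps; congr (\det _); apply/matrixP => r s; rewrite !mxE /f.
  congr ((_ : bool)%:R); rewrite -(inj_eq val_inj) (tnth_nth i) /=; congr (_ == _).
  by move: r; apply: I4P.
pose S (g : 'I_4 -> 'I_4 -> 'I_4 -> 'I_4 -> R) :=
  \sum_i \sum_j \sum_k \sum_l g i j k l * h i j k l.
have SD g1 g2 : S (fun i j k l => g1 i j k l + g2 i j k l) = S g1 + S g2.
  rewrite /S -big_split; apply: eq_bigr => i _; rewrite -big_split; apply: eq_bigr => j _.
  rewrite -big_split; apply: eq_bigr => k _; rewrite -big_split; apply: eq_bigr => l _ /=.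
  exact: mulrDl.
have SN g : S (fun i j k l => - g i j k l) = - S g.
  rewrite /S -sumrN; apply: eq_bigr => i _; rewrite -sumrN; apply: eq_bigr => j _.
  rewrite -sumrN; apply: eq_bigr => k _; rewrite -sumrN; apply: eq_bigr => l _ /=.
  exact: mulNr.
have D (a : 'I_4) (F : 'I_4 -> R) : \sum_i (i == a)%:R * F i = F a.
  rewrite (bigD1 a) //= eqxx mul1r big1 ?addr0 // => i ia.
  by rewrite (negbTE ia) mul0r.
have Sd (a b c d : 'I_4) :
    S (fun i j k l => f i j k l 0%N a * f i j k l 1%N b * f i j k l 2%N c * f i j k l 3%N d) =
    h a b c d.
  rewrite /S /f /= -[RHS](D a (fun i => h i b c d)); apply: eq_bigr => i _.
  rewrite -(D b (fun j => h i j c d)) mulr_sumr; apply: eq_bigr => j _.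
  rewrite -(D c (fun k => h i j k d)) !mulr_sumr; apply: eq_bigr => k _.
  rewrite -(D d (fun l => h i j k l)) !mulr_sumr; apply: eq_bigr => l _.
  by rewrite !mulrA !val_eqE.
transitivity (S (fun i j k l => det4 (f i j k l))).
  by do 4 (apply: eq_bigr => ? _); rewrite epsE.
rewrite /det4.
do 23 rewrite ?SN SD.
rewrite !SN.
by rewrite -!Sd.
Qed.

Lemma eps_mx P (a b c d : 'I_4) :
  \sum_i \sum_j \sum_k \sum_l eps i j k l * (P a i * P b j * P c k * P d l) =
  \det P * eps a b c d.
Proof.
rewrite eps_sum.
pose f (r s : nat) : R := P (nth a [:: a; b; c; d] r) (inord s).
have : \det (\matrix_(r < 4, s < 4) f r s) = \det P * eps a b c d.
  rewrite [RHS]mulrC /eps -det_mulmx; congr (\det _).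
  apply/matrixP => r s; rewrite !mxE (bigD1 (tnth [tuple a; b; c; d] r)) //= big1.
    by rewrite mxE eqxx mul1r addr0 /f inord_val (tnth_nth a).
  by move=> i ia; rewrite mxE eq_sym (negbTE ia) mul0r.
rewrite det4E => <-; rewrite /det4 /f /=.
have -> : inord 0 = o0 :> 'I_4 by apply: val_inj; rewrite /= inordK.
have -> : inord 1 = o1 :> 'I_4 by apply: val_inj; rewrite /= inordK.
have -> : inord 2 = o2 :> 'I_4 by apply: val_inj; rewrite /= inordK.
have -> : inord 3 = o3 :> 'I_4 by apply: val_inj; rewrite /= inordK.
by [].
Qed.

Definition star0 A : 'M[R]_4 :=
  \matrix_(k, l) (2^-1 * \sum_i \sum_j eps i j k l * A i j).

Definition ip0 A B : R := 4^-1 * \sum_i \sum_j A i j * B i j.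

Lemma congr_entry A P (i j : 'I_4) :
  (P *m A *m P^T) i j = \sum_a \sum_b A a b * (P i a * P j b).
Proof.
rewrite mxE; under eq_bigr do rewrite !mxE mulr_suml.
rewrite exchange_big; apply: eq_bigr => a _; apply: eq_bigr => b _.
by rewrite mulrAC mulrC mulrA mulrC.
Qed.

Lemma wedge22_congr Q A B : wedge22 (Q *m A *m Q^T) (Q *m B *m Q^T) = \det Q * wedge22 A B.
Proof.
rewrite /wedge22 mulrCA; congr (_ * _).
pose T := ('I_4 * 'I_4 * ('I_4 * 'I_4))%type.
pose e (x : T) : R := eps x.1.1 x.1.2 x.2.1 x.2.2.
have sumT (h : 'I_4 -> 'I_4 -> 'I_4 -> 'I_4 -> R) :
    \sum_i \sum_j \sum_k \sum_l h i j k l = \sum_(x : T) h x.1.1 x.1.2 x.2.1 x.2.2.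
  rewrite -(pair_bigA _ (fun x y => h x.1 x.2 y.1 y.2)) /=.
  rewrite -(pair_bigA _ (fun x y => \sum_(z : 'I_4 * 'I_4) h x y z.1 z.2)) /=.
  by do 2 (apply: eq_bigr => ? _); rewrite -(pair_bigA _ (fun x y => h _ _ x y)).
rewrite !(sumT (fun i j k l => eps i j k l * _ i j * _ k l)) mulr_sumr.
pose q (x y : T) : R := Q x.1.1 y.1.1 * Q x.1.2 y.1.2 * Q x.2.1 y.2.1 * Q x.2.2 y.2.2.
pose v (y : T) : R := A y.1.1 y.1.2 * B y.2.1 y.2.2.
transitivity (\sum_(x : T) \sum_(y : T) v y * (e x * q x y)).
  apply: eq_bigr => x _; rewrite -mulrA !congr_entry.
  rewrite (pair_bigA _ (fun a b => A a b * _)) (pair_bigA _ (fun a b => B a b * _)) /=.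
  rewrite big_distrlr /= pair_bigA /= mulr_sumr; apply: eq_bigr => y _.
  rewrite /v /e /q; ring.
rewrite exchange_big; apply: eq_bigr => y _ /=.
rewrite -mulr_sumr mulrC -mulrA mulrCA.
have -> : \sum_(x : T) e x * q x y = \det Q * e y.
  rewrite -(det_tr Q) -eps_mx sumT; apply: eq_bigr => x _.
  by rewrite /q !mxE.
rewrite /v /e; ring.
Qed.

End Standard.

Section Frame.
Context {R : realType}.
Implicit Types (A B P Q F g I : 'M[R]_4).

Lemma wedge22E A B : wedge22 A B = 4^-1 * (
  A o0 o1 * B o2 o3 - A o0 o1 * B o3 o2 - A o0 o2 * B o1 o3 + A o0 o2 * B o3 o1 + A o0 o3 * B o1 o2 - A o0 o3 * B o2 o1
  - A o1 o0 * B o2 o3 + A o1 o0 * B o3 o2 + A o1 o2 * B o0 o3 - A o1 o2 * B o3 o0 - A o1 o3 * B o0 o2 + A o1 o3 * B o2 o0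
  + A o2 o0 * B o1 o3 - A o2 o0 * B o3 o1 - A o2 o1 * B o0 o3 + A o2 o1 * B o3 o0 + A o2 o3 * B o0 o1 - A o2 o3 * B o1 o0
  - A o3 o0 * B o1 o2 + A o3 o0 * B o2 o1 + A o3 o1 * B o0 o2 - A o3 o1 * B o2 o0 - A o3 o2 * B o0 o1 + A o3 o2 * B o1 o0).
Proof.
rewrite -(eps_sum (fun i j k l => A i j * B k l)) /wedge22; congr (_ * _).
by do 4 (apply: eq_bigr => ? _); rewrite mulrA.
Qed.

Lemma star0E A k l : star0 A k l = 2^-1 * \sum_i \sum_j \sum_a \sum_b eps i j a b * ((a == k)%:R * (b == l)%:R * A i j).
Proof.
rewrite mxE; congr (_ * _); apply: eq_bigr => i _; apply: eq_bigr => j _.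
rewrite (bigD1 k) //= [X in _ = _ + X]big1 ?addr0; last first.
  by move=> a ak; rewrite big1 // => b _; rewrite (negbTE ak) ?(mul0r, mulr0).
rewrite (bigD1 l) //= [X in _ = _ + X]big1 ?addr0; last first.
  by move=> b bl; rewrite (negbTE bl) ?(mul0r, mulr0).
by rewrite !eqxx !mul1r.
Qed.

Let swap21 (f : 'I_4 -> 'I_4 -> 'I_4 -> R) :
  \sum_k \sum_l \sum_a f k l a = \sum_a \sum_k \sum_l f k l a.
Proof. by under eq_bigr do rewrite exchange_big; rewrite exchange_big. Qed.

Let swap4 (h : 'I_4 -> 'I_4 -> 'I_4 -> 'I_4 -> 'I_4 -> 'I_4 -> R) :
  \sum_k \sum_l \sum_i \sum_j \sum_a \sum_b h a b i j k l =
  \sum_a \sum_b \sum_i \sum_j \sum_k \sum_l h a b i j k l.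
Proof.
transitivity (\sum_k \sum_l \sum_a \sum_b \sum_i \sum_j h a b i j k l).
  apply: eq_bigr => k _; apply: eq_bigr => l _.
  by rewrite swap21; apply: eq_bigr => a _; rewrite swap21.
rewrite swap21; apply: eq_bigr => a _; rewrite swap21; apply: eq_bigr => b _.
by rewrite swap21; apply: eq_bigr => i _; rewrite swap21.
Qed.

Lemma raise_frame Q A : Q \in unitmx ->
  raise (Q *m Q^T) (Q *m A *m Q^T) = (invmx Q)^T *m A *m invmx Q.
Proof.
move=> uQ; pose F := invmx Q.
have FQ : F *m Q = 1%:M by exact: mulVmx.
have QF : Q *m F = 1%:M by exact: mulmxV.
have FQt : Q^T *m F^T = 1%:M by rewrite -trmx_mul FQ trmx1.
have gi : invmx (Q *m Q^T) = F^T *m F.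
  have ug : Q *m Q^T \in unitmx by rewrite unitmx_mul unitmx_tr uQ.
  apply: (can_inj (mulKmx ug)); rewrite mulmxV // mulmxA -[_ *m F^T]mulmxA FQt.
  by rewrite mulmx1 QF.
rewrite /raise gi trmx_mul trmxK !mulmxA -[F^T *m F *m Q]mulmxA FQ mulmx1.
by rewrite -[F^T *m A *m Q^T *m F^T]mulmxA FQt mulmx1.
Qed.

Lemma hodge_frame Q A : Q \in unitmx ->
  hodge (Q *m Q^T) (Q *m J0 *m Q^T) (Q *m A *m Q^T) = Q *m star0 A *m Q^T.
Proof.
move=> uQ; pose F := invmx Q.
have FQ : F *m Q = 1%:M by exact: mulVmx.
have QF : Q *m F = 1%:M by exact: mulmxV.
have QFt : F^T *m Q^T = 1%:M by rewrite -trmx_mul QF trmx1.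
have rE := raise_frame A uQ.
rewrite -/F in rE.
have s1 : Num.sg (wedge22 (Q *m J0 *m Q^T) (Q *m J0 *m Q^T)) * Num.sqrt (\det (Q *m Q^T)) = \det Q.
  rewrite wedge22_congr det_mulmx det_tr -expr2 sqrtr_sqr.
  have -> : wedge22 (J0 : 'M[R]_4) J0 = 2 by rewrite wedge22E !mxE /=; lra.
  by rewrite sgrM (gtr0_sg (ltr0Sn R 1)) mulr1 mulr_sg_norm.
have -> : hodge (Q *m Q^T) (Q *m J0 *m Q^T) (Q *m A *m Q^T) =
    Q *m (F *m hodge (Q *m Q^T) (Q *m J0 *m Q^T) (Q *m A *m Q^T) *m F^T) *m Q^T.
  by rewrite !mulmxA QF mul1mx -!mulmxA QFt mulmx1.
congr (_ *m _ *m _); apply/matrixP => c d.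
rewrite congr_entry mxE.
pose h a b i j k l := A a b * (eps i j k l * (F a i * F b j * F c k * F d l)).
transitivity (2^-1 * \det Q * \sum_k \sum_l \sum_i \sum_j \sum_a \sum_b h a b i j k l).
  rewrite mulr_sumr; apply: eq_bigr => k _; rewrite mulr_sumr; apply: eq_bigr => l _.
  rewrite mxE rE -[2^-1 * _ * _]mulrA s1 -[LHS]mulrA; congr (_ * _).
  rewrite mulr_suml; apply: eq_bigr => i _; rewrite mulr_suml; apply: eq_bigr => j _.
  have -> : (F^T *m A *m F) i j = (F^T *m A *m F^T^T) i j by rewrite trmxK.
  rewrite congr_entry mulr_sumr mulr_suml; apply: eq_bigr => a _.
  rewrite mulr_sumr mulr_suml; apply: eq_bigr => b _; rewrite /h !mxE; ring.
rewrite -mulrA; congr (_ * _).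
have dF : \det Q * \det F = 1 by rewrite -det_mulmx QF det1.
transitivity (\det Q * \sum_a \sum_b A a b * (\det F * eps a b c d)).
  rewrite swap4; congr (_ * _); apply: eq_bigr => a _; apply: eq_bigr => b _.
  rewrite -eps_mx /h mulr_sumr; apply: eq_bigr => i _; rewrite mulr_sumr; apply: eq_bigr => j _.
  by rewrite mulr_sumr; apply: eq_bigr => k _; rewrite mulr_sumr.
rewrite mulr_sumr; apply: eq_bigr => a _; rewrite mulr_sumr; apply: eq_bigr => b _.
move: (\det F) (\det Q) (eps a b c d) dF => u v w vu.
transitivity (v * u * (w * A a b)); first by ring.
by rewrite vu mul1r.
Qed.

End Frame.

Notation q0 := (@Ordinal 5 0 isT).
Notation q1 := (@Ordinal 5 1 isT).
Notation q2 := (@Ordinal 5 2 isT).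
Notation q3 := (@Ordinal 5 3 isT).
Notation q4 := (@Ordinal 5 4 isT).

Lemma I5P (P : 'I_5 -> Prop) : P q0 -> P q1 -> P q2 -> P q3 -> P q4 -> forall i, P i.
Proof.
move=> P0 P1 P2 P3 P4 [[|[|[|[|[|//]]]]] Hi].
- by rewrite (_ : Ordinal Hi = q0) //; exact: val_inj.
- by rewrite (_ : Ordinal Hi = q1) //; exact: val_inj.
- by rewrite (_ : Ordinal Hi = q2) //; exact: val_inj.
- by rewrite (_ : Ordinal Hi = q3) //; exact: val_inj.
- by rewrite (_ : Ordinal Hi = q4) //; exact: val_inj.
Qed.

Section FrameForms.
Context {R : realType}.
Implicit Types (A B P Q F g I : 'M[R]_4).

Lemma sum5 (V : nmodType) (f : 'I_5 -> V) : \sum_i f i = f q0 + f q1 + f q2 + f q3 + f q4.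
Proof.
rewrite !big_ord_recl big_ord0 addr0 !addrA.
by congr (f _ + f _ + f _ + f _ + f _); exact: val_inj.
Qed.

Definition skew_mx A : Prop := A^T = - A.

Lemma skewE A i j : skew_mx A -> A j i = - A i j.
Proof. by move=> /matrixP /(_ i j); rewrite !mxE. Qed.

Lemma skew0 A i : skew_mx A -> A i i = 0.
Proof. by move=> sA; have := skewE i i sA; lra. Qed.

Lemma skew4E A : skew_mx A ->
  A = skew4 (A o0 o1) (A o0 o2) (A o0 o3) (A o1 o2) (A o1 o3) (A o2 o3).
Proof.
move=> sA; apply: mx4P; do 2 apply: I4P; rewrite mxE /= ?(skew0 _ sA) //; exact: skewE.
Qed.

Lemma star0_skew4 (a b c d e f : R) : star0 (skew4 a b c d e f) = skew4 f (- e) d c (- b) a.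
Proof.
apply: mx4P; do 2 apply: I4P; rewrite star0E eps_sum -!val_eqE /= !mxE /=; lra.
Qed.

Lemma ip0E A B : ip0 A B = 4^-1 * (
  A o0 o0 * B o0 o0 + A o0 o1 * B o0 o1 + A o0 o2 * B o0 o2 + A o0 o3 * B o0 o3 +
  A o1 o0 * B o1 o0 + A o1 o1 * B o1 o1 + A o1 o2 * B o1 o2 + A o1 o3 * B o1 o3 +
  A o2 o0 * B o2 o0 + A o2 o1 * B o2 o1 + A o2 o2 * B o2 o2 + A o2 o3 * B o2 o3 +
  A o3 o0 * B o3 o0 + A o3 o1 * B o3 o1 + A o3 o2 * B o3 o2 + A o3 o3 * B o3 o3).
Proof. by rewrite /ip0 !sum4 !addrA. Qed.

Lemma skew4_skew (a b c d e f : R) : skew_mx (skew4 a b c d e f).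
Proof. by apply: mx4P; do 2 apply: I4P; rewrite !mxE /= ?oppr0 ?opprK. Qed.

Lemma J0_skew : skew_mx (J0 : 'M[R]_4).
Proof. exact: skew4_skew. Qed.

Lemma E5_skew m : skew_mx (E5 m : 'M[R]_4).
Proof. exact: skew4_skew. Qed.

Lemma skew4D (a b c d e f a' b' c' d' e' f' : R) :
  skew4 a b c d e f + skew4 a' b' c' d' e' f' =
  skew4 (a + a') (b + b') (c + c') (d + d') (e + e') (f + f').
Proof. by apply: mx4P; do 2 apply: I4P; rewrite !mxE /= ?addr0 ?opprD. Qed.

Lemma skew4Z (k a b c d e f : R) :
  k *: skew4 a b c d e f = skew4 (k * a) (k * b) (k * c) (k * d) (k * e) (k * f).
Proof. by apply: mx4P; do 2 apply: I4P; rewrite !mxE /= ?mulr0 ?mulrN. Qed.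

Lemma skew4N (a b c d e f : R) :
  - skew4 a b c d e f = skew4 (- a) (- b) (- c) (- d) (- e) (- f).
Proof. by apply: mx4P; do 2 apply: I4P; rewrite !mxE /= ?oppr0 ?opprK. Qed.

Lemma skew4_inj (a b c d e f a' b' c' d' e' f' : R) :
  skew4 a b c d e f = skew4 a' b' c' d' e' f' ->
  [/\ a = a', b = b' & c = c'] /\ [/\ d = d', e = e' & f = f'].
Proof.
move=> H; have Z i j := congr1 (fun M : 'M[R]_4 => M i j) H.
move: (Z o0 o1) (Z o0 o2) (Z o0 o3) (Z o1 o2) (Z o1 o3) (Z o2 o3).
by rewrite !mxE.
Qed.

Lemma ip0_skew4 (a b c d e f a' b' c' d' e' f' : R) :
  ip0 (skew4 a b c d e f) (skew4 a' b' c' d' e' f') =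
  (a * a' + b * b' + c * c' + d * d' + e * e' + f * f') / 2.
Proof. by rewrite ip0E !mxE /=; field. Qed.

Lemma wedge22_skew4 (a b c d e f a' b' c' d' e' f' : R) :
  wedge22 (skew4 a b c d e f) (skew4 a' b' c' d' e' f') =
  a * f' - b * e' + c * d' + d * c' - e * b' + f * a'.
Proof. by rewrite wedge22E !mxE /=; field. Qed.

Lemma skew4_J0 (a b c d e f : R) :
  J0 *m skew4 a b c d e f *m J0^T = skew4 a e (- d) (- c) b f.
Proof. by apply: mx4P; do 2 apply: I4P; rewrite !(mxE, sum4) /=; ring. Qed.

Lemma skew4_sq (a b c d e f : R) : skew4 a b c d e f *m skew4 f (- e) d c (- b) a =
  (- (a * f - b * e + c * d))%:M.
Proof.
by apply: mx4P; do 2 apply: I4P; rewrite !(mxE, sum4) -!val_eqE /=; ring.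
Qed.

Lemma E5_unit m : (E5 m : 'M[R]_4) \in unitmx.
Proof.
rewrite /E5; move: (skew4_sq (val m == 0%N)%:R ((val m == 1%N)%:R + (val m == 3%N)%:R)
   ((val m == 2%N)%:R + (val m == 4%N)%:R) ((val m == 4%N)%:R - (val m == 2%N)%:R)
   ((val m == 1%N)%:R - (val m == 3%N)%:R) (- (val m == 0%N)%:R)).
set c := (X in _ = X%:M); set A := skew4 _ _ _ _ _ _; set B := skew4 _ _ _ _ _ _ => H.
have c2 : c * c = 1 by rewrite /c; move: m {A B c H}; apply: I5P => /=; ring.
have E : A *m (c *: B) = 1%:M by rewrite -scalemxAr H scale_scalar_mx c2.
by have [] := mulmx1_unit E.
Qed.

Lemma ip0_E5 i j : ip0 (E5 i) (E5 j) = (i == j)%:R :> R.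
Proof. by rewrite ip0_skew4; move: i j; do 2 apply: I5P; rewrite -val_eqE /=; field. Qed.

Lemma wedge22_E5 i j : wedge22 (E5 i) (E5 j) = (-1) ^+ (i < 3)%N * (i == j)%:R * 2 :> R.
Proof. by rewrite wedge22_skew4; move: i j; do 2 apply: I5P; rewrite -val_eqE /=; ring. Qed.

Lemma E5_J0 m : J0 *m E5 m *m J0^T = (-1) ^+ (3 <= m)%N *: E5 m :> 'M[R]_4.
Proof.
rewrite skew4_J0 skew4Z.
by congr skew4; move: m; apply: I5P => /=; ring.
Qed.

Lemma star0_E5 m : star0 (E5 m) = (-1) ^+ (m < 3)%N *: E5 m :> 'M[R]_4.
Proof.
rewrite star0_skew4 skew4Z.
by congr skew4; move: m; apply: I5P => /=; ring.
Qed.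

Definition coord5 A : 'rV[R]_5 := \row_m ip0 (E5 m) A.

Lemma coord5_skew4 (a b c d e f : R) : coord5 (skew4 a b c d e f) =
  \row_m nth 0 [:: (a - f) / 2; (b + e) / 2; (c - d) / 2; (b - e) / 2; (c + d) / 2] m.
Proof.
by apply/rowP; apply: I5P; rewrite !mxE ip0_skew4 /=; field.
Qed.

Lemma E5_comb (t : 'I_5 -> R) : \sum_i t i *: E5 i =
  skew4 (t q0) (t q1 + t q3) (t q2 + t q4) (t q4 - t q2) (t q1 - t q3) (- t q0).
Proof.
rewrite sum5 /E5 /= !skew4Z !skew4D; congr skew4; ring.
Qed.

Lemma skew_expand A : skew_mx A -> ip0 J0 A = 0 -> A = \sum_m coord5 A 0 m *: E5 m.
Proof.
move=> sA; rewrite (skew4E sA).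
move: (A o0 o1) (A o0 o2) (A o0 o3) (A o1 o2) (A o1 o3) (A o2 o3) => a b c d e f.
rewrite ip0_skew4 => H.
have -> : f = - a by lra.
rewrite E5_comb coord5_skew4 !mxE /=.
by congr skew4; field.
Qed.

Lemma asd_coord A : skew_mx A -> star0 A = - A ->
  ip0 J0 A = 0 /\ forall m : 'I_5, (3 <= m)%N -> coord5 A 0 m = 0.
Proof.
move=> sA; rewrite (skew4E sA).
rewrite star0_skew4 skew4N coord5_skew4 ip0_skew4 => /skew4_inj[[h1 h2 h3] [h4 h5 h6]]; split.
  lra.
by apply: I5P => //= _; rewrite mxE /=; lra.
Qed.

Lemma antiinv_coord A : skew_mx A -> J0 *m A *m J0^T = - A ->
  ip0 J0 A = 0 /\ forall m : 'I_5, (m < 3)%N -> coord5 A 0 m = 0.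
Proof.
move=> sA; rewrite (skew4E sA).
rewrite skew4_J0 skew4N coord5_skew4 ip0_skew4 => /skew4_inj[[h1 h2 h3] [h4 h5 h6]]; split.
  lra.
by apply: I5P => //= _; rewrite mxE /=; lra.
Qed.

Lemma inv_coord A : skew_mx A -> J0 *m A *m J0^T = A ->
  forall m : 'I_5, (3 <= m)%N -> coord5 A 0 m = 0.
Proof.
move=> sA; rewrite (skew4E sA).
rewrite skew4_J0 coord5_skew4 => /skew4_inj[[h1 h2 h3] [h4 h5 h6]].
by apply: I5P => //= _; rewrite mxE /=; lra.
Qed.

Lemma commutant_zero A : skew_mx A -> (forall m, A *m E5 m = E5 m *m A) ->
  A *m J0 = J0 *m A -> A = 0.
Proof.
move=> sA; rewrite (skew4E sA).
move: (A o0 o1) (A o0 o2) (A o0 o3) (A o1 o2) (A o1 o3) (A o2 o3) => a b c d e f H HJ.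
have Z i j := congr1 (fun M : 'M[R]_4 => M i j) HJ.
have Z0 i j := congr1 (fun M : 'M[R]_4 => M i j) (H q0).
have Z1 i j := congr1 (fun M : 'M[R]_4 => M i j) (H q1).
have Z3 i j := congr1 (fun M : 'M[R]_4 => M i j) (H q3).
move: (Z o0 o2) (Z o0 o3) (Z0 o0 o2) (Z0 o0 o3) (Z1 o0 o1) (Z1 o0 o3) (Z3 o0 o1) (Z3 o0 o3).
rewrite !mxE !sum4 !mxE /= => h1 h2 h3 h4 h5 h6 h7 h8.
have -> : a = 0 by lra. have -> : b = 0 by lra. have -> : c = 0 by lra.
have -> : d = 0 by lra. have -> : e = 0 by lra. have -> : f = 0 by lra.
by apply: mx4P; do 2 apply: I4P; rewrite !mxE /= ?oppr0.
Qed.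

End FrameForms.

Section Pointwise.
Context {R : realType}.
Implicit Types (A B P Q F g I w : 'M[R]_4).

Lemma sum_mul_trace A B : \sum_i \sum_j A i j * B i j = \tr (A *m B^T).
Proof.
rewrite /mxtrace; apply: eq_bigr => i _; rewrite mxE.
by apply: eq_bigr => j _; rewrite mxE.
Qed.

Lemma form_inner_frame Q A B : Q \in unitmx ->
  form_inner (Q *m Q^T) (Q *m A *m Q^T) (Q *m B *m Q^T) = ip0 A B.
Proof.
move=> uQ; rewrite /form_inner /ip0 raise_frame // !sum_mul_trace; congr (_ * _).
rewrite !trmx_mul trmxK mxtrace_mulC !mulmxA.
rewrite -[_ *m invmx Q *m Q]mulmxA mulVmx // mulmx1.
rewrite mxtrace_mulC !mulmxA -trmx_mul mulVmx // trmx1 mul1mx.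
by rewrite mxtrace_mulC.
Qed.

Record unitary_frame g I Q : Prop := UnitaryFrame {
  uf_unit : Q \in unitmx;
  uf_metric : g = Q *m Q^T;
  uf_complex : I *m Q = Q *m J0 }.

Section InFrame.
Variables (g I Q : 'M[R]_4).
Hypothesis uf : unitary_frame g I Q.
Let F := invmx Q.
Let uQ : Q \in unitmx := uf_unit uf.
Let FQ : F *m Q = 1%:M. Proof. exact: mulVmx. Qed.
Let QF : Q *m F = 1%:M. Proof. exact: mulmxV. Qed.
Let gE : g = Q *m Q^T := uf_metric uf.

Lemma uf_kahler : I *m g = Q *m J0 *m Q^T.
Proof. by rewrite gE mulmxA (uf_complex uf). Qed.

Lemma uf_endo : I = Q *m J0 *m F.
Proof. by rewrite -(uf_complex uf) -mulmxA QF mulmx1. Qed.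

Lemma uf_complex_l : F *m I = J0 *m F.
Proof. by rewrite uf_endo !mulmxA FQ mul1mx. Qed.

Lemma uf_gF : g *m F^T = Q.
Proof. by rewrite gE -mulmxA -trmx_mul FQ trmx1 mulmx1. Qed.

Lemma uf_congrK A : F *m (Q *m A *m Q^T) *m F^T = A.
Proof. by rewrite !mulmxA FQ mul1mx -mulmxA -trmx_mul FQ trmx1 mulmx1. Qed.

Lemma uf_congrVK A : Q *m (F *m A *m F^T) *m Q^T = A.
Proof. by rewrite !mulmxA QF mul1mx -mulmxA -trmx_mul QF trmx1 mulmx1. Qed.

Lemma uf_act A : I *m (Q *m A *m Q^T) *m I^T = Q *m (J0 *m A *m J0^T) *m Q^T.
Proof.
rewrite !mulmxA (uf_complex uf) -[_ *m Q^T *m I^T]mulmxA -trmx_mul (uf_complex uf).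
by rewrite trmx_mul !mulmxA.
Qed.

Lemma uf_hodge A : hodge g (I *m g) (Q *m A *m Q^T) = Q *m star0 A *m Q^T.
Proof. by rewrite uf_kahler gE hodge_frame. Qed.

Lemma uf_form_inner A B : form_inner g (Q *m A *m Q^T) (Q *m B *m Q^T) = ip0 A B.
Proof. by rewrite gE form_inner_frame. Qed.

Lemma skew_congr A P : skew_mx A -> skew_mx (P *m A *m P^T).
Proof. by rewrite /skew_mx => sA; rewrite !trmx_mul trmxK sA mulNmx mulmxN mulmxA. Qed.

Lemma bil_act w (s : R) : I *m w *m I^T = s *: w ->
  forall u v : 'rV[R]_4, bil w (u *m I) (v *m I) = s * bil w u v.
Proof.
move=> E u v; rewrite /bil trmx_mul !mulmxA.
have -> : u *m I *m w *m I^T = s *: (u *m w) by rewrite scalemxAr -E !mulmxA.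
by rewrite -scalemxAl mxE.
Qed.

Lemma compatible_at :
  let w m := Q *m E5 m *m Q^T in
  [/\ forall i j, form_inner g (w i) (w j) = (i == j)%:R,
      forall eta : 'M[R]_4,
        (eta^T = - eta /\ hodge g (I *m g) eta = - eta) <->
        (exists t : 'I_5 -> R, eta = \sum_(i < 5 | (i < 3)%N) t i *: w i),
      forall i : 'I_5, (3 <= i)%N -> hodge g (I *m g) (w i) = w i &
      forall i : 'I_5, (3 <= i)%N -> forall u v : 'rV[R]_4,
        bil (w i) (u *m I) (v *m I) = - bil (w i) u v].
Proof.
move=> w; split.
- by move=> i j; rewrite uf_form_inner ip0_E5.
- move=> eta; split.
    move=> [se he].
    pose A := F *m eta *m F^T.
    have etaE : eta = Q *m A *m Q^T by rewrite uf_congrVK.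
    have sA : skew_mx A by exact: skew_congr.
    have hA : star0 A = - A.
      rewrite -[LHS]uf_congrK -uf_hodge -etaE he mulmxN mulNmx.
      by rewrite etaE uf_congrK.
    have [A0 Ac] := asd_coord sA hA.
    exists (fun m => coord5 A 0 m).
    rewrite {1}etaE {1}(skew_expand sA A0) mulmx_sumr mulmx_suml [RHS]big_mkcond /=.
    apply: eq_bigr => m _; rewrite -scalemxAr -scalemxAl.
    by case: ifP => // /negbT; rewrite -leqNgt => /Ac ->; rewrite scale0r.
  move=> [t ->].
  have -> : \sum_(i < 5 | (i < 3)%N) t i *: w i =
      Q *m (\sum_(i < 5 | (i < 3)%N) t i *: E5 i) *m Q^T.
    rewrite mulmx_sumr mulmx_suml; apply: eq_bigr => m _.
    by rewrite -scalemxAr -scalemxAl.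
  set A := \sum_(i < 5 | _) _.
  have AE : A = skew4 (t q0) (t q1) (t q2) (- t q2) (t q1) (- t q0).
    rewrite /A big_mkcond sum5 /= !addr0 /E5 /= !skew4Z !skew4D; congr skew4; ring.
  have sA : skew_mx A by rewrite AE; exact: skew4_skew.
  split; first exact: skew_congr.
  rewrite uf_hodge AE star0_skew4 -mulNmx -mulmxN skew4N !opprK.
  by congr (_ *m _ *m _); congr skew4; ring.
- by move=> i i3; rewrite uf_hodge star0_E5 ltnNge i3 expr0 scale1r.
- move=> i i3 u v; rewrite (@bil_act _ (-1)) ?mulN1r //.
  by rewrite uf_act E5_J0 i3 expr1 -scalemxAr -scalemxAl.
Qed.

End InFrame.

Lemma bilZ g (a b : R) (u v : 'rV[R]_4) : bil g (a *: u) (b *: v) = a * b * bil g u v.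
Proof. by rewrite /bil linearZ /= -!scalemxAl -scalemxAr !mxE mulrA. Qed.

Lemma exists_unitary_frame g I : g^T = g -> (forall u : 'rV[R]_4, u != 0 -> 0 < bil g u u) ->
  I *m I = - 1%:M -> (forall u v, bil g (u *m I) (v *m I) = bil g u v) ->
  exists Q, unitary_frame g I Q.
Proof.
move=> gT gpos I2 gI.
have bC u v : bil g u v = bil g v u.
  by rewrite /bil -[in LHS](trmxK (u *m g *m v^T)) mxE !trmx_mul trmxK gT mulmxA.
have II (u : 'rV[R]_4) : u *m I *m I = - u by rewrite -mulmxA I2 mulmxN mulmx1.
have bN u v : bil g u (- v) = - bil g u v.
  by rewrite -[u in LHS]scale1r -scaleN1r bilZ mul1r mulN1r.
have bI u v : bil g (u *m I) v = - bil g u (v *m I).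
  by rewrite -[RHS]bN -[in RHS]gI mulNmx II opprK.
have uI u : bil g u (u *m I) = 0.
  by have := bI u u; rewrite bC; lra.
have normalize (u : 'rV[R]_4) : u != 0 -> exists2 k : R, k != 0 & bil g (k *: u) (k *: u) = 1.
  move=> /gpos b0; have s0 : Num.sqrt (bil g u u) != 0 by rewrite gt_eqF // sqrtr_gt0.
  exists (Num.sqrt (bil g u u))^-1; first by rewrite invr_eq0.
  by rewrite bilZ -[X in _ * X]sqr_sqrtr ?ltW // expr2; field.
have d0 : (delta_mx 0 o0 : 'rV[R]_4) != 0.
  by apply/eqP => /matrixP /(_ 0 o0); rewrite !mxE !eqxx => /eqP; rewrite oner_eq0.
have [k _ e0n] := normalize _ d0.
set e0 := k *: _ in e0n.
pose e1 := e0 *m I.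
pose C : 'M[R]_(4, 1 + 1) := g *m (col_mx e0 e1)^T.
have : kermx C != 0.
  rewrite kermx_eq0 /row_free neq_ltn.
  by rewrite (leq_ltn_trans (rank_leq_col C)).
move=> /rowV0Pn[v /sub_kermxP vC v0].
have [v_e0 v_e1] : bil g v e0 = 0 /\ bil g v e1 = 0.
  move: vC; rewrite /C mulmxA tr_col_mx mul_mx_row => vC; split.
    have := congr1 (fun M : 'M[R]_(1, 1 + 1) => lsubmx M 0 0) vC.
    by rewrite row_mxKl /bil => ->; rewrite !mxE.
  have := congr1 (fun M : 'M[R]_(1, 1 + 1) => rsubmx M 0 0) vC.
  by rewrite row_mxKr /bil => ->; rewrite !mxE.
have [l _ e2n] := normalize _ v0.
set e2 := l *: v in e2n.
have e20 : bil g e2 e0 = 0 by rewrite /e2 -[e0]scale1r bilZ v_e0 mulr0.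
have e21 : bil g e2 e1 = 0 by rewrite /e2 -[e1]scale1r bilZ v_e1 mulr0.
pose e3 := e2 *m I.
pose F : 'M[R]_4 := \matrix_(i, j) (nth e0 [:: e0; e1; e2; e3] i) 0 j.
have rowF i : row i F = nth e0 [:: e0; e1; e2; e3] i.
  by apply/rowP => j; rewrite !mxE.
have e11 : bil g e1 e1 = 1 by rewrite /e1 gI.
have e33 : bil g e3 e3 = 1 by rewrite /e3 gI.
have e01 : bil g e0 e1 = 0 by exact: uI.
have e23 : bil g e2 e3 = 0 by exact: uI.
have e03 : bil g e3 e0 = 0 by rewrite /e3 bI -/e1 e21 oppr0.
have e13 : bil g e3 e1 = 0 by rewrite /e3 /e1 gI.
have FgF : F *m g *m F^T = 1%:M.
  have E i j : (F *m g *m F^T) i j = bil g (row i F) (row j F).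
    rewrite /bil -row_mul [LHS]mxE [RHS]mxE; apply: eq_bigr => k' _.
    have -> : row i (F *m g) 0 k' = (F *m g) i k' by rewrite [LHS]mxE.
    have -> : (row j F)^T k' 0 = F j k' by rewrite !mxE.
    by rewrite [F^T _ _]mxE.
  apply: mx4P => i j; rewrite E !rowF mxE; move: i j; do 2 apply: I4P;
    rewrite -val_eqE /=; by [|rewrite bC].
have FI : F *m I = J0 *m F.
  apply/row_matrixP => i; rewrite !row_mul rowF.
  rewrite [RHS]mulmx_sum_row sum4 !rowF.
  have E m : row i (J0 : 'M[R]_4) 0 m = (J0 : 'M[R]_4) i m by rewrite [LHS]mxE.
  rewrite !E; move: i {E}; apply: I4P; rewrite ![J0 _ _]mxE /=;
    rewrite ?oppr0 ?scale0r ?scale1r ?scaleN1r ?add0r ?addr0 //.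
  - by rewrite /e1 II.
  - by rewrite /e3 II.
pose Q := g *m F^T.
have FQ : F *m Q = 1%:M by rewrite /Q mulmxA.
have [uF uQ] := mulmx1_unit FQ.
have QF : Q *m F = 1%:M by exact: mulmx1C.
exists Q; split => //.
- by rewrite /Q trmx_mul trmxK gT mulmxA -/Q QF mul1mx.
- by rewrite -[LHS]mul1mx -QF -mulmxA [F *m (I *m Q)]mulmxA FI -mulmxA FQ mulmx1.
Qed.

End Pointwise.

Section Torsion.
Context {R : realType}.
Implicit Types (A B P Q F g I w : 'M[R]_4) (T N : 'I_4 -> 'M[R]_4).

Definition cyc T (i j k : 'I_4) : R := T i j k + T j k i + T k i j.

Definition pull F T (a : 'I_4) : 'M[R]_4 := \sum_i F a i *: (F *m T i *m F^T).

Lemma pull_entry F T a b c :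
  pull F T a b c = \sum_i \sum_j \sum_k F a i * F b j * F c k * T i j k.
Proof.
rewrite /pull summxE; apply: eq_bigr => i _; rewrite mxE congr_entry mulr_sumr.
apply: eq_bigr => j _; rewrite mulr_sumr; apply: eq_bigr => k _; ring.
Qed.

Lemma cyc_pull F T : (forall i j k, cyc T i j k = 0) ->
  forall a b c, cyc (pull F T) a b c = 0.
Proof.
move=> H a b c; rewrite /cyc !pull_entry.
have -> : \sum_i \sum_j \sum_k F b i * F c j * F a k * T i j k =
    \sum_i \sum_j \sum_k F a i * F b j * F c k * T j k i.
  under eq_bigr do rewrite exchange_big; rewrite exchange_big.
  apply: eq_bigr => i _; apply: eq_bigr => j _; apply: eq_bigr => k _; ring.
have -> : \sum_i \sum_j \sum_k F c i * F a j * F b k * T i j k =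
    \sum_i \sum_j \sum_k F a i * F b j * F c k * T k i j.
  rewrite exchange_big; under eq_bigr do rewrite exchange_big.
  apply: eq_bigr => i _; apply: eq_bigr => j _; apply: eq_bigr => k _; ring.
rewrite -!big_split big1 //= => i _; rewrite -!big_split big1 //= => j _.
rewrite -!big_split big1 //= => k _; rewrite -!mulrDr.
have := H i j k; rewrite /cyc => ->; exact: mulr0.
Qed.

Lemma pullK F Q T a : Q *m F = 1%:M -> pull Q (pull F T) a = T a.
Proof.
move=> QF; rewrite /pull.
under eq_bigr => i _ do (rewrite mulmx_sumr mulmx_suml scaler_sumr;
  under eq_bigr => j _ do rewrite -scalemxAr -scalemxAl scalerA).
rewrite exchange_big /=.
transitivity (\sum_j ((Q *m F) a j) *: T j).
  apply: eq_bigr => j _; rewrite mxE scaler_suml; apply: eq_bigr => i _.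
  by rewrite !mulmxA QF mul1mx -mulmxA -trmx_mul QF trmx1 mulmx1.
rewrite QF (bigD1 a) //= big1 ?addr0 => [|j ja]; last by rewrite mxE eq_sym (negbTE ja) scale0r.
by rewrite mxE eqxx scale1r.
Qed.

Lemma cyc_pullP F Q T : Q *m F = 1%:M -> (forall a b c, cyc (pull F T) a b c = 0) ->
  forall i j k, cyc T i j k = 0.
Proof.
move=> QF H i j k; have := cyc_pull Q H i j k.
by rewrite /cyc !(pullK _ _ QF).
Qed.

Definition pullv F Q T (a : 'I_4) : 'M[R]_4 := \sum_i F a i *: (F *m T i *m Q).

Lemma mul3_entry A B P i j : (A *m B *m P) i j = \sum_a \sum_b B a b * (A i a * P b j).
Proof.
rewrite mxE; under eq_bigr do rewrite mxE mulr_suml.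
rewrite exchange_big; apply: eq_bigr => a _; apply: eq_bigr => b _; ring.
Qed.

Lemma pullv_sym F Q T : (forall i j k, T i j k = T j i k) ->
  forall a b c, pullv F Q T a b c = pullv F Q T b a c.
Proof.
move=> H a b c.
have E a' b' : pullv F Q T a' b' c = \sum_i \sum_j \sum_k F a' i * F b' j * Q k c * T i j k.
  rewrite /pullv summxE; apply: eq_bigr => i _.
  rewrite mxE mul3_entry mulr_sumr.
  by apply: eq_bigr => j _; rewrite mulr_sumr; apply: eq_bigr => k _; ring.
rewrite !E exchange_big; apply: eq_bigr => i _; apply: eq_bigr => j _.
by apply: eq_bigr => k _; rewrite (H j i k); ring.
Qed.

Lemma pullvB F Q T T' a : pullv F Q (fun i => T i - T' i) a = pullv F Q T a - pullv F Q T' a.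
Proof.
rewrite /pullv -sumrB; apply: eq_bigr => i _.
by rewrite mulmxBr mulmxBl scalerBr.
Qed.

Lemma torsion_core (N : 'I_4 -> 'M[R]_4) (th : 'cV[R]_4) (a b c d e : R) :
  (forall m, skew_mx (N m)) -> (forall m, N m *m J0 = - (J0 *m N m)) ->
  (forall m n k, (\sum_l (J0 : 'M[R]_4) m l *: N l - N m *m J0) n k =
                 (\sum_l (J0 : 'M[R]_4) n l *: N l - N n *m J0) m k) ->
  (forall i j k, cyc (fun m => N m - th m 0 *: J0) i j k = 0) ->
  let Psi m := 2^-1 *: (J0 *m N m) - 4^-1 * (J0 *m th) m 0 *: J0 in
  let w := skew4 a b c d e (- a) in
  forall i j k, cyc (fun m => Psi m *m w - w *m Psi m) i j k = 0.
Proof.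
move=> sN aN nij dom Psi w.
pose s m := N m o0 o2; pose t m := N m o0 o3.
have NE m : N m = skew4 0 (s m) (t m) (t m) (- s m) 0.
  have := aN m; rewrite (skew4E (sN m)) -/(s m) -/(t m).
  move: (s m) (t m) (N m o0 o1) (N m o1 o2) (N m o1 o3) (N m o2 o3) => x y p q r z H.
  have Z i j := congr1 (fun M : 'M[R]_4 => M i j) H.
  move: (Z o0 o0) (Z o2 o2) (Z o0 o2) (Z o0 o3).
  rewrite !mxE !sum4 !mxE /= => h1 h2 h3 h4.
  by congr skew4; lra.
have nij' i j k : (\sum_l (J0 : 'M[R]_4) i l * N l j k) - (N i *m J0) j k =
    (\sum_l (J0 : 'M[R]_4) j l * N l i k) - (N j *m J0) i k.
  have S i' j' : (\sum_l (J0 : 'M[R]_4) i' l *: N l) j' k = \sum_l (J0 : 'M[R]_4) i' l * N l j' k.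
    by rewrite summxE; apply: eq_bigr => l _; rewrite mxE.
  have D (X Y : 'M[R]_4) i' j' : (X - Y) i' j' = X i' j' - Y i' j' by rewrite mxE [X in _ + X]mxE.
  by have := nij i j k; rewrite !D !S.
have vals : [/\ s o0 = - th o3 0 / 2, s o1 = - th o2 0 / 2, s o2 = th o1 0 / 2 & s o3 = th o0 0 / 2] /\
   [/\ t o0 = th o2 0 / 2, t o1 = - th o3 0 / 2, t o2 = - th o0 0 / 2 & t o3 = th o1 0 / 2].
  move: (nij' o0 o2 o0) (nij' o0 o2 o1) (nij' o0 o2 o2) (nij' o0 o2 o3).
  move: (dom o0 o1 o2) (dom o0 o1 o3) (dom o0 o2 o3) (dom o1 o2 o3).
  rewrite /cyc !NE !mxE !sum4 !NE !mxE /= => h1 h2 h3 h4 h5 h6 h7 h8.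
  by split; split; lra.
have PE m : Psi m = skew4 (- (J0 *m th) m 0 / 4) (t m / 2) (- s m / 2) (- s m / 2) (- t m / 2) (- (J0 *m th) m 0 / 4).
  rewrite /Psi NE; move: ((J0 *m th) m 0) (s m) (t m) => x y z.
  by apply: mx4P; do 2 apply: I4P; rewrite !(mxE, sum4) /=; field.
pose x m := (J0 *m th) m 0.
have comm m : Psi m *m w - w *m Psi m =
   skew4 (- s m / 2 * (b - e) - t m / 2 * (c + d)) (- x m / 4 * (c + d)) (x m / 4 * (b - e))
     (x m / 4 * (b - e)) (x m / 4 * (c + d)) (- s m / 2 * (b - e) - t m / 2 * (c + d)).
  rewrite PE /w -/(x m); move: (x m) (s m) (t m) => x' y z.
  by apply: mx4P; do 2 apply: I4P; rewrite !(mxE, sum4) /=; field.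
have xs : [/\ x o0 = th o1 0, x o1 = - th o0 0, x o2 = th o3 0 & x o3 = - th o2 0].
  by rewrite /x !(mxE, sum4) /=; split; ring.
case: xs => x0 x1 x2 x3; case: vals => [[s0 s1 s2 s3] [t0 t1 t2 t3]].
move=> i j k; rewrite /cyc !comm; move: i j k; do 3 apply: I4P;
  rewrite !mxE /= ?(x0, x1, x2, x3, s0, s1, s2, s3, t0, t1, t2, t3); by field.
Qed.

Lemma torsion_identity g I Q (N : 'I_4 -> 'M[R]_4) (th : 'cV[R]_4) w :
  unitary_frame g I Q ->
  (forall m, skew_mx (N m *m g)) -> (forall m, N m *m I = - (I *m N m)) ->
  (forall i j k, (\sum_l I i l *: N l - N i *m I) j k = (\sum_l I j l *: N l - N j *m I) i k) ->
  (forall i j k, cyc (fun m => N m *m g - th m 0 *: (I *m g)) i j k = 0) ->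
  skew_mx w -> form_inner g (I *m g) w = 0 ->
  let Psi m := 2^-1 *: (I *m N m) - 4^-1 * (I *m th) m 0 *: I in
  forall i j k, cyc (fun m => Psi m *m w + w *m (Psi m)^T) i j k = 0.
Proof.
move=> uf sN aN nij dom sw iw Psi.
have uQ := uf_unit uf; pose F := invmx Q.
have FQ : F *m Q = 1%:M by exact: mulVmx.
have QF : Q *m F = 1%:M by exact: mulmxV.
pose N' a := pullv F Q N a.
pose th' := F *m th.
have FI : F *m I = J0 *m F := uf_complex_l uf.
have QI : I *m Q = Q *m J0 := uf_complex uf.
have gF : g *m F^T = Q := uf_gF uf.
have N'E a : N' a = pull F (fun m => N m *m g) a.
  by apply: eq_bigr => i _; rewrite -!mulmxA gF.
pose A := F *m w *m F^T.
have wE : w = Q *m A *m Q^T by rewrite /A !mulmxA QF mul1mx -mulmxA -trmx_mul QF trmx1 mulmx1.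
have sA : skew_mx A by exact: skew_congr.
have iA : ip0 J0 A = 0 by rewrite -(uf_form_inner uf) -wE -(uf_kahler uf).
have AE : A = skew4 (A o0 o1) (A o0 o2) (A o0 o3) (A o1 o2) (A o1 o3) (- A o0 o1).
  rewrite {1}(skew4E sA); congr skew4.
  by move: iA; rewrite {1}(skew4E sA) ip0_skew4 => iA; lra.
have sN' a : skew_mx (N' a).
  rewrite N'E /skew_mx /pull linear_sum /= -sumrN; apply: eq_bigr => i _.
  by rewrite linearZ /= (skew_congr F (sN i)) scalerN.
have aN' a : N' a *m J0 = - (J0 *m N' a).
  rewrite /N' /pullv mulmx_suml mulmx_sumr -sumrN; apply: eq_bigr => i _.
  rewrite -scalemxAl -scalemxAr -scalerN; congr (_ *: _).
  by rewrite -!mulmxA -QI [N i *m _]mulmxA aN !mulmxA -FI mulmxN mulNmx !mulmxA.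
have nij' m n k : (\sum_l (J0 : 'M[R]_4) m l *: N' l - N' m *m J0) n k =
                 (\sum_l (J0 : 'M[R]_4) n l *: N' l - N' n *m J0) m k.
  have E a : \sum_l (J0 : 'M[R]_4) a l *: N' l - N' a *m J0 =
      pullv F Q (fun i => \sum_l I i l *: N l - N i *m I) a.
    rewrite pullvB; congr (_ - _).
      transitivity (\sum_l (J0 *m F) a l *: (F *m N l *m Q)).
        under eq_bigr => l _ do rewrite /N' /pullv scaler_sumr.
        rewrite exchange_big; apply: eq_bigr => l _; rewrite mxE scaler_suml.
        by apply: eq_bigr => i _; rewrite scalerA.
      rewrite -FI /pullv; under [RHS]eq_bigr => i _ do rewrite mulmx_sumr mulmx_suml scaler_sumr.
      rewrite exchange_big; apply: eq_bigr => l _; rewrite mxE scaler_suml.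
      by apply: eq_bigr => i _; rewrite -scalemxAr -scalemxAl scalerA.
    rewrite /N' /pullv mulmx_suml; apply: eq_bigr => i _.
    by rewrite -scalemxAl -!mulmxA QI.
  by rewrite !E; apply: pullv_sym.
have dom' i j k : cyc (fun m => N' m - th' m 0 *: J0) i j k = 0.
  have E m : N' m - th' m 0 *: J0 = pull F (fun m => N m *m g - th m 0 *: (I *m g)) m.
    rewrite N'E /pull /th' mxE scaler_suml -sumrB; apply: eq_bigr => l _.
    rewrite mulmxBr mulmxBl scalerBr; congr (_ - _).
    rewrite -scalemxAr -scalemxAl scalerA; congr (_ *: _).
    by rewrite (uf_kahler uf) (uf_congrK uf).
  by rewrite /cyc !E; exact: cyc_pull.
apply: (cyc_pullP QF) => a b c.
have := torsion_core (A o0 o1) (A o0 o2) (A o0 o3) (A o1 o2) (A o1 o3) sN' aN' nij' dom' a b c.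
rewrite -AE /cyc => H; rewrite -[RHS]H.
have E m : pull F (fun m => Psi m *m w + w *m (Psi m)^T) m =
   (2^-1 *: (J0 *m N' m) - 4^-1 * (J0 *m th') m 0 *: J0) *m A -
   A *m (2^-1 *: (J0 *m N' m) - 4^-1 * (J0 *m th') m 0 *: J0).
  pose P' := 2^-1 *: (J0 *m N' m) - 4^-1 * (J0 *m th') m 0 *: J0.
  have PE : pullv F Q Psi m = P'.
    rewrite /Psi pullvB /P'; congr (_ - _).
      rewrite /N' /pullv mulmx_sumr scaler_sumr; apply: eq_bigr => i _.
      rewrite -!scalemxAr -!scalemxAl scalerA mulrC -scalerA; congr (_ *: (_ *: _)).
      by rewrite !mulmxA FI.
    rewrite /pullv /th' mulmxA -FI -mulmxA mxE mulr_sumr scaler_suml; apply: eq_bigr => i _.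
    rewrite -scalemxAr -scalemxAl scalerA; congr (_ *: _); first by rewrite mulrCA.
    by rewrite FI -mulmxA FQ mulmx1.
  have sP : skew_mx P'.
    rewrite /P' /skew_mx linearB /= !linearZ /= trmx_mul (sN' m) J0_skew mulmxN mulNmx opprK.
    by rewrite aN' !scalerN opprB opprK addrC.
  rewrite -/P' -[in RHS]PE.
  have -> : A *m pullv F Q Psi m = - (A *m (pullv F Q Psi m)^T).
    by rewrite PE sP mulmxN opprK.
  rewrite opprK /pullv /pull mulmx_suml linear_sum /= mulmx_sumr -big_split /=.
  apply: eq_bigr => i _; rewrite linearZ /= -scalemxAl -scalemxAr -scalerDr; congr (_ *: _).
  have QFt : Q^T *m F^T = 1%:M by rewrite -trmx_mul FQ trmx1.
  rewrite mulmxDr mulmxDl wE; congr (_ + _).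
    by rewrite !mulmxA -[_ *m Q^T *m F^T]mulmxA QFt mulmx1.
  by rewrite !trmx_mul !mulmxA FQ mul1mx.
by rewrite !E.
Qed.

End Torsion.

Section Structure.
Context {R : realType}.
Implicit Types (A B P Q F g I : 'M[R]_4).

(* Cartan's lemma for the structure group SO(3) x SO(2): a torsion-free connection form
   L with respect to the coframe of 2-forms E5 vanishes. *)
Lemma structure_core (L : 'I_4 -> 'M[R]_5) :
  (forall e m n, L e m n = - L e n m) ->
  (forall e (m n : 'I_5), (m < 3)%N != (n < 3)%N -> L e m n = 0) ->
  (forall m i j k, cyc (fun e => \sum_n L e m n *: E5 n) i j k = 0) ->
  forall e, L e = 0.
Proof.
move=> aL bL cL.
have L0 e m : L e m m = 0 by have := aL e m m; lra.
pose x e := L e q0 q1; pose y e := L e q0 q2; pose z e := L e q1 q2; pose u e := L e q3 q4.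
have S0 e : \sum_n L e q0 n *: E5 n = skew4 0 (x e) (y e) (- y e) (x e) 0.
  by rewrite E5_comb L0 (bL e q0 q3) // (bL e q0 q4) // /x /y; congr skew4; ring.
have S1 e : \sum_n L e q1 n *: E5 n = skew4 (- x e) 0 (z e) (- z e) 0 (x e).
  by rewrite E5_comb L0 (bL e q1 q3) // (bL e q1 q4) // (aL e q1 q0) /x /z; congr skew4; ring.
have S2 e : \sum_n L e q2 n *: E5 n = skew4 (- y e) (- z e) 0 0 (- z e) (y e).
  rewrite E5_comb L0 (bL e q2 q3) // (bL e q2 q4) // (aL e q2 q0) (aL e q2 q1) /y /z.
  by congr skew4; ring.
have S3 e : \sum_n L e q3 n *: E5 n = skew4 0 0 (u e) (u e) 0 0.
  rewrite E5_comb L0 (bL e q3 q0) // (bL e q3 q1) // (bL e q3 q2) // /u.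
  by congr skew4; ring.
have Z : forall e, [/\ x e = 0, y e = 0, z e = 0 & u e = 0].
  move: (cL q0 o0 o1 o2) (cL q0 o0 o1 o3) (cL q0 o0 o2 o3) (cL q0 o1 o2 o3).
  move: (cL q1 o0 o1 o2) (cL q1 o0 o1 o3) (cL q1 o0 o2 o3) (cL q1 o1 o2 o3).
  move: (cL q2 o0 o1 o2) (cL q2 o0 o1 o3) (cL q2 o0 o2 o3) (cL q2 o1 o2 o3).
  move: (cL q3 o0 o1 o2) (cL q3 o0 o1 o3) (cL q3 o0 o2 o3) (cL q3 o1 o2 o3).
  rewrite /cyc !S0 !S1 !S2 !S3 !mxE /= => h1 h2 h3 h4 h5 h6 h7 h8 h9 h10 h11 h12 h13 h14 h15 h16.
  by apply: I4P; split; lra.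
move=> e; apply/matrixP => m n; rewrite mxE.
have [Zx Zy Zz Zu] := Z e.
have U (m' n' : 'I_5) : (m' < n')%N -> L e m' n' = 0.
  move: m' n'; do 2 apply: I5P => //=; move=> _;
    first [exact: Zx | exact: Zy | exact: Zz | exact: Zu | exact: bL].
case: (ltngtP m n) => [/U //|nm|/val_inj ->]; last exact: L0.
by rewrite aL U ?oppr0.
Qed.

Lemma ip0_trace A B : ip0 A B = 4^-1 * \tr (A *m B^T).
Proof. by rewrite /ip0 sum_mul_trace. Qed.

Lemma ip0_suml (J : Type) (r : seq J) (c : J -> R) (X : J -> 'M[R]_4) B :
  ip0 (\sum_(j <- r) c j *: X j) B = \sum_(j <- r) c j * ip0 (X j) B.
Proof.
rewrite ip0_trace mulmx_suml linear_sum mulr_sumr /=; apply: eq_bigr => j _.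
by rewrite -scalemxAl linearZ /= ip0_trace mulrCA.
Qed.

Lemma ip0C A B : ip0 A B = ip0 B A.
Proof.
by rewrite /ip0; congr (_ * _); apply: eq_bigr => i _; apply: eq_bigr => j _; rewrite mulrC.
Qed.

Lemma ip0_comb (s t : 'I_5 -> R) :
  ip0 (\sum_m s m *: E5 m) (\sum_m t m *: E5 m) = \sum_m s m * t m.
Proof. by rewrite !E5_comb ip0_skew4 sum5; field. Qed.

Lemma frame_parallel g I Q (w : 'I_5 -> 'M[R]_4) (C : 'I_4 -> 'I_5 -> 'M[R]_4) :
  unitary_frame g I Q ->
  (forall a, skew_mx (w a)) ->
  (forall a b, form_inner g (w a) (w b) = (a == b)%:R) ->
  (forall a : 'I_5, (a < 3)%N -> hodge g (I *m g) (w a) = - w a) ->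
  (forall a : 'I_5, (3 <= a)%N -> I *m w a *m I^T = - w a) ->
  (forall i a, skew_mx (C i a)) ->
  (forall i (a : 'I_5), (a < 3)%N -> I *m C i a *m I^T = C i a /\ form_inner g (I *m g) (C i a) = 0) ->
  (forall i (a : 'I_5), (3 <= a)%N -> I *m C i a *m I^T = - C i a) ->
  (forall i a b, form_inner g (C i a) (w b) + form_inner g (w a) (C i b) = 0) ->
  (forall a i j k, cyc (fun i => C i a) i j k = 0) ->
  forall i a, C i a = 0.
Proof.
move=> uf sw ow hw aw sC iC aC mC cC.
have uQ := uf_unit uf; pose F := invmx Q.
have FQ : F *m Q = 1%:M by exact: mulVmx.
have QF : Q *m F = 1%:M by exact: mulmxV.
have FI : F *m I = J0 *m F := uf_complex_l uf.
have congrE B : B = Q *m (F *m B *m F^T) *m Q^T by rewrite (uf_congrVK uf).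
have ipE B B' : ip0 (F *m B *m F^T) (F *m B' *m F^T) = form_inner g B B'.
  by rewrite -(uf_form_inner uf) !(uf_congrVK uf).
have actE B : J0 *m (F *m B *m F^T) *m J0^T = F *m (I *m B *m I^T) *m F^T.
  by rewrite !mulmxA -FI -!mulmxA -!trmx_mul -FI.
pose A a := F *m w a *m F^T.
have sA a : skew_mx (A a) by exact: skew_congr.
have A3 a : ip0 J0 (A a) = 0 /\ forall m : 'I_5, (m < 3)%N != (a < 3)%N -> coord5 (A a) 0 m = 0.
  have [a3|a3] := ltnP a 3.
    have hA : star0 (A a) = - A a.
      rewrite -[LHS](uf_congrK uf) -(uf_hodge uf) -congrE hw //.
      by rewrite mulmxN mulNmx.
    have [h1 h2] := asd_coord (sA a) hA; split => // m.
    by rewrite eqb_id -leqNgt; exact: h2.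
  have hA : J0 *m A a *m J0^T = - A a by rewrite actE aw // mulmxN mulNmx.
  have [h1 h2] := antiinv_coord (sA a) hA; split => // m.
  by rewrite eqbF_neg negbK; exact: h2.
pose W : 'M[R]_5 := \matrix_(a, m) coord5 (A a) 0 m.
have AE a : A a = \sum_m W a m *: E5 m.
  have [h _] := A3 a; rewrite {1}(skew_expand (sA a) h).
  by apply: eq_bigr => m _; rewrite [W _ _]mxE.
have WW : W *m W^T = 1%:M.
  apply/matrixP => a b; rewrite mxE [RHS]mxE -ow -ipE -/(A a) -/(A b) !AE ip0_comb.
  by apply: eq_bigr => m _; rewrite [W^T _ _]mxE.
have WW' : W^T *m W = 1%:M by exact: mulmx1C.
pose D e a := pull F (fun i => C i a) e.
have DE e a : D e a = \sum_i F e i *: (F *m C i a *m F^T) by [].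
have sD e a : skew_mx (D e a).
  rewrite DE /skew_mx linear_sum /= -sumrN; apply: eq_bigr => i _.
  by rewrite linearZ /= (skew_congr F (sC i a)) scalerN.
have D3 e a : ip0 J0 (D e a) = 0 /\ forall m : 'I_5, (m < 3)%N != (a < 3)%N -> coord5 (D e a) 0 m = 0.
  have act (s : R) : (forall i, I *m C i a *m I^T = s *: C i a) -> J0 *m D e a *m J0^T = s *: D e a.
    move=> H; rewrite DE mulmx_sumr mulmx_suml scaler_sumr; apply: eq_bigr => i _.
    by rewrite -scalemxAr -scalemxAl actE H -scalemxAr -scalemxAl !scalerA mulrC.
  have [a3|a3] := ltnP a 3.
    split=> [|m].
      rewrite ip0C DE ip0_suml big1 // => i _.
      have J0E : J0 = F *m (I *m g) *m F^T by rewrite (uf_kahler uf) (uf_congrK uf).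
      by rewrite ip0C [X in ip0 X _]J0E ipE; have [_ ->] := iC i a a3; rewrite mulr0.
    rewrite eqb_id -leqNgt; apply: inv_coord => //.
    rewrite (act 1) ?scale1r // => i; rewrite scale1r.
    by have [] := iC i a a3.
  have hD : J0 *m D e a *m J0^T = - D e a.
    by rewrite (act (-1)) ?scaleN1r // => i; rewrite scaleN1r aC.
  have [h1 h2] := antiinv_coord (sD e a) hD; split => // m.
  by rewrite eqbF_neg negbK; exact: h2.
pose K e : 'M[R]_5 := \matrix_(a, m) coord5 (D e a) 0 m.
have DK e a : D e a = \sum_m K e a m *: E5 m.
  have [h _] := D3 e a; rewrite {1}(skew_expand (sD e a) h).
  by apply: eq_bigr => m _; rewrite [K _ _ _]mxE.
have KW e : K e *m W^T + W *m (K e)^T = 0.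
  apply/matrixP => a b; rewrite !mxE.
  transitivity (ip0 (D e a) (A b) + ip0 (A a) (D e b)).
    by rewrite !DK !AE !ip0_comb; congr (_ + _); apply: eq_bigr => m _; rewrite [X in _ * X]mxE.
  rewrite [ip0 (A a) _]ip0C !DE !ip0_suml -big_split big1 // => i _.
  by rewrite /= -mulrDr !ipE [X in _ + X](_ : _ = form_inner g (w a) (C i b)) ?mC ?mulr0 // -!ipE ip0C.
pose L e := W^T *m K e.
have L0 : forall e, L e = 0.
  apply: structure_core.
  - move=> e m n.
    suff : L e + (L e)^T = 0.
      move=> /matrixP /(_ m n); rewrite mxE [X in _ + X]mxE [RHS]mxE => h.
      by apply/eqP; rewrite -addr_eq0; apply/eqP.
    rewrite /L trmx_mul trmxK.
    have := congr1 (fun X => W^T *m X *m W) (KW e).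
    by rewrite /= mulmx0 mul0mx mulmxDr mulmxDl -!mulmxA WW' mulmx1 !mulmxA WW' mul1mx.
  - move=> e m n mn; rewrite mxE big1 // => a _.
    rewrite [W^T _ _]mxE [W _ _]mxE [K _ _ _]mxE.
    have [ma|ma] := eqVneq (m < 3)%N (a < 3)%N.
      by have [_ ->] := D3 e a; rewrite ?mulr0 // -ma eq_sym.
    by have [_ ->] := A3 a; rewrite ?mul0r.
  - move=> m i j k.
    have E e : \sum_n L e m n *: E5 n = \sum_a W a m *: D e a.
      under [RHS]eq_bigr => a _ do rewrite DK scaler_sumr.
      rewrite exchange_big; apply: eq_bigr => n _; rewrite mxE scaler_suml.
      by apply: eq_bigr => a _; rewrite mxE scalerA.
    rewrite /cyc !E !summxE -!big_split big1 //= => a _.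
    have Ze (X : 'M[R]_4) u v : (W a m *: X) u v = W a m * X u v by rewrite mxE.
    rewrite !Ze -!mulrDr.
    have := cyc_pull F (cC a) i j k; rewrite /cyc => ->.
    by rewrite mulr0.
have K0 e : K e = 0 by rewrite -[K e]mul1mx -WW -mulmxA -/(L e) L0 mulmx0.
have D0 e a : D e a = 0.
  by rewrite DK big1 // => m _; rewrite K0 mxE scale0r.
move=> i a.
rewrite -(pullK (fun i => C i a) i QF); apply: big1 => e _.
have -> : pull F (fun i => C i a) e = 0 := D0 e a.
by rewrite mulmx0 mul0mx scaler0.
Qed.

End Structure.

(** * The twisted canonical connection in a chart *)

Lemma bil_delta (R : realType) (A : 'M[R]_4) a b :
  bil A (delta_mx 0 a) (delta_mx 0 b) = A a b.
Proof. by rewrite /bil trmx_delta -rowE -colE !mxE. Qed.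

Lemma bilE (R : realType) (A : 'M[R]_4) u v :
  bil A u v = \sum_i \sum_j A i j * (u 0 i * v 0 j).
Proof.
rewrite /bil mxE; under eq_bigr do rewrite mxE mulr_suml.
rewrite exchange_big; apply: eq_bigr => i _; apply: eq_bigr => j _.
by rewrite [_^T _ _]mxE; ring.
Qed.

Lemma mxDE (V : nmodType) p q (A B : 'M[V]_(p, q)) i j : (A + B) i j = A i j + B i j.
Proof. by rewrite mxE. Qed.

Lemma mxZE (V : pzSemiRingType) p q (c : V) (A : 'M[V]_(p, q)) i j : (c *: A) i j = c * A i j.
Proof. by rewrite mxE. Qed.

Lemma mxNE (V : zmodType) p q (A : 'M[V]_(p, q)) i j : (- A) i j = - A i j.
Proof. by rewrite mxE. Qed.

Section ChartGeometry.
Context {R : realType}.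
Variables (D : set 'rV[R]_4) (g I : 'rV[R]_4 -> 'M[R]_4) (theta : 'rV[R]_4 -> 'cV[R]_4).
Hypotheses (oD : open D) (sg : smooth_mx_on D g) (sI : smooth_mx_on D I)
  (sth : smooth_mx_on D theta).
Hypothesis gT : forall x, D x -> (g x)^T = g x.
Hypothesis gpos : forall x, D x -> forall u, u != 0 -> 0 < bil (g x) u u.
Hypothesis I2 : forall x, D x -> I x *m I x = - 1%:M.
Hypothesis gI : forall x, D x -> forall u v, bil (g x) (u *m I x) (v *m I x) = bil (g x) u v.
Hypothesis nij : forall X Y : 'rV[R]_4 -> 'rV[R]_4, smooth_mx_on D X -> smooth_mx_on D Y ->
  forall x, D x -> nijenhuis I X Y x = 0.
Hypothesis lee : forall x, D x -> forall i j k,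
  d2 (kahler_form g I) i j k x = wedge12 theta (kahler_form g I) i j k x.

Implicit Types (x : 'rV[R]_4) (i j k l : 'I_4).

Lemma unitary_frame_at x : D x -> exists Q, unitary_frame (g x) (I x) Q.
Proof.
move=> Dx; apply: exists_unitary_frame; [exact: gT|exact: gpos|exact: I2|exact: gI].
Qed.

Lemma g_unit x : D x -> g x \in unitmx.
Proof.
move=> /unitary_frame_at[Q uf].
by rewrite (uf_metric uf) unitmx_mul unitmx_tr (uf_unit uf).
Qed.

Definition christoffel1 i x : 'M[R]_4 :=
  \matrix_(j, l) (pdm i g x j l + pdm j g x i l - pdm l g x i j).

Definition Gam i x : 'M[R]_4 := 2^-1 *: (christoffel1 i x *m (invmx (g x))^T).

Lemma GamE i j k x : Gam i x j k = christoffel g i j k x.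
Proof.
rewrite /Gam /christoffel mxE; congr (_ * _); rewrite mxE; apply: eq_bigr => l _.
by rewrite !mxE !pdmE mulrC.
Qed.

Lemma Gam_smooth i : smooth_mx_on D (Gam i).
Proof.
have sc : smooth_mx_on D (christoffel1 i).
  move=> j l; under eq_fun do rewrite mxE.
  have sp := fun m => smooth_mx_pdm m sg.
  exact: (smoothB oD (smoothD oD (sp i j l) (sp j i l)) (sp l i j)).
have si : smooth_mx_on D (fun x => (invmx (g x))^T).
  exact: (smooth_mxT (smooth_invmx oD g_unit sg)).
exact: (smooth_mxZ oD (@smooth_cst _ _ D 2^-1) (smooth_mxM oD sc si)).
Qed.

Lemma pdm_g_sym i x : D x -> (pdm i g x)^T = pdm i g x.
Proof. by move=> Dx; rewrite -pdmT; exact: (pdm_open i oD Dx gT). Qed.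

Lemma Gam_sym i j k x : D x -> Gam i x j k = Gam j x i k.
Proof.
move=> Dx; rewrite /Gam !mxE; congr (_ * _); apply: eq_bigr => l _; congr (_ * _).
rewrite !mxE [pdm l g x i j](_ : _ = pdm l g x j i); first by ring.
by have := pdm_g_sym l Dx => /matrixP /(_ j i); rewrite mxE.
Qed.

Lemma Gam_metric i x : D x -> Gam i x *m g x + g x *m (Gam i x)^T = pdm i g x.
Proof.
move=> Dx.
have E : Gam i x *m g x = 2^-1 *: christoffel1 i x.
  rewrite /Gam -scalemxAl -mulmxA trmx_inv (gT Dx) mulVmx ?mulmx1 //.
  exact: g_unit.
have -> : g x *m (Gam i x)^T = (Gam i x *m g x)^T by rewrite trmx_mul gT.
have S l j m : pdm l g x j m = pdm l g x m j.
  by have := pdm_g_sym l Dx => /matrixP /(_ m j); rewrite mxE.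
rewrite E; apply/matrixP => j l; rewrite !mxE (S i l j) (S j i l) (S l i j).
by field.
Qed.

Definition Nab i x : 'M[R]_4 := pdm i I x + I x *m Gam i x - Gam i x *m I x.

(* On row vectors the canonical connection is Y |-> d_i Y + Y *m Acan i. *)
Definition Acan i x : 'M[R]_4 := Gam i x + 2^-1 *: (I x *m Nab i x).

Definition eta := act_covector I theta.

Definition Bcon i x : 'M[R]_4 := Acan i x - (4^-1 * eta x i 0) *: I x.

Lemma Nab_smooth i : smooth_mx_on D (Nab i).
Proof.
exact: (smooth_mxB oD (smooth_mxD oD (smooth_mx_pdm i sI) (smooth_mxM oD sI (Gam_smooth i)))
  (smooth_mxM oD (Gam_smooth i) sI)).
Qed.

Lemma Acan_smooth i : smooth_mx_on D (Acan i).
Proof.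
exact: (smooth_mxD oD (Gam_smooth i)
  (smooth_mxZ oD (@smooth_cst _ _ D 2^-1) (smooth_mxM oD sI (Nab_smooth i)))).
Qed.

Lemma eta_smooth : smooth_mx_on D eta.
Proof. exact: (smooth_mxM oD sI sth). Qed.

Lemma Bcon_smooth i : smooth_mx_on D (Bcon i).
Proof.
exact: (smooth_mxB oD (Acan_smooth i)
  (smooth_mxZ oD (smoothM oD (@smooth_cst _ _ D 4^-1) (eta_smooth i 0)) sI)).
Qed.

Lemma kahler_smooth : smooth_mx_on D (kahler_form g I).
Proof. exact: (smooth_mxM oD sI sg). Qed.

Lemma congr_gI x : D x -> I x *m g x *m (I x)^T = g x.
Proof.
move=> Dx; apply/matrixP => a b.
have := gI Dx (delta_mx 0 a) (delta_mx 0 b).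
have -> u v : bil (g x) (u *m I x) (v *m I x) = bil (I x *m g x *m (I x)^T) u v.
  by rewrite /bil trmx_mul !mulmxA.
by rewrite !bil_delta.
Qed.

Lemma kahler_skew x : D x -> skew_mx (kahler_form g I x).
Proof.
move=> Dx; rewrite /skew_mx /kahler_form trmx_mul gT //.
have := congr1 (mulmx (I x)) (congr_gI Dx).
by rewrite !mulmxA I2 // mulNmx mul1mx mulNmx => <-; rewrite opprK.
Qed.

Lemma g_actT x : D x -> g x *m (I x)^T = - (I x *m g x).
Proof. by move=> Dx; have := kahler_skew Dx; rewrite /skew_mx /kahler_form trmx_mul gT. Qed.

Lemma Nab_anti i x : D x -> Nab i x *m I x = - (I x *m Nab i x).
Proof.
move=> Dx.
have E : pdm i I x *m I x = - (I x *m pdm i I x).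
  have : pdm i (fun y => I y *m I y) x = 0.
    by rewrite (pdm_open i oD Dx I2) pdm_cst.
  by rewrite (pdmM i oD sI sI Dx) => /eqP; rewrite addrC addr_eq0 => /eqP.
rewrite /Nab !mulmxBl !mulmxDl !mulmxBr !mulmxDr E !mulmxA -[Gam i x *m I x *m I x]mulmxA.
rewrite I2 // mulmxN mulmx1 mulNmx mul1mx.
by apply/matrixP => a b; rewrite !mxE; ring.
Qed.

Lemma Nab_lower i x : D x -> Nab i x *m g x =
  pdm i (kahler_form g I) x - (Gam i x *m kahler_form g I x + kahler_form g I x *m (Gam i x)^T).
Proof.
move=> Dx; rewrite [pdm i (kahler_form g I) x](pdmM i oD sI sg Dx) -Gam_metric //.
rewrite /kahler_form /Nab !mulmxBl !mulmxDl !mulmxDr !mulmxA.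
by apply/matrixP => a b; rewrite !mxE; ring.
Qed.

Lemma Nab_skew i x : D x -> skew_mx (Nab i x *m g x).
Proof.
move=> Dx; rewrite /skew_mx Nab_lower // linearB linearD /=.
have -> : (pdm i (kahler_form g I) x)^T = - pdm i (kahler_form g I) x.
  rewrite -pdmT -(pdmN i kahler_smooth Dx); apply: (pdm_open i oD Dx) => y Dy.
  exact: kahler_skew.
move: (kahler_form g I x) (kahler_skew Dx) => w sw.
rewrite !trmx_mul trmxK sw mulNmx mulmxN.
by apply/matrixP => a b; rewrite !mxE; ring.
Qed.

(* The difference of B and the Levi-Civita connection. *)
Definition Psi i x : 'M[R]_4 := 2^-1 *: (I x *m Nab i x) - (4^-1 * eta x i 0) *: I x.

Lemma Bcon_Psi i x : Bcon i x = Gam i x + Psi i x.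
Proof. by rewrite /Bcon /Acan addrA. Qed.

Lemma Bcon_metric i x : D x -> pdm i g x = Bcon i x *m g x + g x *m (Bcon i x)^T.
Proof.
move=> Dx; rewrite Bcon_Psi linearD /= mulmxDl mulmxDr addrACA Gam_metric //.
suff -> : Psi i x *m g x + g x *m (Psi i x)^T = 0 by rewrite addr0.
have S : skew_mx (Psi i x *m g x).
  rewrite /skew_mx /Psi mulmxBl -!scalemxAl linearB !linearZ /=.
  have -> : (I x *m g x)^T = - (I x *m g x) := kahler_skew Dx.
  have -> : (I x *m Nab i x *m g x)^T = - (I x *m Nab i x *m g x).
    rewrite -mulmxA trmx_mul (Nab_skew i Dx) mulNmx -mulmxA g_actT // mulmxN opprK.
    by rewrite !mulmxA Nab_anti // mulNmx.
  by rewrite !scalerN opprD opprK.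
have -> : g x *m (Psi i x)^T = (Psi i x *m g x)^T by rewrite trmx_mul gT.
by rewrite S subrr.
Qed.

Lemma Acan_complex i x : D x -> pdm i I x + I x *m Acan i x - Acan i x *m I x = 0.
Proof.
move=> Dx.
have e1 : I x *m (I x *m Nab i x) = - Nab i x by rewrite mulmxA I2 // mulNmx mul1mx.
have e2 : I x *m Nab i x *m I x = Nab i x.
  by rewrite -mulmxA Nab_anti // mulmxN e1 opprK.
have NE : pdm i I x = Nab i x - I x *m Gam i x + Gam i x *m I x.
  by rewrite /Nab; apply/matrixP => a b; rewrite !mxE; ring.
rewrite NE /Acan; move: (Nab i x) (Gam i x) e1 e2 => n c e1 e2.
rewrite mulmxDl mulmxDr -scalemxAl -scalemxAr e1 e2.
move: (_ *m _) (_ *m _) => a b.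
by apply/matrixP => u v; rewrite !mxE; field.
Qed.

Lemma Bcon_complex i x : D x -> pdm i I x = Bcon i x *m I x - I x *m Bcon i x.
Proof.
move=> Dx; have := Acan_complex i Dx.
rewrite /Bcon mulmxBl mulmxBr -scalemxAl -scalemxAr opprB.
move: (pdm i I x) (_ *m Acan i x) (_ *m I x) (_ *: _) => a b c d H.
apply/eqP; rewrite -subr_eq0 -H; apply/eqP.
by apply/matrixP => u v; rewrite !mxE; ring.
Qed.

Lemma Bcon_kahler i x : D x -> pdm i (kahler_form g I) x =
  Bcon i x *m kahler_form g I x + kahler_form g I x *m (Bcon i x)^T.
Proof.
move=> Dx; rewrite [LHS](pdmM i oD sI sg Dx) Bcon_metric // Bcon_complex //.
rewrite /kahler_form; move: (Bcon i x) (I x) (g x) => b c d.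
rewrite mulmxDr mulmxBl !mulmxA addrC addrA subrK //.
Qed.

Lemma cyc_Gam w x : D x -> skew_mx w ->
  forall i j k, cyc (fun i => Gam i x *m w + w *m (Gam i x)^T) i j k = 0.
Proof.
move=> Dx sw i j k; rewrite /cyc.
have E a b c : (Gam a x *m w + w *m (Gam a x)^T) b c =
   \sum_l Gam a x b l * w l c - \sum_l Gam a x c l * w l b.
  rewrite mxE !mxE -sumrN; congr (_ + _); apply: eq_bigr => l _.
  by rewrite !mxE (skewE l b sw) mulNr mulrC.
rewrite !E.
have F a b c : \sum_l Gam a x b l * w l c = \sum_l Gam b x a l * w l c.
  by apply: eq_bigr => l _; rewrite Gam_sym.
rewrite (F k i j) (F j k i) (F i j k); ring.
Qed.

Lemma nabla_nijenhuis x : D x -> forall i j k,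
  (\sum_l I x i l *: Nab l x - Nab i x *m I x) j k =
  (\sum_l I x j l *: Nab l x - Nab j x *m I x) i k.
Proof.
move=> Dx i j k.
pose dI l := pdm l I x.
have dE : (\sum_l I x i l *: dI l - dI i *m I x) j k = (\sum_l I x j l *: dI l - dI j *m I x) i k.
  pose e m : 'rV[R]_4 := delta_mx 0 m.
  have se m : smooth_mx_on D (fun=> e m) by exact: smooth_mx_cst.
  have sa m : smooth_mx_on D (act_field I (fun=> e m)).
    exact: (smooth_mxM oD (se m) sI).
  have Da m v : 'D_v (act_field I (fun=> e m)) x = row m (dirm v dI).
    have [_ ->] := derive_row v oD (sa m) Dx.
    rewrite rowE /dirm mulmx_sumr; apply: eq_bigr => l _.
    rewrite -scalemxAr; congr (_ *: _).
    by rewrite (pdmM l oD (se m) sI Dx) pdm_cst mul0mx addr0.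
  have Dc m v : 'D_v (fun=> e m) x = 0 by exact: derive_cst.
  have := nij (se i) (se j) Dx.
  rewrite /nijenhuis /lie_bracket !Da !Dc subrr !subr0 !sub0r.
  rewrite mulNmx opprK => /matrixP /(_ 0 k).
  have Db m : dirm (e m) dI = dI m by exact: dirm_delta.
  rewrite !Db -!row_mul.
  have Dd m : dirm (act_field I (fun=> e m) x) dI = \sum_l I x m l *: dI l.
    apply: eq_bigr => l _; congr (_ *: _).
    by rewrite /act_field -rowE mxE.
  rewrite !Dd.
  have V (a b c d : 'rV[R]_4) : (a - b + c - d) 0 k = a 0 k - b 0 k + c 0 k - d 0 k by rewrite !mxE.
  have M (a b : 'M[R]_4) p q : (a - b) p q = a p q - b p q by rewrite mxE [X in _ + X]mxE.
  have Rw p (a : 'M[R]_4) : row p a 0 k = a p k by rewrite mxE.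
  rewrite V !Rw !M [(0 : 'rV[R]_4) 0 k]mxE.
  have K (a b c d : R) : a - b + c - d = 0 -> a - d = b - c by lra.
  exact: K.
pose C l := I x *m Gam l x - Gam l x *m I x.
have cE : (\sum_l I x i l *: C l - C i *m I x) j k = (\sum_l I x j l *: C l - C j *m I x) i k.
  have E a b : (\sum_l I x a l *: C l - C a *m I x) b k =
    \sum_l \sum_m I x a l * I x b m * Gam l x m k
    - (I x *m Gam b x *m I x) a k - (I x *m Gam a x *m I x) b k - Gam a x b k.
    have -> : C a *m I x = I x *m Gam a x *m I x + Gam a x.
      by rewrite /C mulmxBl -[_ *m I x *m I x]mulmxA I2 // mulmxN mulmx1 opprK.
    have -> : \sum_l I x a l *: C l = \sum_l I x a l *: (I x *m Gam l x) - \sum_l I x a l *: (Gam l x *m I x).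
      by rewrite -sumrB; apply: eq_bigr => l _; rewrite scalerBr.
    have M (p q r s : 'M[R]_4) : (p - q - (r + s)) b k = p b k - q b k - r b k - s b k.
      by rewrite !mxE; ring.
    rewrite M; congr (_ - _ - _ - _).
      rewrite summxE; apply: eq_bigr => l _; rewrite !mxE mulr_sumr.
      by apply: eq_bigr => m _; rewrite mulrA.
    rewrite summxE mul3_entry; apply: eq_bigr => l _; rewrite !mxE mulr_sumr.
    by apply: eq_bigr => m _; rewrite (Gam_sym b l m Dx); ring.
  rewrite !E (Gam_sym i j k Dx) [in LHS]exchange_big /=.
  have -> : \sum_m \sum_l I x i l * I x j m * Gam l x m k = \sum_m \sum_l I x j m * I x i l * Gam m x l k.
    by apply: eq_bigr => m _; apply: eq_bigr => l _; rewrite (Gam_sym l m k Dx); ring.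
  ring.
have NE l : Nab l x = dI l + C l by rewrite /Nab addrA.
have S a : \sum_l I x a l *: Nab l x - Nab a x *m I x =
   (\sum_l I x a l *: dI l - dI a *m I x) + (\sum_l I x a l *: C l - C a *m I x).
  rewrite addrACA -opprD -mulmxDl -NE -big_split; congr (_ - _).
  by apply: eq_bigr => l _; rewrite NE scalerDr.
by rewrite !S mxE dE cE [RHS]mxE.
Qed.

Lemma lee_Nab x : D x -> forall i j k,
  cyc (fun m => Nab m x *m g x - theta x m 0 *: (I x *m g x)) i j k = 0.
Proof.
move=> Dx i j k.
have H := lee Dx i j k; have Z := cyc_Gam Dx (kahler_skew Dx) i j k.
rewrite /d2 /wedge12 in H.
have P m a b : pd m (fun y => kahler_form g I y a b) x = pdm m (kahler_form g I) x a b by rewrite pdmE.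
rewrite !P in H.
rewrite /cyc; rewrite /cyc in Z.
have E m a b : (Nab m x *m g x - theta x m 0 *: (I x *m g x)) a b =
   pdm m (kahler_form g I) x a b
   - (Gam m x *m kahler_form g I x + kahler_form g I x *m (Gam m x)^T) a b
   - theta x m 0 * kahler_form g I x a b.
  have M (p q r : 'M[R]_4) (s : R) : (p - q - s *: r) a b = p a b - q a b - s * r a b by rewrite !mxE.
  by rewrite Nab_lower // M.
rewrite !E.
have K (p1 p2 p3 z1 z2 z3 t1 t2 t3 : R) : z1 + z2 + z3 = 0 -> p1 + p2 + p3 = t1 + t2 + t3 ->
  p1 - z1 - t1 + (p2 - z2 - t2) + (p3 - z3 - t3) = 0 by lra.
exact: K Z H.
Qed.

Lemma Bcon_torsion x w : D x -> skew_mx w -> form_inner (g x) (kahler_form g I x) w = 0 ->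
  forall i j k, cyc (fun i => Bcon i x *m w + w *m (Bcon i x)^T) i j k = 0.
Proof.
move=> Dx sw iw i j k.
have [Q uf] := unitary_frame_at Dx.
have T := torsion_identity uf (fun m => Nab_skew m Dx) (fun m => Nab_anti m Dx)
  (nabla_nijenhuis Dx) (lee_Nab Dx) sw iw i j k.
have Z := cyc_Gam Dx sw i j k.
have E m a b : (Bcon m x *m w + w *m (Bcon m x)^T) a b =
   (Gam m x *m w + w *m (Gam m x)^T) a b + (Psi m x *m w + w *m (Psi m x)^T) a b.
  have M (p q : 'M[R]_4) : p a b + q a b = (p + q) a b by rewrite mxE.
  rewrite M; congr (fun_of_matrix _ a b).
  by rewrite Bcon_Psi linearD /= mulmxDl mulmxDr addrACA.
rewrite /cyc in Z T *; rewrite !E.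
have K (z1 z2 z3 t1 t2 t3 : R) : z1 + z2 + z3 = 0 -> t1 + t2 + t3 = 0 ->
  z1 + t1 + (z2 + t2) + (z3 + t3) = 0 by lra.
exact: K Z T.
Qed.

Lemma dirmD p q u (S T : 'I_4 -> 'M[R]_(p, q)) :
  dirm u (fun i => S i + T i) = dirm u S + dirm u T.
Proof. by rewrite /dirm -big_split; apply: eq_bigr => i _; rewrite scalerDr. Qed.

Lemma dirmN p q u (S : 'I_4 -> 'M[R]_(p, q)) : dirm u (fun i => - S i) = - dirm u S.
Proof. by rewrite /dirm -sumrN; apply: eq_bigr => i _; rewrite scalerN. Qed.

Lemma dirmMr p q r u (S : 'I_4 -> 'M[R]_(p, q)) (T : 'M[R]_(q, r)) :
  dirm u (fun i => S i *m T) = dirm u S *m T.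
Proof. by rewrite /dirm mulmx_suml; apply: eq_bigr => i _; rewrite scalemxAl. Qed.

Lemma dirmZ p q u (c : R) (S : 'I_4 -> 'M[R]_(p, q)) :
  dirm u (fun i => c *: S i) = c *: dirm u S.
Proof. by rewrite /dirm scaler_sumr; apply: eq_bigr => i _; rewrite !scalerA mulrC. Qed.

Lemma levi_civitaE (X Y : 'rV[R]_4 -> 'rV[R]_4) x : smooth_mx_on D Y -> D x ->
  levi_civita g X Y x = dirm (X x) (fun i => pdm i Y x + Y x *m Gam i x).
Proof.
move=> sY Dx; have [_ DY] := derive_row (X x) oD sY Dx.
rewrite /levi_civita DY dirmD; congr (_ + _).
apply/rowP => k; rewrite mxE summxE; apply: eq_bigr => i _.
rewrite !mxE mulr_sumr; apply: eq_bigr => j _; rewrite GamE; ring.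
Qed.

Lemma act_field_smooth Y : smooth_mx_on D Y -> smooth_mx_on D (act_field I Y).
Proof. by move=> sY; exact: (smooth_mxM oD sY sI). Qed.

Lemma nabla_endoE (X Y : 'rV[R]_4 -> 'rV[R]_4) x : smooth_mx_on D Y -> D x ->
  nabla_endo g I X Y x = dirm (X x) (fun i => Y x *m Nab i x).
Proof.
move=> sY Dx; rewrite /nabla_endo levi_civitaE //; last exact: act_field_smooth.
rewrite levi_civitaE // -dirmMr -dirmN -dirmD.
apply: eq_bigr => i _; congr (_ *: _).
rewrite (pdmM i oD sY sI Dx) /act_field /Nab mulmxBr !mulmxDr mulmxDl !mulmxA.
move: (_ *m _) (_ *m _) (_ *m _ *m _) (_ *m _ *m _) => a b c d.
by apply/matrixP => u v; rewrite !mxE; ring.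
Qed.

Definition cov i (Z : 'rV[R]_4 -> 'rV[R]_4) x := pdm i Z x + Z x *m Acan i x.

Lemma cov_smooth i Z : smooth_mx_on D Z -> smooth_mx_on D (cov i Z).
Proof.
by move=> sZ; exact: (smooth_mxD oD (smooth_mx_pdm i sZ) (smooth_mxM oD sZ (Acan_smooth i))).
Qed.

Lemma canonical_connE (X Y : 'rV[R]_4 -> 'rV[R]_4) x : smooth_mx_on D Y -> D x ->
  canonical_conn g I X Y x = dirm (X x) (fun i => cov i Y x).
Proof.
move=> sY Dx; rewrite /canonical_conn levi_civitaE // nabla_endoE //; last exact: act_field_smooth.
rewrite -dirmZ -dirmD; apply: eq_bigr => i _; congr (_ *: _).
rewrite /cov /Acan /act_field; move: (Gam i x) (Nab i x) => a b.
by rewrite mulmxDr addrA -scalemxAr mulmxA.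
Qed.

Definition curv (A : 'I_4 -> 'rV[R]_4 -> 'M[R]_4) i j x : 'M[R]_4 :=
  pdm i (A j) x - pdm j (A i) x + A j x *m A i x - A i x *m A j x.

Lemma cov_comm i j Z x : smooth_mx_on D Z -> D x ->
  cov i (cov j Z) x - cov j (cov i Z) x = Z x *m curv Acan i j x.
Proof.
move=> sZ Dx.
have E a b : cov a (cov b Z) x = pdm a (pdm b Z) x + Z x *m pdm a (Acan b) x
    + pdm a Z x *m Acan b x + pdm b Z x *m Acan a x + Z x *m (Acan b x *m Acan a x).
  have sb := Acan_smooth b.
  rewrite /cov (pdmD a (smooth_mx_pdm b sZ) (smooth_mxM oD sZ sb) Dx) (pdmM a oD sZ sb Dx).
  by rewrite mulmxDl !addrA mulmxA.
rewrite !E (pdmC i j oD sZ Dx) /curv.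
move: (pdm j (pdm i Z) x) (pdm i Z x) (pdm j Z x) (Z x) (Acan i x) (Acan j x)
  (pdm i (Acan j) x) (pdm j (Acan i) x) => zij zi zj z a b db da.
rewrite mulmxBr mulmxDr mulmxBr.
by apply/matrixP => u v; rewrite !(mxDE, mxNE); ring.
Qed.

Lemma sum_swap (u v : 'rV[R]_4) (c : 'I_4 -> 'I_4 -> 'rV[R]_4) :
  \sum_i \sum_j (v 0 i * u 0 j) *: c i j = \sum_i \sum_j (u 0 i * v 0 j) *: c j i.
Proof.
rewrite exchange_big; apply: eq_bigr => i _; apply: eq_bigr => j _.
by rewrite mulrC.
Qed.

Lemma curvature_formula (X Y Z : 'rV[R]_4 -> 'rV[R]_4) x :
  smooth_mx_on D X -> smooth_mx_on D Y -> smooth_mx_on D Z -> D x ->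
  canonical_curv g I X Y Z x =
  - \sum_i \sum_j (X x 0 i * Y x 0 j) *: (Z x *m curv Acan i j x).
Proof.
move=> sX sY sZ Dx.
have conn2 (V W : 'rV[R]_4 -> 'rV[R]_4) : smooth_mx_on D V -> smooth_mx_on D W ->
    canonical_conn g I V (canonical_conn g I W Z) x =
    dirm ('D_(V x) W x) (fun j => cov j Z x) +
    \sum_i \sum_j (V x 0 i * W x 0 j) *: cov i (cov j Z) x.
  move=> sV sW.
  pose T y := dirm (W y) (fun j => cov j Z y).
  have sWj j : smooth_on D (fun y => W y 0 j) := sW 0 j.
  have sT1 j : smooth_mx_on D (fun y => W y 0 j *: cov j Z y).
    exact: (smooth_mxZ oD (sWj j) (cov_smooth j sZ)).
  have sT : smooth_mx_on D T by apply: smooth_mx_sum.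
  have ET y : D y -> T y = canonical_conn g I W Z y.
    by move=> Dy; rewrite canonical_connE.
  have sC : smooth_mx_on D (canonical_conn g I W Z) := smooth_mx_ext oD ET sT.
  rewrite (canonical_connE V sC Dx).
  have [_ DW] := derive_row (V x) oD sW Dx.
  have cE i : cov i (canonical_conn g I W Z) x =
      \sum_j (pdm i W x 0 j *: cov j Z x + W x 0 j *: cov i (cov j Z) x).
    rewrite {1}/cov -(pdm_open i oD Dx ET) -(ET x Dx) (pdm_sum _ i oD sT1 Dx).
    rewrite /T /dirm mulmx_suml -big_split; apply: eq_bigr => j _ /=.
    rewrite (pdmZ i (sWj j) (cov_smooth j sZ) Dx) -scalemxAl pdmE.
    have K (a b c : 'rV[R]_4) (s t : R) : s *: a + t *: b + s *: c = t *: b + s *: (a + c).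
      by rewrite addrAC -scalerDr addrC.
    exact: K.
  have E1 : dirm (V x) (fun i => cov i (canonical_conn g I W Z) x) =
     \sum_i V x 0 i *: (\sum_j pdm i W x 0 j *: cov j Z x) +
     \sum_i V x 0 i *: (\sum_j W x 0 j *: cov i (cov j Z) x).
    rewrite -big_split; apply: eq_bigr => i _.
    by rewrite (cE i) -[RHS]scalerDr -[in RHS]big_split.
  rewrite E1 DW; congr (_ + _).
    rewrite /dirm; under eq_bigr => i _ do rewrite scaler_sumr.
    rewrite exchange_big; apply: eq_bigr => j _.
    rewrite summxE scaler_suml; apply: eq_bigr => i _.
    by rewrite scalerA mxE.
  by apply: eq_bigr => i _; rewrite scaler_sumr; apply: eq_bigr => j _; rewrite scalerA.
rewrite /canonical_curv !conn2 // (canonical_connE (lie_bracket X Y) sZ Dx).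
have -> : dirm (lie_bracket X Y x) (fun j => cov j Z x) =
   dirm ('D_(X x) Y x) (fun j => cov j Z x) - dirm ('D_(Y x) X x) (fun j => cov j Z x).
  rewrite /lie_bracket /dirm -sumrB; apply: eq_bigr => j _.
  by rewrite mxE [X in _ + X]mxE scalerBl.
set S := \sum_i \sum_j _; set S' := \sum_i \sum_j _.
have -> : \sum_i \sum_j (X x 0 i * Y x 0 j) *: (Z x *m curv Acan i j x) = S - S'.
  have -> : S' = \sum_i \sum_j (X x 0 i * Y x 0 j) *: cov j (cov i Z) x.
    exact: (sum_swap (X x) (Y x) (fun i j => cov i (cov j Z) x)).
  rewrite /S -sumrB; apply: eq_bigr => i _; rewrite -sumrB; apply: eq_bigr => j _.
  by rewrite -(cov_comm i j sZ Dx) scalerBr.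
move: S S' (dirm _ _) (dirm _ _) => s s' a b.
by apply/matrixP => u v; rewrite !(mxDE, mxNE); ring.
Qed.

Lemma curv_Bcon i j x : D x ->
  curv Bcon i j x = curv Acan i j x - (4^-1 * d1 eta x i j) *: I x.
Proof.
move=> Dx.
have sb m : smooth_on D (fun y => 4^-1 * eta y m 0).
  exact: (smoothM oD (@smooth_cst _ _ D 4^-1) (eta_smooth m 0)).
have pB m l : pdm m (Bcon l) x = pdm m (Acan l) x -
    ((4^-1 * eta x l 0) *: pdm m I x + (4^-1 * pd m (fun y => eta y l 0) x) *: I x).
  rewrite (pdmB m oD (Acan_smooth l) (smooth_mxZ oD (sb l) sI) Dx).
  have e := pdZ 4^-1 m (eta_smooth l 0) Dx.
  by rewrite (pdmZ m (sb l) sI Dx) e.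
rewrite /curv !pB /Bcon.
have P m : pdm m I x = Acan m x *m I x - I x *m Acan m x.
  have := Acan_complex m Dx; move: (pdm m I x) (_ *m _) (_ *m _) => a b c H.
  by apply/eqP; rewrite -subr_eq0 -H; apply/eqP/matrixP => u v; rewrite !mxE; ring.
rewrite !P.
have -> : d1 eta x i j = pd i (fun y => eta y j 0) x - pd j (fun y => eta y i 0) x by rewrite mxE.
move: (pd i _ x) (pd j _ x) (eta x i 0) (eta x j 0) (pdm i (Acan j) x) (pdm j (Acan i) x)
  (Acan i x) (Acan j x) (I x) => di dj ei ej p q a b J.
rewrite !mulmxBl !mulmxBr -!scalemxAl -!scalemxAr.
by apply/matrixP => u v; rewrite !(mxDE, mxNE, mxZE); ring.
Qed.

Lemma curvature_conditionP :
  (forall X Y Z W : 'rV[R]_4 -> 'rV[R]_4,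
    smooth_mx_on D X -> smooth_mx_on D Y -> smooth_mx_on D Z -> smooth_mx_on D W ->
    forall x, D x ->
      bil (g x) (canonical_curv g I X Y Z x) (W x) =
      - 4^-1 * bil (d1 (act_covector I theta) x) (X x) (Y x)
             * bil (kahler_form g I x) (Z x) (W x)) <->
  (forall i j x, D x -> curv Bcon i j x = 0).
Proof.
split=> [H i j x Dx|H X Y Z W sX sY sZ sW x Dx].
  rewrite curv_Bcon //; apply/eqP; rewrite subr_eq0; apply/eqP.
  apply: (can_inj (mulmxK (g_unit Dx))); apply/matrixP => k l.
  pose e m : 'rV[R]_4 := delta_mx 0 m.
  have se m : smooth_mx_on D (fun=> e m) by exact: smooth_mx_cst.
  have := H _ _ _ _ (se i) (se j) (se k) (se l) x Dx.
  rewrite curvature_formula // !bil_delta => K.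
  rewrite -scalemxAl [RHS]mxE.
  suff : - (curv Acan i j x *m g x) k l = - 4^-1 * d1 eta x i j * (I x *m g x) k l.
    by move: ((_ *m _) k l) ((_ *m _) k l) (d1 _ _ _ _) => a b c; lra.
  rewrite -[RHS]K.
  have -> : \sum_a \sum_b (e i 0 a * e j 0 b) *: (e k *m curv Acan a b x) = e k *m curv Acan i j x.
    rewrite (bigD1 i) //= [X in _ + X]big1 ?addr0; last first.
      by move=> a ai; rewrite big1 // => b _; rewrite mxE (negbTE ai) andbF mul0r scale0r.
    rewrite (bigD1 j) //= [X in _ + X]big1 ?addr0; last first.
      by move=> b bj; rewrite [e j 0 b]mxE (negbTE bj) andbF mulr0 scale0r.
    by rewrite !mxE !eqxx mulr1 scale1r.
  rewrite -(bil_delta (curv Acan i j x *m g x)) /bil !mulNmx mxNE.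
  by rewrite !mulmxA.
have cA i j : curv Acan i j x = (4^-1 * d1 eta x i j) *: I x.
  by have := H i j x Dx; rewrite curv_Bcon // => /eqP; rewrite subr_eq0 => /eqP.
rewrite curvature_formula //.
have -> : \sum_i \sum_j (X x 0 i * Y x 0 j) *: (Z x *m curv Acan i j x) =
    (4^-1 * bil (d1 eta x) (X x) (Y x)) *: (Z x *m I x).
  rewrite bilE mulr_sumr scaler_suml; apply: eq_bigr => i _.
  rewrite mulr_sumr scaler_suml; apply: eq_bigr => j _.
  by rewrite cA -scalemxAr scalerA; congr (_ *: _); ring.
rewrite /bil /kahler_form mulNmx mulNmx -!scalemxAl !mulmxA [LHS]mxE [X in - X]mxE /eta.
by rewrite mulNr mulNr.
Qed.

Lemma parallel_curv D' (w : 'rV[R]_4 -> 'M[R]_4) : open D' -> D' `<=` D ->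
  smooth_mx_on D' w ->
  (forall i x, D' x -> pdm i w x = Bcon i x *m w x + w x *m (Bcon i x)^T) ->
  forall i j x, D' x -> curv Bcon i j x *m w x + w x *m (curv Bcon i j x)^T = 0.
Proof.
move=> oD' DD sw pw i j x Dx.
have sB m : smooth_mx_on D' (Bcon m) := smooth_mx_subset DD (Bcon_smooth m).
have sBT m : smooth_mx_on D' (fun y => (Bcon m y)^T) := smooth_mxT (sB m).
have E a b : pdm a (pdm b w) x =
   Bcon b x *m (Bcon a x *m w x + w x *m (Bcon a x)^T) + pdm a (Bcon b) x *m w x +
   (w x *m (pdm a (Bcon b) x)^T + (Bcon a x *m w x + w x *m (Bcon a x)^T) *m (Bcon b x)^T).
  rewrite (pdm_open a oD' Dx (pw b)).
  rewrite (pdmD a (smooth_mxM oD' (sB b) sw) (smooth_mxM oD' sw (sBT b)) Dx).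
  by rewrite (pdmM a oD' (sB b) sw Dx) (pdmM a oD' sw (sBT b) Dx) pdmT !pw.
have := pdmC i j oD' sw Dx; rewrite !E /curv => H.
move: (pdm i (Bcon j) x) (pdm j (Bcon i) x) (Bcon i x) (Bcon j x) (w x) H => p q a b c H.
have T : (p - q + b *m a - a *m b)^T = p^T - q^T + a^T *m b^T - b^T *m a^T.
  by rewrite linearB linearD linearB /= !trmx_mul.
rewrite T !(mulmxBl, mulmxDl, mulmxBr, mulmxDr) !mulmxA.
move: H; rewrite !mulmxDr !mulmxDl !mulmxA => /eqP; rewrite -subr_eq0 => /eqP H.
rewrite -[RHS]H.
by apply/matrixP => u v; rewrite !(mxDE, mxNE); ring.
Qed.

Definition covform i (w : 'rV[R]_4 -> 'M[R]_4) x : 'M[R]_4 :=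
  pdm i w x - (Bcon i x *m w x + w x *m (Bcon i x)^T).

Lemma pd_form_inner D' (w1 w2 : 'rV[R]_4 -> 'M[R]_4) i x : open D' -> D' `<=` D ->
  smooth_mx_on D' w1 -> smooth_mx_on D' w2 -> D' x ->
  pd i (fun y => form_inner (g y) (w1 y) (w2 y)) x =
  form_inner (g x) (covform i w1 x) (w2 x) + form_inner (g x) (w1 x) (covform i w2 x).
Proof.
move=> oD' DD s1 s2 Dx.
pose C (w : 'rV[R]_4 -> 'M[R]_4) := covform i w x.
rewrite -/(C w1) -/(C w2).
pose h y := invmx (g y).
have hT y : D y -> (h y)^T = h y by move=> Dy; rewrite /h trmx_inv gT.
have ipE y a b : D y -> form_inner (g y) a b = 4^-1 * \tr (a *m (h y *m (b^T *m h y))).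
  move=> Dy; rewrite /form_inner sum_mul_trace /raise -/(h y) !trmx_mul trmxK (hT y Dy).
  by rewrite mulmxA.
have sg' := smooth_mx_subset DD sg.
have sh : smooth_mx_on D' h.
  by apply: (smooth_invmx oD' _ sg') => y /DD; exact: g_unit.
have hg y : D' y -> h y *m g y = 1%:M by move=> /DD Dy; rewrite mulVmx // g_unit.
have gh y : D' y -> g y *m h y = 1%:M by move=> /DD Dy; rewrite mulmxV // g_unit.
have ph : pdm i h x = - (h x *m Bcon i x + (Bcon i x)^T *m h x).
  have : pdm i (fun y => h y *m g y) x = 0.
    by rewrite (pdm_open i oD' Dx hg) pdm_cst.
  rewrite (pdmM i oD' sh sg' Dx) (Bcon_metric i (DD x Dx)) => H.
  have := congr1 (mulmx^~ (h x)) H; rewrite /= mul0mx mulmxDl -[pdm i h x *m g x *m _]mulmxA gh // mulmx1.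
  rewrite mulmxDr mulmxDl !mulmxA hg // mul1mx -[h x *m Bcon i x *m g x *m h x]mulmxA gh // mulmx1.
  by move=> /eqP; rewrite addrC addr_eq0 => /eqP.
have s2T := smooth_mxT s2.
have sF2 := smooth_mxM oD' s2T sh.
have sF3 := smooth_mxM oD' sh sF2.
have sF := smooth_mxM oD' s1 sF3.
have trE (F : 'rV[R]_4 -> 'M[R]_4) : smooth_mx_on D' F ->
    pd i (fun y => 4^-1 * \tr (F y)) x = 4^-1 * \tr (pdm i F x).
  move=> sF'; have st : smooth_on D' (fun y => \tr (F y)).
    by apply: smooth_sum => // a; exact: sF'.
  rewrite (pdZ 4^-1 i st Dx); congr (_ * _).
  rewrite (pd_sum _ i oD' (fun a => sF' a a) Dx).
  by apply: eq_bigr => a _; rewrite pdmE.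
rewrite (pd_open _ oD' Dx (fun y Dy => ipE y (w1 y) (w2 y) (DD y Dy))) (trE _ sF).
rewrite !ipE; try exact: DD.
rewrite -mulrDr; congr (_ * _).
rewrite (pdmM i oD' s1 sF3 Dx) (pdmM i oD' sh sF2 Dx) (pdmM i oD' s2T sh Dx) pdmT ph.
have C1 : pdm i w1 x = C w1 + (Bcon i x *m w1 x + w1 x *m (Bcon i x)^T) by rewrite /C subrK.
have C2 : pdm i w2 x = C w2 + (Bcon i x *m w2 x + w2 x *m (Bcon i x)^T) by rewrite /C subrK.
rewrite C1 C2; move: (C w1) (C w2) (Bcon i x) (w1 x) (w2 x) (h x) => c1 c2 b a1 a2 k.
rewrite -linearD /=.
set L := \tr _; set M := \tr _.
suff -> : L = M + (\tr (b *m (a1 *m k *m a2^T *m k)) - \tr ((a1 *m k *m a2^T *m k) *m b)).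
  by rewrite [\tr (b *m _)]mxtrace_mulC subrr addr0.
rewrite /L /M -linearB -linearD /=; congr (\tr _).
have T : (c2 + (b *m a2 + a2 *m b^T))^T = c2^T + (a2^T *m b^T + b *m a2^T).
  by rewrite !linearD /= !trmx_mul trmxK.
rewrite T !(mulmxDl, mulmxDr, mulmxN, mulNmx) !mulmxA.
by apply/matrixP => u v; rewrite !(mxDE, mxNE); ring.
Qed.

Lemma covform_act D' (w : 'rV[R]_4 -> 'M[R]_4) (s : R) : open D' -> D' `<=` D ->
  smooth_mx_on D' w -> (forall x, D' x -> I x *m w x *m (I x)^T = s *: w x) ->
  forall i x, D' x -> I x *m covform i w x *m (I x)^T = s *: covform i w x.
Proof.
move=> oD' DD sw H i x Dx.
have sI' := smooth_mx_subset DD sI.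
have := pdm_open i oD' Dx H.
have ss : smooth_on D' (fun=> s) by exact: smooth_cst.
rewrite (pdmM i oD' (smooth_mxM oD' sI' sw) (smooth_mxT sI') Dx) (pdmM i oD' sI' sw Dx).
rewrite (pdmZ i ss sw Dx) pd_cst scale0r addr0 pdmT Bcon_complex; last exact: DD.
have := H x Dx; rewrite /covform.
move: (I x) (w x) (Bcon i x) (pdm i w x) => J a b da E.
have T : (b *m J - J *m b)^T = J^T *m b^T - b^T *m J^T by rewrite linearB /= !trmx_mul.
rewrite T => E2.
have E3 := congr1 (mulmx b) E; have E4 := congr1 (mulmx^~ b^T) E.
move: E3 E4 E2; rewrite /= !scalerBr !scalerDr -!scalemxAr -!scalemxAl.
rewrite !(mulmxDl, mulmxDr, mulmxBl, mulmxBr, mulmxN, mulNmx) !mulmxA.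
move=> E3 E4 E2; rewrite -E2 -E3 -E4.
by apply/matrixP => u v; rewrite !(mxDE, mxNE); ring.
Qed.

Lemma asd_act x (w : 'M[R]_4) : D x -> skew_mx w ->
  hodge (g x) (kahler_form g I x) w = - w ->
  I x *m w *m (I x)^T = w /\ form_inner (g x) (kahler_form g I x) w = 0.
Proof.
move=> Dx sw hw; have [Q uf] := unitary_frame_at Dx.
pose A := invmx Q *m w *m (invmx Q)^T.
have wE : w = Q *m A *m Q^T by rewrite (uf_congrVK uf).
have sA : skew_mx A by exact: skew_congr.
have hA : star0 A = - A.
  rewrite -[LHS](uf_congrK uf) -(uf_hodge uf) -wE -/(kahler_form g I x) hw.
  by rewrite mulmxN mulNmx.
have [h1 h2] := asd_coord sA hA.
split.
  rewrite wE (uf_act uf); congr (_ *m _ *m _).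
  have AE := skew_expand sA h1.
  rewrite [X in J0 *m X]AE [RHS]AE mulmx_sumr mulmx_suml; apply: eq_bigr => m _.
  rewrite -scalemxAr -scalemxAl E5_J0.
  have [m3|m3] := leqP 3 m; first by rewrite h2 // !scale0r.
  by rewrite expr0 scale1r.
by rewrite {1}/kahler_form (uf_kahler uf) wE (uf_form_inner uf).
Qed.

Lemma antiinv_orth x (w : 'M[R]_4) : D x -> skew_mx w ->
  I x *m w *m (I x)^T = - w -> form_inner (g x) (kahler_form g I x) w = 0.
Proof.
move=> Dx sw hw; have [Q uf] := unitary_frame_at Dx.
pose A := invmx Q *m w *m (invmx Q)^T.
have wE : w = Q *m A *m Q^T by rewrite (uf_congrVK uf).
have sA : skew_mx A by exact: skew_congr.
have hA : J0 *m A *m J0^T = - A.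
  rewrite -[LHS](uf_congrK uf) -(uf_act uf) -wE hw.
  by rewrite mulmxN mulNmx.
have [h1 h2] := antiinv_coord sA hA.
by rewrite {1}/kahler_form (uf_kahler uf) wE (uf_form_inner uf).
Qed.

Lemma d2_cyc (w : 'rV[R]_4 -> 'M[R]_4) i j k x : d2 w i j k x = cyc (fun m => pdm m w x) i j k.
Proof. by rewrite /d2 /cyc !pdmE. Qed.

Lemma pdm_skew D' (w : 'rV[R]_4 -> 'M[R]_4) i x : open D' -> smooth_mx_on D' w ->
  (forall y, D' y -> skew_mx (w y)) -> D' x -> skew_mx (pdm i w x).
Proof.
move=> oD' s sw Dx; rewrite /skew_mx -pdmT -(pdmN i s Dx).
by apply: (pdm_open i oD' Dx) => y Dy; exact: sw.
Qed.

Lemma conj_skew (b a : 'M[R]_4) : skew_mx a -> skew_mx (b *m a + a *m b^T).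
Proof.
move=> sa; rewrite /skew_mx linearD /= !trmx_mul trmxK sa mulNmx mulmxN opprD.
by rewrite addrC.
Qed.

Lemma necessity_chart D' (w : 'I_5 -> 'rV[R]_4 -> 'M[R]_4) : open D' -> D' `<=` D ->
  (forall a, smooth_mx_on D' (w a)) ->
  (forall a x, D' x -> skew_mx (w a x)) ->
  (forall a b x, D' x -> form_inner (g x) (w a x) (w b x) = (a == b)%:R) ->
  (forall (a : 'I_5) x, D' x -> (a < 3)%N -> hodge (g x) (kahler_form g I x) (w a x) = - w a x) ->
  (forall (a : 'I_5) x, D' x -> (3 <= a)%N -> I x *m w a x *m (I x)^T = - w a x) ->
  (forall a x, D' x -> forall i j k, d2 (w a) i j k x = 0) ->
  forall i j x, D' x -> curv Bcon i j x = 0.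
Proof.
move=> oD' DD sm sw ow hw aw cw.
have iw a x : D' x -> form_inner (g x) (kahler_form g I x) (w a x) = 0.
  move=> Dx; have [a3|a3] := ltnP a 3.
    by have [] := asd_act (DD x Dx) (sw a x Dx) (hw a x Dx a3).
  exact: antiinv_orth (DD x Dx) (sw a x Dx) (aw a x Dx a3).
have sk := smooth_mx_subset DD kahler_smooth.
have C0 i a x : D' x -> covform i (w a) x = 0.
  move=> Dx; have [Q uf] := unitary_frame_at (DD x Dx).
  have cst0 (f : 'rV[R]_4 -> R) (c : R) : (forall y, D' y -> f y = c) -> pd i f x = 0.
    by move=> E; rewrite (pd_open i oD' Dx E) pd_cst.
  apply: (frame_parallel (g := g x) (I := I x) (w := fun a => w a x)
    (C := fun i a => covform i (w a) x) uf) => {i a cst0}.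
  - by move=> a; exact: sw.
  - by move=> a b; exact: ow.
  - by move=> a a3; exact: hw.
  - by move=> a a3; exact: aw.
  - move=> i a; rewrite /skew_mx /covform linearB /=.
    rewrite (pdm_skew i oD' (sm a) (sw a) Dx).
    by rewrite (conj_skew (Bcon i x) (sw a x Dx)) opprK opprB addrC.
  - move=> i a a3; split.
      have H y : D' y -> I y *m w a y *m (I y)^T = 1 *: w a y.
        move=> Dy; rewrite scale1r.
        by have [] := asd_act (DD y Dy) (sw a y Dy) (hw a y Dy a3).
      by rewrite (covform_act oD' DD (sm a) H i Dx) scale1r.
    have := pd_form_inner i oD' DD sk (sm a) Dx.
    rewrite (pd_open i oD' Dx (iw a)) pd_cst.
    have -> : covform i (kahler_form g I) x = 0.
      by rewrite /covform (Bcon_kahler i (DD x Dx)) subrr.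
    have -> : form_inner (g x) 0 (w a x) = 0.
      by rewrite /form_inner big1 ?mulr0 // => u _; rewrite big1 // => v _; rewrite mxE mul0r.
    by rewrite add0r => <-.
  - move=> i a a3.
    have H y : D' y -> I y *m w a y *m (I y)^T = -1 *: w a y.
      by move=> Dy; rewrite scaleN1r; exact: aw.
    by rewrite (covform_act oD' DD (sm a) H i Dx) scaleN1r.
  - move=> i a b; have := pd_form_inner i oD' DD (sm a) (sm b) Dx.
    by rewrite (pd_open i oD' Dx (ow a b)) pd_cst => <-.
  - move=> a i j k.
    have T := Bcon_torsion (DD x Dx) (sw a x Dx) (iw a x Dx) i j k.
    have := cw a x Dx i j k; rewrite d2_cyc => E.
    rewrite /cyc in T E *.
    rewrite /covform !(mxDE (pdm _ _ _)) !mxNE.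
    have K (p1 p2 p3 z1 z2 z3 : R) : p1 + p2 + p3 = 0 -> z1 + z2 + z3 = 0 ->
      p1 - z1 + (p2 - z2) + (p3 - z3) = 0 by lra.
    exact: K E T.
move=> i j x Dx; have [Q uf] := unitary_frame_at (DD x Dx).
have uQ := uf_unit uf; pose F := invmx Q.
have FQ : F *m Q = 1%:M by exact: mulVmx.
have QF : Q *m F = 1%:M by exact: mulmxV.
have par v : smooth_mx_on D' v -> (forall i y, D' y -> covform i v y = 0) ->
    curv Bcon i j x *m v x + v x *m (curv Bcon i j x)^T = 0.
  move=> sv cv; apply: (parallel_curv oD' DD sv) => // m y Dy.
  by have /eqP := cv m y Dy; rewrite subr_eq0 => /eqP.
pose K := F *m curv Bcon i j x *m Q.
have KE (v : 'M[R]_4) : curv Bcon i j x *m v + v *m (curv Bcon i j x)^T = 0 ->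
    K *m (F *m v *m F^T) + (F *m v *m F^T) *m K^T = 0.
  move=> H; rewrite /K !trmx_mul.
  have := congr1 (fun M => F *m M *m F^T) H; rewrite /= mulmx0 mul0mx mulmxDr mulmxDl => <-.
  congr (_ + _); rewrite !mulmxA.
    by rewrite -[F *m _ *m Q *m F]mulmxA QF mulmx1.
  by rewrite -[_ *m F^T *m Q^T]mulmxA -trmx_mul QF trmx1 mulmx1.
have sK : skew_mx K.
  have /KE : curv Bcon i j x *m g x + g x *m (curv Bcon i j x)^T = 0.
    apply: (par g) => [|m y Dy]; first exact: smooth_mx_subset DD sg.
    by rewrite /covform (Bcon_metric m (DD y Dy)) subrr.
  have -> : F *m g x *m F^T = 1%:M by rewrite -mulmxA (uf_gF uf) FQ.
  by rewrite mulmx1 mul1mx => /eqP; rewrite addrC addr_eq0 => /eqP.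
have comm (v : 'M[R]_4) : curv Bcon i j x *m v + v *m (curv Bcon i j x)^T = 0 ->
    K *m (F *m v *m F^T) = (F *m v *m F^T) *m K.
  by move=> /KE; rewrite sK mulmxN => /eqP; rewrite subr_eq0 => /eqP.
have K0 : K = 0.
  apply: commutant_zero => //.
  - move=> m.
    pose A a := F *m w a x *m F^T.
    have KA a : K *m A a = A a *m K.
      by apply: comm; apply: (par (w a)) => // l y Dy; exact: C0.
    pose W : 'M[R]_5 := \matrix_(a, n) coord5 (A a) 0 n.
    have AE a : A a = \sum_n W a n *: E5 n.
      have sA : skew_mx (A a) by exact: skew_congr (sw a x Dx).
      have iA : ip0 J0 (A a) = 0.
        rewrite -(uf_form_inner uf) (uf_congrVK uf) -(uf_kahler uf).
        exact: iw.
      rewrite {1}(skew_expand sA iA); apply: eq_bigr => n _.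
      by rewrite [W _ _]mxE.
    have WW : W *m W^T = 1%:M.
      apply/matrixP => a b; rewrite mxE [RHS]mxE -(ow a b x Dx).
      rewrite -(uf_congrVK uf (w a x)) -(uf_congrVK uf (w b x)) (uf_form_inner uf).
      rewrite -/(A a) -/(A b) !AE ip0_comb.
      by apply: eq_bigr => n _; rewrite [W^T _ _]mxE.
    have WW' : W^T *m W = 1%:M by exact: mulmx1C.
    have S n : \sum_a W a m * W a n = (m == n)%:R.
      have := congr1 (fun M : 'M[R]_5 => M m n) WW'; rewrite mxE [RHS]mxE => <-.
      by apply: eq_bigr => a _; rewrite [W^T _ _]mxE.
    have -> : E5 m = \sum_a W a m *: A a.
      under eq_bigr => a _ do rewrite AE scaler_sumr.
      rewrite exchange_big /= (bigD1 m) //= [X in _ + X]big1 ?addr0.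
        under eq_bigr => a _ do rewrite scalerA.
        by rewrite -scaler_suml S eqxx scale1r.
      move=> n nm; under eq_bigr => a _ do rewrite scalerA.
      by rewrite -scaler_suml S eq_sym (negbTE nm) scale0r.
    rewrite mulmx_sumr mulmx_suml; apply: eq_bigr => a _.
    by rewrite -scalemxAr -scalemxAl KA.
  - have J0E : J0 = F *m kahler_form g I x *m F^T.
      by rewrite /kahler_form (uf_kahler uf) (uf_congrK uf).
    rewrite [J0]J0E; apply: comm; apply: (par (kahler_form g I)) => // m y Dy.
    by rewrite /covform (Bcon_kahler m (DD y Dy)) subrr.
have -> : curv Bcon i j x = Q *m K *m F.
  by rewrite /K !mulmxA QF mul1mx -mulmxA QF mulmx1.
by rewrite K0 mulmx0 mul0mx.
Qed.

Lemma ip0_J0_E5 m : ip0 J0 (E5 m) = 0 :> R.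
Proof. by rewrite ip0_skew4; move: m; apply: I5P => /=; field. Qed.

Lemma pdm0_constant p q (r : R) (c : 'rV[R]_4) (H : 'rV[R]_4 -> 'M[R]_(p, q)) :
  smooth_mx_on (cball c r) H -> (forall i x, cball c r x -> pdm i H x = 0) ->
  forall x, cball c r x -> H x = H c.
Proof.
move=> sH dH x Bx; apply/matrixP => a b.
have df y : `|y - c| < r -> forall i, derivable (fun z => H z a b) y (delta_mx 0 i).
  by move=> By i; exact: smooth_derivable (sH a b) By.
have [z [Hz E]] := increment_expansion (h := x - c) Bx df.
move: E; rewrite [c + _]addrC subrK => /eqP; rewrite subr_eq => /eqP ->.
rewrite big1 ?add0r // => i _.
have Bz : cball c r (z i) by apply: le_lt_trans (Hz i) _.
have := dH i _ Bz => /matrixP /(_ a b); rewrite pdmE => ->.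
by rewrite [X in _ * X]mxE mulr0.
Qed.

Lemma sufficiency_chart p : D p -> (forall i j x, D x -> curv Bcon i j x = 0) ->
  exists (r : R) (Q : 'rV[R]_4 -> 'M[R]_4),
    [/\ 0 < r, cball p r `<=` D, smooth_mx_on (cball p r) Q,
      forall x, cball p r x -> unitary_frame (g x) (I x) (Q x) &
      forall m i j k x, cball p r x -> d2 (fun y => Q y *m E5 m *m (Q y)^T) i j k x = 0].
Proof.
move=> Dp flat; have [Q0 uf0] := unitary_frame_at Dp.
have sG i : smooth_mx_on D (fun x => - Bcon i x) := smooth_mxN oD (Bcon_smooth i).
have flatG i j x : D x -> pdm i (fun y => - Bcon j y) x - pdm j (fun y => - Bcon i y) x
    + (- Bcon i x) *m (- Bcon j x) - (- Bcon j x) *m (- Bcon i x) = 0.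
  move=> Dx; rewrite (pdmN i (Bcon_smooth j) Dx) (pdmN j (Bcon_smooth i) Dx).
  rewrite !mulmxN !mulNmx !opprK; have := flat i j x Dx; rewrite /curv.
  move: (pdm _ _ _) (pdm _ _ _) (_ *m _) (_ *m _) => a b c d /eqP.
  rewrite -oppr_eq0 => /eqP <-.
  by apply/matrixP => u v; rewrite !(mxDE, mxNE); ring.
have [r [F [r0 BD sF Fp dF]]] := flat_connection_frame (invmx Q0) oD Dp sG flatG.
have oB : open (cball p r) by exact: open_cball.
have sgB := smooth_mx_subset BD sg; have sKB := smooth_mx_subset BD kahler_smooth.
have sFT := smooth_mxT sF.
have dhF (h : 'rV[R]_4 -> 'M[R]_4) : smooth_mx_on (cball p r) h ->
    (forall i x, cball p r x -> pdm i h x = Bcon i x *m h x + h x *m (Bcon i x)^T) ->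
    forall i x, cball p r x -> pdm i (fun y => h y *m (F y)^T) x = Bcon i x *m (h x *m (F x)^T).
  move=> sh dh i x Bx; rewrite (pdmM i oB sh sFT Bx) pdmT (dF i x Bx) (dh i x Bx).
  move: (Bcon i x) (h x) (F x) => b a f.
  rewrite mulmxN linearN /= mulmxN trmx_mul mulmxDl !mulmxA addrC -addrA subrr.
  by rewrite addr0.
have cst (h : 'rV[R]_4 -> 'M[R]_4) : smooth_mx_on (cball p r) h ->
    (forall i x, cball p r x -> pdm i h x = Bcon i x *m h x + h x *m (Bcon i x)^T) ->
    forall x, cball p r x -> F x *m (h x *m (F x)^T) = invmx Q0 *m h p *m (invmx Q0)^T.
  move=> sh dh x Bx; have sc := smooth_mxM oB sh sFT.
  rewrite (pdm0_constant (smooth_mxM oB sF sc) _ Bx) ?Fp ?mulmxA //.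
  move=> i y By; rewrite (pdmM i oB sF sc By) (dhF h sh dh i y By) (dF i y By).
  by rewrite mulmxN mulNmx !mulmxA subrr.
have dg i x : cball p r x -> pdm i g x = Bcon i x *m g x + g x *m (Bcon i x)^T.
  by move=> /BD; exact: Bcon_metric.
have dk i x : cball p r x -> pdm i (kahler_form g I) x =
    Bcon i x *m kahler_form g I x + kahler_form g I x *m (Bcon i x)^T.
  by move=> /BD; exact: Bcon_kahler.
have FQ x : cball p r x -> F x *m (g x *m (F x)^T) = 1%:M.
  by move=> Bx; rewrite (cst g) // -mulmxA (uf_gF uf0) mulVmx // (uf_unit uf0).
have FJ x : cball p r x -> F x *m (kahler_form g I x *m (F x)^T) = J0.
  move=> Bx; rewrite (cst (kahler_form g I)) //.
  by rewrite /kahler_form (uf_kahler uf0) (uf_congrK uf0).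
pose Q x := g x *m (F x)^T; exists r, Q.
have sQ : smooth_mx_on (cball p r) Q := smooth_mxM oB sgB sFT.
have uf x : cball p r x -> unitary_frame (g x) (I x) (Q x).
  move=> Bx; have fq := FQ x Bx; have qf := mulmx1C fq.
  split.
  - by have [] := mulmx1_unit fq.
  - by rewrite -[Q x in RHS]/(g x *m (F x)^T) -mulmxA -trmx_mul qf trmx1 mulmx1.
  - by rewrite -(FJ x Bx) /kahler_form -mulmxA -/(Q x) !mulmxA qf mul1mx.
split=> // m i j k x Bx; rewrite d2_cyc.
have sQT := smooth_mxT sQ; have sE : smooth_mx_on (cball p r) (fun=> E5 m) by exact: smooth_mx_cst.
have sQE := smooth_mxM oB sQ sE.
have dw l : pdm l (fun y => Q y *m E5 m *m (Q y)^T) x =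
    Bcon l x *m (Q x *m E5 m *m (Q x)^T) + Q x *m E5 m *m (Q x)^T *m (Bcon l x)^T.
  rewrite (pdmM l oB sQE sQT Bx) (pdmM l oB sQ sE Bx) pdm_cst mulmx0 add0r pdmT.
  rewrite [pdm l Q x](dhF g sgB dg l x Bx) -/(Q x) trmx_mul addrC.
  by move: (Bcon l x) (Q x) => b a; rewrite !mulmxA.
rewrite /cyc !dw; apply: (Bcon_torsion (BD x Bx)).
- exact: (skew_congr (Q x) (E5_skew m)).
- rewrite {1}/kahler_form (uf_kahler (uf x Bx)) (uf_form_inner (uf x Bx)).
  exact: ip0_J0_E5.
Qed.

End ChartGeometry.

(** * Charts *)

Section Pullback.
Context {R : realType}.
Variables (D E : set 'rV[R]_4) (phi : 'rV[R]_4 -> 'rV[R]_4).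
Hypotheses (oD : open D) (oE : open E) (sphi : smooth_mx_on D phi).
Hypothesis phiDE : forall x, D x -> E (phi x).

Let J x : 'M[R]_4 := \matrix_(i, j) pd i (fun y => phi y 0 j) x.

Lemma smooth_jacobian : smooth_mx_on D J.
Proof. by move=> i j; under eq_fun do rewrite mxE; exact: smooth_pd (sphi 0 j). Qed.

Lemma closed_pullback (w : 'rV[R]_4 -> 'M[R]_4) : smooth_mx_on E w ->
  (forall y, E y -> skew_mx (w y)) -> (forall i j k y, E y -> d2 w i j k y = 0) ->
  forall i j k x, D x -> d2 (fun x => J x *m w (phi x) *m (J x)^T) i j k x = 0.
Proof.
move=> sw kw cw i j k x Dx; rewrite d2_cyc.
have sJ := smooth_jacobian; have sJT := smooth_mxT sJ.
have swp : smooth_mx_on D (fun x => w (phi x)) := smooth_mx_comp oD oE sphi phiDE sw.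
have sJw := smooth_mxM oD sJ swp.
pose A m := pdm m J x *m w (phi x) *m (J x)^T.
have dE m : pdm m (fun x => J x *m w (phi x) *m (J x)^T) x =
    pull (J x) (fun l => pdm l w (phi x)) m + (A m - (A m)^T).
  rewrite (pdmM m oD sJw sJT Dx) (pdmM m oD sJ swp Dx) pdmT.
  rewrite (pdm_comp oD oE sphi phiDE m sw Dx) /A.
  have -> : (pdm m J x *m w (phi x) *m (J x)^T)^T = - (J x *m w (phi x) *m (pdm m J x)^T).
    by rewrite !trmx_mul trmxK (kw _ (phiDE Dx)) mulNmx mulmxN !mulmxA.
  have -> : pull (J x) (fun l => pdm l w (phi x)) m =
      J x *m (\sum_j pd m (fun y => phi y 0 j) x *: pdm j w (phi x)) *m (J x)^T.
    rewrite mulmx_sumr mulmx_suml; apply: eq_bigr => l _.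
    by rewrite [J x m l]mxE -scalemxAr -scalemxAl.
  rewrite mulmxDl; move: (_ *m _ *m _) (_ *m _ *m _) (_ *m _ *m _) => a b c.
  by apply/matrixP => u v; rewrite !(mxDE, mxNE); ring.
have AS a b c : A a b c = A b a c.
  rewrite /A -!mulmxA !mxE; apply: eq_bigr => l _; congr (_ * _); rewrite !pdmE.
  have JE u : (fun y => J y u l) = pd u (fun y => phi y 0 l).
    by apply/funext => y; rewrite mxE.
  by rewrite !JE; exact: (pdC a b oD (sphi 0 l) Dx).
have Z := cyc_pull (J x) (fun a b c => esym (etrans (esym (cw a b c _ (phiDE Dx))) (d2_cyc w a b c (phi x)))) i j k.
rewrite /cyc in Z *; rewrite !dE.
have M (p q : 'M[R]_4) u v : (p + (q - q^T)) u v = p u v + (q u v - q v u) by rewrite !mxE.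
rewrite !M (AS k i j) (AS j i k) (AS k j i).
move: Z; set a := pull _ _ i j k; set b := pull _ _ j k i; set c := pull _ _ k i j.
have K (z1 z2 z3 t1 t2 t3 : R) : z1 + z2 + z3 = 0 ->
  z1 + (t1 - t2) + (z2 + (t3 - t1)) + (z3 + (t2 - t3)) = 0 by lra.
exact: K.
Qed.

End Pullback.

Section Atlas.
Context {R : realType} {n : nat} {M : topologicalType} (A : manifold R n M).
Implicit Types (c : chart A) (U : set M) (q : M).

Lemma chart_cover q : exists c, chart_dom c q.
Proof. by move: q; case: A. Qed.

Lemma chart_dom_open c : open (chart_dom c).
Proof. by move: c; case: A. Qed.

Lemma chart_image_open c : open (chart_map c @` chart_dom c).
Proof. by move: c; case: A. Qed.

Lemma chart_mapK c q : chart_dom c q -> chart_inv c (chart_map c q) = q.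
Proof. by move: c q; case: A. Qed.

Lemma chart_map_continuous c : {within chart_dom c, continuous (chart_map c)}.
Proof. by move: c; case: A. Qed.

Lemma chart_inv_continuous c :
  {within chart_map c @` chart_dom c, continuous (chart_inv c)}.
Proof. by move: c; case: A. Qed.

Lemma transition_smooth c c' : smooth_mx_on (coord_dom (chart_dom c') c) (transition c c').
Proof. by move: c c'; case: A. Qed.

Lemma open_preimage (S T : topologicalType) (W : set S) (f : S -> T) (U : set T) :
  open W -> {within W, continuous f} -> open U -> open (W `&` f @^-1` U).
Proof.
move=> oW cf oU; rewrite openE => x [Wx Ux].
have cx : {for x, continuous f}.
  by move: cf; rewrite (continuous_open_subspace f oW); apply; rewrite inE.
apply: filterI; first by move: oW Wx; rewrite openE => /[apply].
by apply: cx; move: oU Ux; rewrite openE => /[apply].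
Qed.

Lemma coord_dom_open c U : open U -> open (coord_dom U c).
Proof.
move=> oU.
have -> : coord_dom U c = (chart_map c @` chart_dom c) `&` chart_inv c @^-1` U.
  apply/seteqP; split => [x [q [cq Uq] <-]|x [[q cq <-]]].
    by split; [exists q|rewrite /= chart_mapK].
  by rewrite /= chart_mapK // => Uq; exists q.
exact: (@open_preimage _ _ _ _ _ (@chart_image_open c) (@chart_inv_continuous c) oU).
Qed.

Lemma coord_dom_sub c U U' : U `<=` U' -> coord_dom U c `<=` coord_dom U' c.
Proof. by move=> UU x [q [cq Uq] <-]; exists q => //; split=> //; exact: UU. Qed.

Lemma transition_chart c c' q : chart_dom c q -> transition c c' (chart_map c q) = chart_map c' q.
Proof. by move=> cq; rewrite /transition chart_mapK. Qed.

Lemma jacobian_chain c c1 c2 q : chart_dom c q -> chart_dom c1 q -> chart_dom c2 q ->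
  Defs.jacobian c c2 (chart_map c q) =
  Defs.jacobian c c1 (chart_map c q) *m Defs.jacobian c1 c2 (chart_map c1 q).
Proof.
move=> cq c1q c2q; pose D := coord_dom (chart_dom c1 `&` chart_dom c2) c.
have oD : open D by apply: coord_dom_open; apply: openI; exact: chart_dom_open.
have oE : open (coord_dom (chart_dom c2) c1) by apply: coord_dom_open; exact: chart_dom_open.
have sphi : smooth_mx_on D (transition c c1).
  apply: smooth_mx_subset (@transition_smooth c c1).
  by apply: coord_dom_sub => y [].
have DE x : D x -> coord_dom (chart_dom c2) c1 (transition c c1 x).
  by move=> [y [cy [c1y c2y]] <-]; rewrite transition_chart //; exists y.
have Dq : D (chart_map c q) by exists q.
apply/matrixP => i j; rewrite [LHS]mxE mxE.
have [_ H] := pd_comp oD oE sphi DE i (@transition_smooth c1 c2 0 j) Dq.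
have -> : pd i (fun y => transition c c2 y 0 j) (chart_map c q) =
    pd i ((fun y => transition c1 c2 y 0 j) \o transition c c1) (chart_map c q).
  apply: (pd_open i oD Dq) => y [y' [cy [c1y c2y]] <-] /=.
  by rewrite !transition_chart.
rewrite H; apply: eq_bigr => k _.
by rewrite [in RHS]mxE [X in _ = _ * X]mxE transition_chart.
Qed.

Lemma jacobian_refl c q : chart_dom c q -> Defs.jacobian c c (chart_map c q) = 1%:M.
Proof.
move=> cq; apply/matrixP => i j; rewrite !mxE -(pd_coord j i (chart_map c q)).
have oD : open (coord_dom setT c) by apply: coord_dom_open; exact: openT.
have Dq : coord_dom setT c (chart_map c q) by exists q.
by apply: (pd_open i oD Dq) => y [y' [cy _] <-]; rewrite transition_chart.
Qed.

Lemma jacobian_unit c c' q : chart_dom c q -> chart_dom c' q ->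
  Defs.jacobian c c' (chart_map c q) \in unitmx.
Proof.
move=> cq c'q; have := jacobian_chain cq c'q cq.
by rewrite (jacobian_refl cq) => /esym /mulmx1_unit [].
Qed.

End Atlas.

Arguments coord_dom_open {R n M A} c {U} oU.

Section HermitianCharts.
Context {R : realType} {M : topologicalType} {A : manifold R 4 M}.
Variables (g I : chart A -> 'rV[R]_4 -> 'M[R]_4) (theta : chart A -> 'rV[R]_4 -> 'cV[R]_4).
Hypotheses (hgI : hermitian_manifold g I) (htheta : lee_form g I theta).
Implicit Types (c : chart A) (q : M).

Definition curv_chart c := curv (Bcon (g c) (I c) (theta c)).

Lemma curvature_condition_chartP : curvature_condition g I theta <->
  forall c i j x, coord_dom setT c x -> curv_chart c i j x = 0.
Proof.
case: hgI => [[[sg _] gp] [[sI _] I2 _] gI]; case: htheta => [[sth _] _].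
have P c := curvature_conditionP (coord_dom_open c openT) (sg c) (sI c) (sth c)
  (fun x Dx => (gp c x Dx).1) (fun x Dx => (gp c x Dx).2) (I2 c) (gI c).
by split=> H c; apply/(P c); exact: H.
Qed.

Lemma bil_congr (b J : 'M[R]_4) : (forall u v, bil b (u *m J) (v *m J) = - bil b u v) ->
  J *m b *m J^T = - b.
Proof.
move=> H; apply/matrixP => k l.
rewrite -bil_delta mxE -(bil_delta b) -H.
by rewrite /bil trmx_mul !mulmxA.
Qed.

Lemma flat_of_closed_frame U (w : 'I_5 -> chart A -> 'rV[R]_4 -> 'M[R]_4) : open U ->
  five_frame U w -> closed_frame U w -> compatible_frame g I U w ->
  forall c i j x, coord_dom U c x -> curv_chart c i j x = 0.
Proof.
move=> oU [w2 _ _] cw kw c.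
case: hgI => [[[sg _] gp] [[sI _] I2 nij] gI]; case: htheta => [[sth _] lee].
apply: (necessity_chart (coord_dom_open c openT) (sg c) (sI c) (sth c)
  (fun x Dx => (gp c x Dx).1) (fun x Dx => (gp c x Dx).2) (I2 c) (gI c) (nij c) (lee c)
  (w := fun a => w a c) (coord_dom_open c oU)).
- exact: coord_dom_sub.
- by move=> a; have [[]] := w2 a.
- by move=> a x Dx; have [_] := w2 a; exact.
- by move=> a b x Dx; have [] := kw c x Dx.
- move=> a x Dx a3; have [_ asd _ _] := kw c x Dx.
  apply: (proj2 ((asd (w a c x)).2 _)).
  exists (fun b => (b == a)%:R).
  rewrite (bigD1 a) //= eqxx scale1r big1 ?addr0 // => b /andP[_ /negbTE ->].
  by rewrite scale0r.
- by move=> a x Dx a3; have [_ _ _ inv] := kw c x Dx; apply: bil_congr; exact: inv.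
- by move=> a x Dx i j k; exact: cw.
Qed.

Lemma unitary_frame_chart c c' q Q : chart_dom c q -> chart_dom c' q ->
  unitary_frame (g c' (chart_map c' q)) (I c' (chart_map c' q)) Q ->
  unitary_frame (g c (chart_map c q)) (I c (chart_map c q))
    (Defs.jacobian c c' (chart_map c q) *m Q).
Proof.
move=> cq c'q uf; case: hgI => [[[_ tg] _] [[_ tI] _ _] _].
have Dq : coord_dom (setT `&` chart_dom c') c (chart_map c q) by exists q.
split.
- by rewrite unitmx_mul (jacobian_unit cq c'q) (uf_unit uf).
- by rewrite (tg _ _ _ Dq) (transition_chart _ cq) (uf_metric uf) trmx_mul !mulmxA.
- rewrite mulmxA (tI _ _ _ Dq) (transition_chart _ cq) -!mulmxA.
  by rewrite (uf_complex uf).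
Qed.

Section LocalFrame.
Variables (c0 : chart A) (x0 : 'rV[R]_4) (r : R) (Q : 'rV[R]_4 -> 'M[R]_4).
Let B := cball x0 r.
Hypothesis sQ : smooth_mx_on B Q.
Hypothesis ufQ : forall x, B x -> unitary_frame (g c0 x) (I c0 x) (Q x).
Hypothesis dQ : forall m i j k x, B x ->
  d2 (fun y => Q y *m E5 m *m (Q y)^T) i j k x = 0.

Definition frame_dom : set M := chart_dom c0 `&` chart_map c0 @^-1` B.

Definition frame_mx c x : 'M[R]_4 := Defs.jacobian c c0 x *m Q (transition c c0 x).

Definition frame_form m c x : 'M[R]_4 := frame_mx c x *m E5 m *m (frame_mx c x)^T.

Lemma frame_dom_open : open frame_dom.
Proof.
apply: (@open_preimage _ _ _ _ _ (@chart_dom_open _ _ _ A c0) (@chart_map_continuous _ _ _ A c0)).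
exact: open_cball.
Qed.

Lemma frame_mx_chart c q : chart_dom c q ->
  frame_mx c (chart_map c q) = Defs.jacobian c c0 (chart_map c q) *m Q (chart_map c0 q).
Proof. by move=> cq; rewrite /frame_mx transition_chart. Qed.

Lemma frame_unitary c x : coord_dom frame_dom c x ->
  unitary_frame (g c x) (I c x) (frame_mx c x).
Proof.
move=> [q [cq [c0q Bq]] <-]; rewrite (frame_mx_chart cq).
by apply: unitary_frame_chart => //; exact: ufQ.
Qed.

Let oB : open B. Proof. exact: open_cball. Qed.
Let oU c : open (coord_dom frame_dom c).
Proof. exact: (coord_dom_open c frame_dom_open). Qed.
Let sphi c : smooth_mx_on (coord_dom frame_dom c) (transition c c0).
Proof.
by apply: smooth_mx_subset (@transition_smooth _ _ _ A c c0); apply: coord_dom_sub => y [].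
Qed.
Let phiB c x : coord_dom frame_dom c x -> B (transition c c0 x).
Proof. by move=> [q [cq [c0q Bq]] <-]; rewrite transition_chart. Qed.

Lemma frame_mx_smooth c : smooth_mx_on (coord_dom frame_dom c) (frame_mx c).
Proof.
exact: (smooth_mxM (oU (c := c)) (smooth_jacobian (sphi (c := c)))
  (smooth_mx_comp (oU (c := c)) oB (sphi (c := c)) (phiB (c := c)) sQ)).
Qed.

Lemma frame_form_smooth m c : smooth_mx_on (coord_dom frame_dom c) (frame_form m c).
Proof.
have sE : smooth_mx_on (coord_dom frame_dom c) (fun=> E5 m : 'M[R]_4) by exact: smooth_mx_cst.
exact: (smooth_mxM (oU (c := c)) (smooth_mxM (oU (c := c)) (frame_mx_smooth (c := c)) sE)
  (smooth_mxT (frame_mx_smooth (c := c)))).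
Qed.

Lemma frame_five : five_frame frame_dom frame_form.
Proof.
split=> [m|m c x Dx|].
- split=> [|c x Dx]; last exact: (skew_congr _ (E5_skew m)).
  split=> [c|c c' x [q [cq [[c0q Bq] c'q]] <-]]; first exact: frame_form_smooth.
  rewrite /frame_form (transition_chart _ cq) (frame_mx_chart cq) (frame_mx_chart c'q).
  by rewrite (jacobian_chain cq c'q c0q) !trmx_mul !mulmxA.
- have uf := uf_unit (frame_unitary Dx).
  by rewrite /frame_form 2!unitmx_mul unitmx_tr uf E5_unit.
- exists (fun i : 'I_5 => (i < 3)%N); move=> i j c x Dx.
  rewrite /frame_form !wedge22_congr !wedge22_E5 eqxx /= expr0 !mul1r.
  by rewrite mulrCA mulrA.
Qed.

Lemma frame_closed : closed_frame frame_dom frame_form.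
Proof.
move=> m c x Dx i j k.
have sE : smooth_mx_on B (fun=> E5 m : 'M[R]_4) by exact: smooth_mx_cst.
have sw := smooth_mxM oB (smooth_mxM oB sQ sE) (smooth_mxT sQ).
have := closed_pullback (oU (c := c)) oB (sphi (c := c)) (phiB (c := c)) sw
  (fun y _ => skew_congr _ (E5_skew m)) (fun i j k y By => dQ m i j k By) i j k Dx.
congr (d2 _ i j k x = 0); apply/funext => y.
by rewrite /frame_form /frame_mx trmx_mul !mulmxA.
Qed.

Lemma frame_compatible : compatible_frame g I frame_dom frame_form.
Proof. by move=> c x Dx; exact: compatible_at (frame_unitary Dx). Qed.

End LocalFrame.
End HermitianCharts.

Theorem proposition4p1 (R : realType) (M : topologicalType)
    (A : manifold R 4 M)
    (g I : chart A -> 'rV[R]_4 -> 'M[R]_4)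
    (theta : chart A -> 'rV[R]_4 -> 'cV[R]_4)
    (hgI : hermitian_manifold g I) (htheta : lee_form g I theta) :
  (forall p : M, exists (U : set M)
       (w : 'I_5 -> chart A -> 'rV[R]_4 -> 'M[R]_4),
     [/\ open_nbhs p U, five_frame U w, closed_frame U w &
         compatible_frame g I U w]) <->
  curvature_condition g I theta.
Proof.
split=> [H|/(curvature_condition_chartP hgI htheta) H p].
  apply/(curvature_condition_chartP hgI htheta) => c i j _ [q [cq _] <-].
  have [U [w [[oU Uq] w5 cw kw]]] := H q.
  by apply: (flat_of_closed_frame hgI htheta oU w5 cw kw); exists q.
have [c0 c0p] := chart_cover A p.
case: (hgI) => [[[sg _] gp] [[sI _] I2 nij] gI]; case: (htheta) => [[sth _] lee].
have Dp : coord_dom setT c0 (chart_map c0 p) by exists p.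
have [r [Q [r0 BD sQ uQ dQ]]] := sufficiency_chart (coord_dom_open c0 openT) (sg c0) (sI c0) (sth c0)
  (fun x Dx => (gp c0 x Dx).1) (fun x Dx => (gp c0 x Dx).2) (I2 c0) (gI c0) (nij c0) (lee c0)
  Dp (H c0).
exists (frame_dom c0 (chart_map c0 p) r), (frame_form c0 Q); split.
- split; first exact: frame_dom_open.
  by split=> //=; rewrite /cball /= subrr normr0.
- exact: (frame_five hgI sQ uQ).
- exact: (frame_closed sQ dQ).
- exact: (frame_compatible hgI uQ).
Qed.
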